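(* Let $b,r,f$ be fixed analytic data on $[0,1]$ and $\gamma>0$ a fixed constant as in the context. There exist constants $c_0\in(0,1)$, $\kappa>0$, $\sigma>0$ and $C>0$, all independent of $\varepsilon_1,\varepsilon_2$ and $p$, such that the following holds for all $p\in\mathbb{N}$, $p\ge1$, and all $0<\varepsilon_1<1$, $0<\varepsilon_2\le1$ satisfying $r-\tfrac{\varepsilon_2}{2}b'\ge\gamma$ on $[0,1]$ and $\varepsilon_2^2\le c_0\,\varepsilon_1$ (that is, $\varepsilon_1\gg\varepsilon_2^2$). Let $\omega=\omega_{BL}(\kappa,p)$ be the Spectral Boundary Layer mesh described in the context, let $u$ be the solution of $$-\varepsilon_1u''(x)+\varepsilon_2b(x)u'(x)+r(x)u(x)=f(x),\quad x\in I=(0,1),\qquad u(0)=u(1)=0,$$ and let $u_p\in V^{\omega}_{p,0}$ be the weak Galerkin solution on the mesh $\omega$, i.e. $\mathcal{A}_p(u_p,v)=(f,v_0)_I$ for all $v=(v_0,v_b)\in V^{\omega}_{p,0}$. Then $$|||u-u_p|||_p\le C\,e^{-\sigma p}.$$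
   Context: Data. $I=(0,1)$, $0<\varepsilon_1,\varepsilon_2\le1$ are parameters. The functions $b,r,f$ do not depend on $\varepsilon_1,\varepsilon_2$ and are analytic on $[0,1]$: there are positive constants $C_0,\gamma_b,\gamma_r,\gamma_f$, independent of $\varepsilon_1,\varepsilon_2$, with $\|b^{(n)}\|_{L^\infty(I)}\le C_0\,n!\,\gamma_b^n$, $\|r^{(n)}\|_{L^\infty(I)}\le C_0\,n!\,\gamma_r^n$, $\|f^{(n)}\|_{L^\infty(I)}\le C_0\,n!\,\gamma_f^n$ for all $n\in\mathbb{N}_0$. Moreover $b>0$ and $r\ge0$ on $[0,1]$, and $r-\tfrac{\varepsilon_2}{2}b'\ge\gamma>0$ on $[0,1]$, with $\gamma$ independent of $\varepsilon_1,\varepsilon_2$. Mesh. The Spectral Boundary Layer mesh $\omega_{BL}(\kappa,p)$ has nodes $\{0,1\}$ if $\kappa p\varepsilon_1^{1/2}\ge 1/2$, and nodes $\{0,\kappa p\varepsilon_1^{1/2},1-\kappa p\varepsilon_1^{1/2},1\}$ if $\kappa p\varepsilon_1^{1/2}<1/2$. Spaces. For a mesh $\omega:0=x_0<x_1<\dots<x_N=1$ put $I_j=(x_{j-1},x_j)$, $h_j=x_j-x_{j-1}$. Let $\mathcal{M}^\omega$ be the set of pairs $v=(v_0,v_b)\in L^2(I)\times\mathbb{R}^{N+1}$ with $v_0|_{I_j}\in H^1(I_j)$ for all $j$ and $v_b=(v_{b,0},\dots,v_{b,N})$. A function $v\in H^1(I)$ is identified with the element $(v,(v(x_0),\dots,v(x_N)))$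 of $\mathcal{M}^\omega$. With $\mathbb{P}_p$ the polynomials of degree at most $p$, let $V^\omega_p=\{v\in\mathcal{M}^\omega: v_0|_{I_j}\in\mathbb{P}_p\ \forall j\}$, $V^\omega_{p,0}=\{v\in V^\omega_p: v_{b,0}=v_{b,N}=0\}$, and $W^\omega_p=\{w\in L^2(I): w|_{I_j}\in\mathbb{P}_p\ \forall j\}$. Weak derivatives. For $v\in\mathcal{M}^\omega$ and $p\in\mathbb{N}_0$, the weak derivative $D_pv\in W^\omega_p$ and weak convection derivative $D^c_pv\in W^\omega_p$ are the unique elements such that, for all $q\in\mathbb{P}_p$ and $j=1,\dots,N$, $$\int_{I_j}D_pv\,q=-\int_{I_j}v_0q'+v_{b,j}q(x_j)-v_{b,j-1}q(x_{j-1}),$$ $$\int_{I_j}D^c_pv\,q=-\int_{I_j}v_0(bq)'+v_{b,j}(bq)(x_j)-v_{b,j-1}(bq)(x_{j-1}).$$ Bilinear form. For $p\ge1$, with $(\cdot,\cdot)_I$ the $L^2(I)$ inner product, $$\mathcal{A}_p(w,v)=\varepsilon_1(D_{p-1}w,D_{p-1}v)_I+\varepsilon_2(D^c_pw,v_0)_I+(rw_0,v_0)_I+S(w,v)+S_c(w,v),$$ $$S(w,v)=\sum_{j=1}^N\sigma_j\Big[(w_0(x_j^-)-w_{b,j})(v_0(x_j^-)-v_{b,j})+(w_0(x_{j-1}^+)-w_{b,j-1})(v_0(x_{j-1}^+)-v_{b,j-1})\Big],$$ $$S_c(w,v)=\sum_{j=1}^N\varepsilon_2b(x_j)(w_0(x_j^-)-w_{b,j})(v_0(x_j^-)-v_{b,j}),$$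 where the penalty parameters are $\sigma_j=\varepsilon_1p^2/h_j$ and $x_j^\mp$ denote one-sided limits from the left/right. Norm. For $v\in\mathcal{M}^\omega$, $$|||v|||_p^2=\varepsilon_1\|D_{p-1}v\|_{L^2(I)}^2+\|v_0\|_{L^2(I)}^2+S(v,v)+S_c(v,v)+|v|_J^2,\qquad |v|_J^2=\sum_{j=1}^Nw_j\,\varepsilon_2b(x_j)\,(v_0(x_j^-)-v_{b,j})^2,$$ with $w_j=1$ for $j=1,\dots,N-1$ and $w_N=1/2$. *)

(* Defs.v *)
From HB Require Import structures.
From mathcomp Require Import all_boot all_order all_algebra.
From mathcomp Require Import all_classical all_reals all_analysis.
From mathcomp Require Import lra.

Set Implicit Arguments.
Unset Strict Implicit.
Unset Printing Implicit Defensive.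

Import Order.TTheory GRing.Theory Num.Theory.
Import numFieldNormedType.Exports.

Local Open Scope classical_set_scope.
Local Open Scope ring_scope.

Section FunctionSpaces.
Context {R : realType}.
Notation mu := (@lebesgue_measure R).
Implicit Types (a b : R) (g v : R -> R).

(* [g \_ D] extends [g|_D] by zero, so the norms below are those of L^p(D). *)
Definition L2 (D : set R) g : Prop := g \_ D \in Lfun mu 2%:E.

Definition inner (D : set R) g1 g2 : R := \int[mu]_(x in D) (g1 x * g2 x).

Definition test_function a b (phi : R -> R) : Prop :=
  (forall n (x : R), derivable (derive1n n phi) x 1) /\
  exists c d, [/\ a < c, d < b & forall x : R, phi x != 0 -> c <= x <= d].

(* H^1(a, b); its elements are given by their continuous representative, for
   which the one-sided limits at [a] and [b] are the traces. *)
Definition H1 a b v : Prop :=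
  [/\ L2 `]a, b[ v,
      {in `]a, b[, forall x : R, {for x, continuous v}} &
      exists2 g, L2 `]a, b[ g &
        forall phi, test_function a b phi ->
          \int[mu]_(x in `]a, b[) (v x * derive1 phi x) =
          - \int[mu]_(x in `]a, b[) (g x * phi x)].

(* The derivatives are taken on the open interval only, so that values of [g]
   outside [0, 1] are irrelevant; [g 0] and [g 1] are the continuous
   extensions. *)
Definition analytic01 (C gam : R) g : Prop :=
  [/\ {within `[0, 1], continuous g},
      forall n (x : R), x \in `]0, 1[ -> derivable (derive1n n g) x 1 &
      forall n, (Lnorm mu +oo (EFin \o ((derive1n n g) \_ `]0%R, 1%R[))
                 <= (C * n`!%:R * gam ^+ n)%:E)%E].

End FunctionSpaces.

Section WeakGalerkin.
Context {R : realType}.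
Notation mu := (@lebesgue_measure R).

Record mesh := Mesh { nel : nat ; nodes : (nel.+1).-tuple R }.

Definition is_mesh (w : mesh) : Prop :=
  [/\ tnth (nodes w) ord0 = 0, tnth (nodes w) ord_max = 1 &
      sorted <%R (nodes w)].

Definition BL_mesh (kappa : R) (p : nat) (eps1 : R) : mesh :=
  let t := kappa * p%:R * Num.sqrt eps1 in
  if 1 / 2 <= t then @Mesh 1 [tuple 0; 1]
  else @Mesh 3 [tuple 0; t; 1 - t; 1].

Lemma BL_meshP kappa p eps1 : 0 < kappa -> (0 < p)%N -> 0 < eps1 ->
  is_mesh (BL_mesh kappa p eps1).
Proof.
move=> k0 p0 e0; rewrite /BL_mesh; set t := (kappa * _ * _).
have t0 : 0 < t by rewrite !mulr_gt0 ?ltr0n ?sqrtr_gt0.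
case: (leP (1 / 2) t) => ht; split => //=; first by rewrite ltr01.
by rewrite t0 /= andbT; apply/andP; split; lra.
Qed.

Section OnMesh.
Variable w : mesh.
Notation N := (nel w).

(* The element numbered j + 1 for j : 'I_N has end points [xl j] = x_j and
   [xr j] = x_(j+1), whose indices in 'I_(N + 1) are [il j] and [ir j]. *)
Definition il (j : 'I_N) : 'I_N.+1 := widen_ord (leqnSn N) j.
Definition ir (j : 'I_N) : 'I_N.+1 := lift ord0 j.
Definition xl (j : 'I_N) : R := tnth (nodes w) (il j).
Definition xr (j : 'I_N) : R := tnth (nodes w) (ir j).
Definition elt (j : 'I_N) : set R := `]xl j, xr j[.
Definition meshsize (j : 'I_N) : R := xr j - xl j.

Definition wgfun : Type := ((R -> R) * 'rV[R]_N.+1)%type.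

Definition bl (v : wgfun) (j : 'I_N) : R := v.2 0 (il j).
Definition br (v : wgfun) (j : 'I_N) : R := v.2 0 (ir j).
Definition tracel (v : wgfun) (j : 'I_N) : R := lim (v.1 @ (xl j)^'+).
Definition tracer (v : wgfun) (j : 'I_N) : R := lim (v.1 @ (xr j)^'-).

Definition in_M (v : wgfun) : Prop :=
  L2 `]0, 1[ v.1 /\ forall j, H1 (xl j) (xr j) v.1.

Definition of_H1 (u : R -> R) : wgfun :=
  (u, \row_j u (tnth (nodes w) j)).

Definition piecewise_poly (p : nat) (g : R -> R) : Prop :=
  forall j, exists2 q : {poly R},
    (size q <= p.+1)%N & forall x : R, elt j x -> g x = q.[x].

Definition in_V (p : nat) (v : wgfun) : Prop :=
  in_M v /\ piecewise_poly p v.1.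

Definition in_V0 (p : nat) (v : wgfun) : Prop :=
  [/\ in_V p v, v.2 0 ord0 = 0 & v.2 0 ord_max = 0].

Definition in_W (p : nat) (g : R -> R) : Prop :=
  L2 `]0, 1[ g /\ piecewise_poly p g.

Definition is_weak_deriv (p : nat) (v : wgfun) (d : R -> R) : Prop :=
  in_W p d /\
  forall (q : {poly R}) (j : 'I_N), (size q <= p.+1)%N ->
    \int[mu]_(x in elt j) (d x * q.[x]) =
      - (\int[mu]_(x in elt j) (v.1 x * (deriv q).[x]))
      + br v j * q.[xr j] - bl v j * q.[xl j].

Definition is_weak_conv_deriv (b : R -> R) (p : nat) (v : wgfun)
    (d : R -> R) : Prop :=
  in_W p d /\
  forall (q : {poly R}) (j : 'I_N), (size q <= p.+1)%N ->
    let bq := fun x => b x * q.[x] in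
    \int[mu]_(x in elt j) (d x * q.[x]) =
      - (\int[mu]_(x in elt j) (v.1 x * derive1 bq x))
      + br v j * bq (xr j) - bl v j * bq (xl j).

(* Unique up to the values at the nodes and outside (0, 1), which are never
   used. *)
Definition wderiv (p : nat) (v : wgfun) : R -> R :=
  xget (fun=> 0) [set d | is_weak_deriv p v d].

Definition wconv (b : R -> R) (p : nat) (v : wgfun) : R -> R :=
  xget (fun=> 0) [set d | is_weak_conv_deriv b p v d].

Section Form.
Variables (eps1 eps2 : R) (b r : R -> R) (p : nat).

Definition penalty (j : 'I_N) : R := eps1 * p%:R ^+ 2 / meshsize j.

Definition stab (u v : wgfun) : R :=
  \sum_(j < N) penalty j *
    ((tracer u j - br u j) * (tracer v j - br v j)
     + (tracel u j - bl u j) * (tracel v j - bl v j)).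

Definition stabc (u v : wgfun) : R :=
  \sum_(j < N) eps2 * b (xr j) * (tracer u j - br u j) * (tracer v j - br v j).

Definition bilin (u v : wgfun) : R :=
  eps1 * inner `]0, 1[ (wderiv p.-1 u) (wderiv p.-1 v)
  + eps2 * inner `]0, 1[ (wconv b p u) v.1
  + inner `]0, 1[ (fun x => r x * u.1 x) v.1
  + stab u v + stabc u v.

Definition jump_weight (j : 'I_N) : R := if j.+1 == N then 1 / 2 else 1.

Definition jump2 (v : wgfun) : R :=
  \sum_(j < N) jump_weight j * eps2 * b (xr j) * (tracer v j - br v j) ^+ 2.

Definition wgnorm (v : wgfun) : R :=
  Num.sqrt (eps1 * inner `]0, 1[ (wderiv p.-1 v) (wderiv p.-1 v)
            + inner `]0, 1[ v.1 v.1 + stab v v + stabc v v + jump2 v).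

Definition wg_solution (f : R -> R) (u : wgfun) : Prop :=
  in_V0 p u /\ forall v, in_V0 p v -> bilin u v = inner `]0, 1[ f v.1.

End Form.
End OnMesh.

Definition bvp_solution (eps1 eps2 : R) (b r f u : R -> R) : Prop :=
  [/\ {within `[0, 1], continuous u}, u 0 = 0, u 1 = 0 &
      forall x : R, x \in `]0, 1[ ->
        [/\ derivable u x 1, derivable (derive1 u) x 1 &
            - eps1 * derive1n 2 u x + eps2 * b x * derive1 u x + r x * u x
            = f x]].

End WeakGalerkin.

Arguments mesh : clear implicits.

(* Main.v *)
Require Import Defs.
From mathcomp Require Import all_boot all_order all_algebra.
From mathcomp Require Import all_classical all_reals all_analysis.
From mathcomp Require Import measurable_realfun ess_sup_inf.
From mathcomp Require Import ring lra.

Set Implicit Arguments.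
Unset Strict Implicit.
Unset Printing Implicit Defensive.

Import Order.TTheory GRing.Theory Num.Theory.
Import numFieldNormedType.Exports.

Local Open Scope classical_set_scope.
Local Open Scope ring_scope.

(* Write s = sqrt eps1 and L v = - eps1 v'' + eps2 b v' + r v, with eps2 <= th s
   for a small th. Compare u and u_p with a piecewise polynomial psi that is
   globally C^1 and vanishes at 0 and 1. Since psi is C^1, the nodal terms
   telescope when the scheme is tested with psi - u_p, and coercivity bounds
   |||psi - u_p||| by the sup norm rho of L psi - f over the open elements; the
   same energy argument, with u in place of u_p, bounds u - psi. It remains to
   find psi with rho exponentially small in p.

   The equation gives |u^(n)| / n! <= A K^n prod_(k <= n) (1 + 1 / (k s)), so u is
   analytic at the scale s p on which the layer elements live and, rescaled to
   (0, 1), is approximated exponentially well there (on the whole of (0, 1) if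
   the mesh has only one element). On the inner element psi approximates w, a
   partial sum with about p terms of the formal expansion of u in powers of s,
   whose derivatives are bounded independently of s. By the maximum principle
   u - w decays like exp(- be dist / s) away from the boundary, and therefore is
   exponentially small at the layer points; a quadratic correction on each layer
   element then restores the C^1 matching. *)

(** * Bounded continuous functions on open intervals *)

(** A C^1 comparison function is worth its price because the flux terms, e1 times its slope times a
    nodal error, are then single valued at the nodes; only the interior residual is left, and the
    L^2 part of the norm absorbs it. The price is paid on the layer elements, where a boundary
    value, a matching value and a matching slope are imposed: this takes a quadratic, so p = 1 is
    treated apart, with the comparison function 0. The bound eps2 <= th s makes convection a
    perturbation at the scale s in three ways: eps2 <= s puts it on a par with the other terms in
    every scaled estimate, eps2 C0 <= s / 2 lets the slope bound absorb it, and eps2 sup |b'| <= gam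
    turns the hypothesis on r - eps2 b' / 2 into r >= gam / 2. The expansion may have M terms only
    while M s stays small. Three elements occur only when kap p s < 1 / 2, so M proportional to p is
    allowed, and its truncation error exp(- M) is exponential in p. The constant kap is fixed after
    the approximation rate on the layers, which does not depend on it. *)

Section Calculus.
Context {R : realType}.
Notation mu := (@lebesgue_measure R).
Implicit Types (a b x y M : R) (f g F : R -> R).

(** The class of all integrands on an element. Derivatives of the solution are known only inside (0,
    1), and continuity with a bound on the open interval already gives integrability. *)
Definition bdcont a b f : Prop :=
  (forall x, a < x < b -> {for x, continuous f}) /\
  exists M, forall x, a < x < b -> `|f x| <= M.

Lemma is_derive_cvg f x d : is_derive x 1 f d -> {for x, continuous f}.
Proof.
by move=> h; apply: differentiable_continuous; apply/derivable1_diffP.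
Qed.

Lemma nbhs_oo a b x : a < x < b -> \forall y \near x, a < y < b.
Proof.
move=> xab; have := @near_in_itvoo R a b x; rewrite in_itv => /(_ xab).
by apply: filterS => y; rewrite in_itv.
Qed.

Lemma bdcont_eq a b f g : (forall x, a < x < b -> f x = g x) ->
  bdcont a b f -> bdcont a b g.
Proof.
move=> fg [cf [M Mf]]; split; last first.
  by exists M => x xab; rewrite -fg ?Mf.
move=> x xab; rewrite /prop_for /continuous_at -(fg x xab); apply: cvg_trans (cf x xab).
apply: near_eq_cvg; near=> y; rewrite fg //.
by near: y; exact: nbhs_oo.
Unshelve. all: by end_near. Qed.

Lemma bdcont_cst a b (c : R) : bdcont a b (fun=> c).
Proof. by split=> [x _|]; [exact: cvg_cst | exists `|c|]. Qed.

Lemma bdcontD a b f g :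
  bdcont a b f -> bdcont a b g -> bdcont a b (fun x => f x + g x).
Proof.
move=> [cf [M Mf]] [cg [M' Mg]]; split=> [x xab|].
  by apply: cvgD; [exact: cf | exact: cg].
by exists (M + M') => x xab; rewrite (le_trans (ler_normD _ _)) ?lerD ?Mf ?Mg.
Qed.

Lemma bdcontM a b f g :
  bdcont a b f -> bdcont a b g -> bdcont a b (fun x => f x * g x).
Proof.
move=> [cf [M Mf]] [cg [M' Mg]]; split=> [x xab|].
  by apply: cvgM; [exact: cf | exact: cg].
by exists (M * M') => x xab; rewrite normrM ler_pM ?Mf ?Mg.
Qed.

Lemma bdcontN a b f : bdcont a b f -> bdcont a b (fun x => - f x).
Proof.
move=> hf; apply: (@bdcont_eq a b (fun x => -1 * f x)).
  by move=> x _; rewrite mulN1r.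
exact: (bdcontM (bdcont_cst _ _ _)).
Qed.

Lemma bdcontB a b f g :
  bdcont a b f -> bdcont a b g -> bdcont a b (fun x => f x - g x).
Proof. by move=> hf /bdcontN; exact: bdcontD. Qed.

Lemma bdcont_within a b f : a < b -> {within `[a, b], continuous f} -> bdcont a b f.
Proof.
move=> ab /[dup] cf /(continuous_within_itvP f ab) [ci _ _]; split.
  by move=> x xab; apply: ci; rewrite in_itv.
have [c _ hc] := EVT_max (ltW ab) cf.
have [d _ hd] := EVT_min (ltW ab) cf.
exists (`|f c| + `|f d|) => x xab.
have xI : x \in `[a, b] by rewrite in_itv /=; case/andP: xab => /ltW -> /ltW.
have h1 : - `|f d| <= f x by rewrite (le_trans _ (hd _ xI)) // lerNl -normrN ler_norm.
have h2 : f x <= `|f c| by rewrite (le_trans (hc _ xI)) // ler_norm.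
rewrite ler_norml; apply/andP; split; have := normr_ge0 (f c);
  have := normr_ge0 (f d); lra.
Qed.

Lemma bdcont_horner a b (p : {poly R}) : bdcont a b (fun x => p.[x]).
Proof.
have [ab|ba] := ltP a b; last by split=> [|]; [|exists 0] => x /andP[/lt_trans h/h]; rewrite ltNge ba.
by apply: bdcont_within => //; apply: continuous_subspaceT => x; exact: continuous_horner.
Qed.

Lemma bdcontW a b c d f : a <= c -> d <= b -> bdcont a b f -> bdcont c d f.
Proof.
move=> ac db [cf [M Mf]].
have h x : c < x < d -> a < x < b.
  by case/andP => cx xd; rewrite (le_lt_trans ac) // (lt_le_trans xd).
by split=> [x /h/cf //|]; exists M => x /h/Mf.
Qed.

Lemma bdcont_integrable a b f :
  bdcont a b f -> mu.-integrable `]a, b[ (EFin \o f).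
Proof.
move=> [cf [M Mf]]; apply: measurable_bounded_integrable => //.
- rewrite /= lebesgue_measure_itv /=; case: ifP => _; rewrite ?ltry //.
- apply: open_continuous_measurable_fun; first exact: interval_open.
  by move=> x; rewrite inE /= in_itv /= => /cf.
- by exists M; split; [exact: num_real | move=> N MN x /=; rewrite in_itv => /= /Mf/le_trans; apply; exact: ltW].
Qed.

Lemma bdcont_RintD a b f g : bdcont a b f -> bdcont a b g ->
  \int[mu]_(x in `]a, b[) (f x + g x) =
  \int[mu]_(x in `]a, b[) f x + \int[mu]_(x in `]a, b[) g x.
Proof. by move=> /bdcont_integrable hf /bdcont_integrable hg; rewrite RintegralD. Qed.

Lemma bdcont_RintZ a b f (c : R) : bdcont a b f ->
  \int[mu]_(x in `]a, b[) (c * f x) = c * \int[mu]_(x in `]a, b[) f x.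
Proof. by move=> /bdcont_integrable hf; rewrite RintegralZl. Qed.

Lemma eq_Rint_oo a b f g : (forall x, a < x < b -> f x = g x) ->
  \int[mu]_(x in `]a, b[) f x = \int[mu]_(x in `]a, b[) g x.
Proof.
by move=> fg; apply: eq_Rintegral => x; rewrite inE /= in_itv => /fg.
Qed.

Lemma le_Rint_oo a b f g : bdcont a b f -> bdcont a b g ->
  (forall x, a < x < b -> f x <= g x) ->
  \int[mu]_(x in `]a, b[) f x <= \int[mu]_(x in `]a, b[) g x.
Proof.
move=> /bdcont_integrable hf /bdcont_integrable hg fg; exact: le_Rintegral.
Qed.

Lemma Rint_oo_cst a b (c : R) : a <= b ->
  \int[mu]_(x in `]a, b[) c = c * (b - a).
Proof.
move=> ab; rewrite Rintegral_cst //; congr (_ * _).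
rewrite /= lebesgue_measure_itv /= lte_fin; by case: ltgtP ab => //= -> _; rewrite subrr.
Qed.

Lemma Rint_oo_norm_le a b f M : a <= b -> bdcont a b f ->
  (forall x, a < x < b -> `|f x| <= M) ->
  `|\int[mu]_(x in `]a, b[) f x| <= M * (b - a).
Proof.
move=> ab hf fM; rewrite -Rint_oo_cst // ler_norml; apply/andP; split.
  rewrite lerNl -mulN1r -bdcont_RintZ //.
  apply: le_Rint_oo; [|exact: bdcont_cst|].
    exact: (bdcontM (bdcont_cst _ _ _)).
  by move=> x /fM; rewrite ler_norml mulN1r lerNl => /andP[].
apply: le_Rint_oo => //; first exact: bdcont_cst.
by move=> x /fM; rewrite ler_norml => /andP[].
Qed.

Lemma Rint_oo_split a b c f : a < c < b -> bdcont a b f ->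
  \int[mu]_(x in `]a, b[) f x =
  \int[mu]_(x in `]a, c[) f x + \int[mu]_(x in `]c, b[) f x.
Proof.
move=> /andP[ac cb] hf; have hi := bdcont_integrable hf.
rewrite -(@Rintegral_itvB _ _ (BRight a) (BLeft b) c) ?bnd_simp ?(ltW ac) //.
have <- : \int[mu]_(x in `]a, c[) f x = \int[mu]_(x in `]a, c]) f x.
  rewrite Rintegral_itv_bndo_bndc //.
  by apply: bdcont_integrable; apply: bdcontW hf => //; exact: ltW.
by rewrite addrC subrK.
Qed.

Lemma derive_within a b f df : (forall x, a <= x <= b -> is_derive x 1 f (df x)) ->
  {within `[a, b], continuous f}.
Proof.
move=> h; apply: continuous_in_subspaceT => x; rewrite inE /= in_itv => /h.
exact: is_derive_cvg.
Qed.

(* [F] is not assumed continuous at [a] and [b]: only the limits [Fa] and [Fb]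
   matter, and [F'] need not extend to the end points. *)
Lemma FTC_open a b F f (Fa Fb : R) : a < b ->
  (forall x, a < x < b -> is_derive x 1 F (f x)) -> bdcont a b f ->
  F x @[x --> a^'+] --> Fa -> F x @[x --> b^'-] --> Fb ->
  \int[mu]_(x in `]a, b[) f x = Fb - Fa.
Proof.
move=> ab dF hf Fal Fbl; have [cf [M0 Mf]] := hf.
pose M := `|M0| + 1.
have M_gt0 : 0 < M by rewrite ltr_pwDr.
have {}Mf x : a < x < b -> `|f x| <= M.
  by move=> /Mf /le_trans; apply; rewrite (le_trans (ler_norm _)) // lerDl.
apply/eqP; rewrite -subr_eq0 -normr_le0; apply/ler_addgt0Pl => e e_gt0.
rewrite addr0.
have e4 : 0 < e / 4 by lra.
have [c [ac cb cM cF]] : exists c, [/\ a < c, c < (a + b) / 2, c - a <= e / 4 / M & `|Fa - F c| < e / 4].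
  near a^'+ => c; exists c; split => //.
  - near: c; apply: nbhs_right_lt; lra.
  - have : c <= a + e / 4 / M by near: c; apply: nbhs_right_le; rewrite ltrDl divr_gt0.
    lra.
  - near: c; move/cvgrPdist_lt: Fal; exact.
have [d [dc db dM dF']] : exists d, [/\ (a + b) / 2 < d, d < b, b - d <= e / 4 / M & `|Fb - F d| < e / 4].
  near b^'- => d; exists d; split => //.
  - near: d; apply: nbhs_left_gt; lra.
  - have : b - e / 4 / M <= d by near: d; apply: nbhs_left_ge; rewrite gtrBl divr_gt0.
    lra.
  - near: d; move/cvgrPdist_lt: Fbl; exact.
have cd : c < d by lra.
have inab x : c <= x <= d -> a < x < b by move=> /andP[]; lra.
rewrite (@Rint_oo_split a b c) //; last by lra.
rewrite (@Rint_oo_split c b d); [|lra|apply: bdcontW hf; lra].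
have -> : \int[mu]_(x in `]c, d[) f x = F d - F c.
  rewrite Rintegral_itv_bndo_bndc; last by apply: bdcont_integrable; apply: bdcontW hf; lra.
  rewrite Rintegral_itv_obnd_cbnd; last first.
    apply: (@integrableS _ _ _ mu `]a, b[) => //; last exact: bdcont_integrable.
    by move=> x /=; rewrite !in_itv /= => /andP[? ?]; apply: inab; rewrite ltW.
  rewrite /Rintegral (@continuous_FTC2 _ f F c d) //.
  - by apply: continuous_in_subspaceT => x; rewrite inE /= in_itv => /inab/cf.
  - have cFF x : c <= x <= d -> {for x, continuous F} by move=> /inab/dF; exact: is_derive_cvg.
    split.
    + move=> x; rewrite in_itv /= => /andP[? ?].
      by have [] := dF x (inab x _); rewrite ?ltW.
    + by apply: cvg_at_right_filter; apply: cFF; rewrite lexx ltW.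
    + by apply: cvg_at_left_filter; apply: cFF; rewrite lexx ltW.
  - move=> x; rewrite in_itv /= => /andP[? ?].
    rewrite derive1E; have [| _ ->] // := dF x.
    by apply: inab; rewrite !ltW.
have h1 : `|\int[mu]_(x in `]a, c[) f x| <= e / 4.
  apply: (@le_trans _ _ (M * (c - a))).
    apply: Rint_oo_norm_le; [exact: ltW| apply: bdcontW hf; lra|].
    by move=> x /andP[? ?]; apply: Mf; lra.
  by rewrite mulrC -ler_pdivlMr.
have h2 : `|\int[mu]_(x in `]d, b[) f x| <= e / 4.
  apply: (@le_trans _ _ (M * (b - d))).
    apply: Rint_oo_norm_le; [exact: ltW| apply: bdcontW hf; lra|].
    by move=> x /andP[? ?]; apply: Mf; lra.
  by rewrite mulrC -ler_pdivlMr.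
move: h1 h2 cF dF' => {Fal Fbl dF inab}.
set I1 := Rintegral _ _ _; set I2 := Rintegral _ _ _.
rewrite !ler_norml !ltr_norml; lra.
Unshelve. all: by end_near. Qed.

(** The order of [x] and [y] is left free, and the bound on [|x - z|] serves Taylor remainders,
    where a power of [x - z] has to be controlled by the distance to the center. *)
Lemma MVT_between a b f df : (forall x, a < x < b -> is_derive x 1 f (df x)) ->
  forall x y, a < x < b -> a < y < b ->
  exists z, [/\ a < z < b, `|x - z| <= `|x - y| & f x - f y = df z * (x - y)].
Proof.
move=> dfh x y xab yab; case: (leP y x) => [yx|/ltW xy].
  have [z zxy E] : exists2 c, c \in `[y, x] & f x - f y = df c * (x - y).
    apply: MVT_segment => //.
      by move=> z; rewrite in_itv /= => /andP[? ?]; apply: dfh; lra.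
    by apply: (@derive_within _ _ _ df) => z /andP[? ?]; apply: dfh; lra.
  move: zxy; rewrite in_itv /= => /andP[? ?]; exists z; split => //; first lra.
  by rewrite !ger0_norm; lra.
have [z zxy E] : exists2 c, c \in `[x, y] & f y - f x = df c * (y - x).
  apply: MVT_segment => //.
    by move=> z; rewrite in_itv /= => /andP[? ?]; apply: dfh; lra.
  by apply: (@derive_within _ _ _ df) => z /andP[? ?]; apply: dfh; lra.
move: zxy; rewrite in_itv /= => /andP[? ?]; exists z; split; first lra.
  by rewrite !ler0_norm; lra.
by rewrite -[LHS]opprB E -mulrN opprB.
Qed.

Lemma lip_oo a b f df M : (forall x, a < x < b -> is_derive x 1 f (df x)) ->
  (forall x, a < x < b -> `|df x| <= M) ->
  forall x y, a < x < b -> a < y < b -> `|f x - f y| <= M * `|x - y|.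
Proof.
move=> dfh dM x y xab yab; have [z [zab _ ->]] := MVT_between dfh xab yab.
by rewrite normrM ler_wpM2r // dM.
Qed.

(** If [|f x| > B], continuity keeps this true on a ball around [x]; the ball would lie in the
    exceptional null set, yet it has positive measure. *)
Lemma Lnorm_pointwise f (B : R) :
  (forall x, 0 < x < 1 -> {for x, continuous f}) ->
  (Lnorm mu +oo (EFin \o (f \_ `]0%R, 1%R[)) <= B%:E)%E ->
  forall x, 0 < x < 1 -> `|f x| <= B.
Proof.
move=> cf; rewrite unlock => + x x01.
have mu0 : (0 < mu setT)%E by rewrite -set_itvNyy lebesgue_measure_itv /= lt0y.
case: ifPn => [_|/negP/(_ mu0) //] => /ess_supP [N [mN N0 hN]].
rewrite leNgt; apply/negP => Bx.
have /= : \forall y \near x, 0 < y < 1 /\ B < `|f y|.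
  apply: filterI; first exact: nbhs_oo.
  by apply: (cvgr_gt _ (cvg_norm (cf x x01))).
move=> /nbhs_ballP [e /= e0 he].
have : (mu (ball x e) <= mu N)%E.
  apply: le_measure; rewrite ?inE //; first exact: measurable_ball.
  move=> y /he [y01 By]; apply: hN => /=.
  rewrite patchE mem_set /= ?in_itv // lee_fin; apply/negP; rewrite -ltNge //.
have : (0 < mu (ball x e))%E by rewrite lebesgue_measure_ball ?ltW // lte_fin mulrn_wgt0.
by rewrite N0 => /lt_le_trans h/h; rewrite ltxx.
Qed.

End Calculus.

(** * Polynomial approximation of analytic functions *)

Section Jets.
Context {R : realType}.
Implicit Types (a b x y t A g : R) (c : nat -> R -> R).

(* [c n] plays the role of the n-th derivative of [c 0] divided by n!; with
   this normalisation products are Cauchy products, without binomials. *)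
Definition jet a b c : Prop := forall n x, a < x < b ->
  is_derive x 1 (c n) (n.+1%:R * c n.+1 x).

Definition jbound a b A g c : Prop := forall n x, a < x < b ->
  `|c n x| <= A * g ^+ n.

Definition taylor c m t : {poly R} :=
  \sum_(i < m.+1) c i t *: ('X - t%:P) ^+ i.

Lemma horner_taylor c m t x :
  (taylor c m t).[x] = \sum_(i < m.+1) c i t * (x - t) ^+ i.
Proof. by rewrite horner_sum; apply: eq_bigr => i _; rewrite !hornerE. Qed.

Lemma size_taylor c m t : (size (taylor c m t) <= m.+1)%N.
Proof.
apply: (leq_trans (size_sum _ _ _)); apply/bigmax_leqP => i _.
by apply: (leq_trans (size_scale_leq _ _)); rewrite size_exp_XsubC.
Qed.

(* The derivative of the Taylor polynomial with respect to its center
   telescopes. *)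
Lemma is_derive_taylor_center a b c m x t : jet a b c -> a < t < b ->
  is_derive t 1 (fun s => \sum_(i < m.+1) c i s * (x - s) ^+ i)
    (m.+1%:R * c m.+1 t * (x - t) ^+ m).
Proof.
move=> cj tab; elim: m => [|m IHm].
  rewrite (_ : (fun s => _) = c 0%N); last first.
    by apply/funext => s; rewrite big_ord1 expr0 mulr1.
  by rewrite expr0 mulr1; exact: cj.
under eq_fun do rewrite big_ord_recr /=.
have h := cj m.+1 t tab.
have -> : m.+2%:R * c m.+2 t * (x - t) ^+ m.+1 =
   m.+1%:R * c m.+1 t * (x - t) ^+ m +
   (c m.+1 t *: (m.+1%:R * (x - t) ^+ m *: (-1)) +
   (x - t) ^+ m.+1 *: (m.+2%:R * c m.+2 t)).
  by rewrite !scalerAl /GRing.scale /=; ring.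
apply: is_deriveD; apply: is_deriveM.
have -> : m.+1%:R * (x - t) ^+ m *: (-1) = (m.+1%:R * (x - t) ^+ m) *: (-1 : R) by [].
have hx : is_derive t 1 (fun s => x - s) (-1).
  rewrite -[-1]add0r; apply: is_deriveD.
rewrite (_ : (fun s => _) = (fun s => x - s) ^+ m.+1); last first.
  by apply/funext => s; rewrite fctE.
exact: (@is_deriveX R R (fun s => x - s) m.+1 t 1 (-1) hx).
Qed.

(** Mean value theorem in the center of expansion: with center [x] the Taylor polynomial takes the
    value [c 0 x] at [x]. *)
Lemma taylor_error a b c m A g x t : jet a b c -> jbound a b A g c ->
  a < x < b -> a < t < b ->
  `|c 0%N x - (taylor c m t).[x]| <= m.+1%:R * A * (g * `|x - t|) ^+ m.+1.
Proof.
move=> cj cb xab tab; rewrite horner_taylor.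
pose phi s := \sum_(i < m.+1) c i s * (x - s) ^+ i.
have -> : c 0%N x = phi x.
  rewrite /phi big_ord_recl expr0 mulr1 big1 ?addr0 // => i _.
  by rewrite subrr expr0n mulr0.
have dphi s : a < s < b -> is_derive s 1 phi (m.+1%:R * c m.+1 s * (x - s) ^+ m).
  exact: is_derive_taylor_center.
have [z [zab zx E]] := MVT_between dphi xab tab.
rewrite -/(phi t) E !normrM normrX ger0_norm //.
rewrite exprMn [X in _ <= _ * (_ * X)]exprSr !mulrA ler_wpM2r // ler_pM //.
  by rewrite -mulrA ler_wpM2l // cb.
by rewrite lerXn2r ?nnegrE.
Qed.

Definition bern n k : {poly R} := 'C(n, k)%:R *: ('X ^+ k * (1 - 'X) ^+ (n - k)).

Lemma horner_bern n k x : (bern n k).[x] = 'C(n, k)%:R * (x ^+ k * (1 - x) ^+ (n - k)).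
Proof. by rewrite /bern !hornerE. Qed.

Lemma bern_ge0 n k x : 0 <= x <= 1 -> 0 <= (bern n k).[x].
Proof.
by move=> /andP[? ?]; rewrite horner_bern !mulr_ge0 ?exprn_ge0 ?subr_ge0.
Qed.

Lemma sum_bern n x : \sum_(k < n.+1) (bern n k).[x] = 1.
Proof.
under eq_bigr do rewrite horner_bern mulr_natl [x ^+ _ * _]mulrC.
by rewrite -exprDn subrK expr1n.
Qed.

Lemma size_bern n k : (k <= n)%N -> (size (bern n k) <= n.+1)%N.
Proof.
move=> kn; apply: (leq_trans (size_scale_leq _ _)).
apply: (leq_trans (size_polyMleq _ _)); rewrite size_polyXn addSn /=.
apply: (@leq_trans (k + (n - k).+1)%N); last by rewrite addnS subnKC.
rewrite leq_add2l; apply: (leq_trans (size_poly_exp_leq _ _)).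
have -> : 1 - 'X = - ('X - 1%:P) :> {poly R} by rewrite opprB.
by rewrite size_polyN size_XsubC mul1n.
Qed.

(** From [expR (- t) >= 1 - t], since [(1 - t) * (1 + t + 2 * t ^+ 2) >= 1] for [t <= 1 / 2]. *)
Lemma expR_quadratic t : `|t| <= 1 / 2 -> expR t <= 1 + t + 2 * t ^+ 2.
Proof.
rewrite ler_norml => /andP[t1 t2].
have h : 1 - t <= expR (- t) by exact: expR_ge1Dx.
have : expR t * (1 - t) <= 1.
  by apply: (le_trans (ler_wpM2l (expR_ge0 t) h)); rewrite expRxMexpNx_1.
have := expR_ge0 t.
have : 0 <= t ^+ 2 by exact: sqr_ge0.
nra.
Qed.

(* Chernoff bound: [bern n k] at [x] is the probability that a binomial variable
   with parameters n and x is k. *)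
Lemma bern_mgf n x t : 0 <= x <= 1 -> `|t| <= 1 / 2 ->
  \sum_(k < n.+1) (bern n k).[x] * expR (t * (k%:R - n%:R * x))
   <= expR (2 * n%:R * t ^+ 2).
Proof.
move=> /andP[x0 x1] t12.
have -> : \sum_(k < n.+1) (bern n k).[x] * expR (t * (k%:R - n%:R * x)) =
    ((1 - x + x * expR t) * expR (- (t * x))) ^+ n.
  rewrite exprMn exprDn mulr_suml; apply: eq_bigr => k _.
  rewrite horner_bern mulrBr expRD -!expRM_natl exprMn -expRM_natl.
  have -> : n%:R * - (t * x) = - (t * (n%:R * x)) by ring.
  rewrite -mulr_natl (mulrC k%:R t).
  move: ((1 - x) ^+ _) (x ^+ _) (expR (t * _)) (expR (- _)) => *; ring.
have -> : expR (2 * n%:R * t ^+ 2) = expR (2 * t ^+ 2) ^+ n.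
  by rewrite -expRM_natl; congr expR; ring.
rewrite lerXn2r ?nnegrE ?expR_ge0 //.
  by rewrite mulr_ge0 ?expR_ge0 // addr_ge0 ?subr_ge0 // mulr_ge0 ?expR_ge0.
have h : 1 - x + x * expR t <= expR (x * t + 2 * t ^+ 2).
  apply: le_trans (expR_ge1Dx _).
  have := expR_quadratic t12; have : 0 <= t ^+ 2 by exact: sqr_ge0.
  nra.
apply: (le_trans (ler_wpM2r (expR_ge0 _) h)).
by rewrite -expRD ler_expR; lra.
Qed.

(** The exponential of an absolute value is at most the sum of the exponentials with both signs. *)
Lemma bern_mgf_abs n x t : 0 <= x <= 1 -> 0 <= t <= 1 / 2 ->
  \sum_(k < n.+1) (bern n k).[x] * expR (t * `|k%:R - n%:R * x|)
   <= 2 * expR (2 * n%:R * t ^+ 2).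
Proof.
move=> x01 /andP[t0 t12].
have h1 := @bern_mgf n x t x01; have h2 := @bern_mgf n x (- t) x01.
rewrite sqrrN normrN ger0_norm // in h1 h2.
rewrite (_ : 2 * _ = expR (2 * n%:R * t ^+ 2) + expR (2 * n%:R * t ^+ 2)); last by ring.
apply: le_trans (lerD (h1 t12) (h2 t12)); rewrite -big_split /=.
apply: ler_sum => k _; rewrite -mulrDr ler_wpM2l ?bern_ge0 //.
case: (leP 0 (k%:R - n%:R * x)) => h.
  by rewrite ger0_norm // lerDl expR_ge0.
by rewrite ltr0_norm // mulrN -mulNr lerDr expR_ge0.
Qed.

Definition clamp x d : R := Num.max d (Num.min (1 - d) x).

Lemma clampP x d : 0 < d < 1 / 2 -> 0 <= x <= 1 ->
  0 < clamp x d < 1 /\ `|x - clamp x d| <= d.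
Proof.
move=> /andP[d0 d1] /andP[x0 x1]; rewrite /clamp.
case: (leP (1 - d) x) => h.
  by rewrite max_r; [split; [lra | rewrite ger0_norm; lra] | lra].
case: (leP d x) => h'; first by rewrite subrr normr0; split; lra.
by split; [lra | rewrite ler0_norm; lra].
Qed.

(* Local Taylor polynomials glued by Bernstein weights: the bounds on [c] give
   convergence of the Taylor series only near their centers, and the weight of
   the centers far from [x] is exponentially small. Centers are clamped to
   [[d, 1 - d]] since [c] is only controlled in the open interval. *)
Definition bern_taylor c d n m : {poly R} :=
  \sum_(k < n.+1) bern n k * taylor c m (clamp (k%:R / n%:R) d).

Lemma size_bern_taylor c d n m : (size (bern_taylor c d n m) <= n + m.+1)%N.
Proof.
apply: (leq_trans (size_sum _ _ _)); apply/bigmax_leqP => k _.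
apply: (leq_trans (size_polyMleq _ _)).
have h1 : (size (bern n k) <= n.+1)%N by apply: size_bern; rewrite -ltnS.
have h2 := size_taylor c m (clamp (k%:R / n%:R) d).
have := leq_add h1 h2; rewrite addSn; by case: (_ + _)%N.
Qed.

(** A crude bound for centers far from [x], where the polynomial does not approximate [c 0]; its
    growth [g ^+ m] is compensated by small Bernstein weights. *)
Lemma taylor_bound c m A g t x : jbound 0 1 A g c -> 1 <= g -> 0 < t < 1 -> 0 < x < 1 ->
  `|(taylor c m t).[x]| <= m.+1%:R * A * g ^+ m.
Proof.
move=> cb g1 t01 x01; rewrite horner_taylor.
apply: (le_trans (ler_norm_sum _ _ _)).
have A0 : 0 <= A by have := cb 0%N x x01; rewrite expr0 mulr1; exact: le_trans.
apply: (@le_trans _ _ (\sum_(i < m.+1) A * g ^+ m)); last first.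
  by rewrite sumr_const card_ord -[leLHS]mulr_natl mulrA.
apply: ler_sum => i _; rewrite normrM normrX.
apply: (@le_trans _ _ (A * g ^+ i * 1)).
  rewrite ler_pM ?cb // exprn_ile1 // ler_norml; lra.
rewrite mulr1 ler_wpM2l // ler_weXn2l //; by rewrite -ltnS.
Qed.

(** Centers with [|k / n - x| <= d] lie within [2 * d] of [x] after clamping, and
    [g * (2 * d) = 1 / 2] makes their Taylor errors geometric. The other centers carry an
    exponentially small total weight once [n] is a large multiple of [m.+1]. *)
Lemma bern_taylor_error c A g (n m : nat) x : jet 0 1 c -> jbound 0 1 A g c -> 1 <= g ->
  0 < x < 1 -> (0 < n)%N -> 128 * g ^+ 2 * (2 * g) * m.+1%:R <= n%:R ->
  `|c 0%N x - (bern_taylor c (4 * g)^-1 n m).[x]| <= 5 * m.+1%:R * A * (1 / 2) ^+ m.+1.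
Proof.
move=> cj cb g1 x01 n0 hn; set d := (4 * g)^-1.
have g0 : 0 < g by lra.
have d0 : 0 < d by rewrite invr_gt0; lra.
have d4 : d <= 1 / 4.
  by rewrite /d invfM -[leRHS]mulr1 mul1r ler_wpM2l // ?invf_le1.
have gd : g * d = 1 / 4 by rewrite /d; field; lra.
have nR0 : 0 < n%:R :> R by rewrite ltr0n.
have A0 : 0 <= A by have := cb 0%N x x01; rewrite expr0 mulr1; exact: le_trans.
have x01' : 0 <= x <= 1 by lra.
(* Minimises [- t * d + 2 * t ^+ 2], the exponent per unit of [n] for the far centers; the minimum
   is [- d ^+ 2 / 8]. *)
pose t := d / 4.
have t12 : 0 <= t <= 1 / 2 by rewrite /t; lra.
pose G := m.+1%:R * A * (1 / 2) ^+ m.+1.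
pose B := 2 * m.+1%:R * A * g ^+ m.
have G0 : 0 <= G by rewrite /G !mulr_ge0 ?exprn_ge0.
have B0 : 0 <= B by rewrite /B !mulr_ge0 ?exprn_ge0 // ltW.
have -> : c 0%N x = \sum_(k < n.+1) (bern n k).[x] * c 0%N x.
  by rewrite -mulr_suml sum_bern mul1r.
rewrite /bern_taylor horner_sum -sumrB; apply: (le_trans (ler_norm_sum _ _ _)).
apply: (@le_trans _ _ (\sum_(k < n.+1) (bern n k).[x] *
   (G + B * expR (- (t * (n%:R * d))) * expR (t * `|k%:R - n%:R * x|)))).
  apply: ler_sum => k _; rewrite hornerM -mulrBr normrM ger0_norm ?bern_ge0 //.
  rewrite ler_wpM2l ?bern_ge0 //.
  have kn : 0 <= (k%:R / n%:R : R) <= 1.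
    by rewrite divr_ge0 //= ler_pdivrMr // mul1r ler_nat -ltnS.
  have [|s01 sd] := @clampP (k%:R / n%:R) d _ kn; first by lra.
  set s := clamp _ _ in s01 sd *.
  have [near_|far] := leP `|k%:R - n%:R * x| (n%:R * d).
    apply: (@le_trans _ _ G); last first.
      by rewrite lerDl; apply: mulr_ge0; [apply: mulr_ge0|]; rewrite ?expR_ge0.
    apply: (le_trans (taylor_error m cj cb x01 s01)).
    rewrite /G ler_wpM2l ?mulr_ge0 // lerXn2r ?nnegrE //.
      by rewrite mulr_ge0 // ltW.
    have h1 : `|k%:R / n%:R - x| <= d.
      have -> : k%:R / n%:R - x = (k%:R - n%:R * x) / n%:R by field; rewrite gt_eqF.
      by rewrite normrM normfV [`|n%:R|]ger0_norm // ler_pdivrMr // [d * _]mulrC.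
    have h2 : `|x - s| <= 2 * d.
      move: h1 sd; rewrite !ler_norml; lra.
    apply: (le_trans (ler_wpM2l (ltW g0) h2)); lra.
  (* For a far center the product of the two exponentials is at least 1. *)
  apply: (@le_trans _ _ B); last first.
    rewrite -mulrA -expRD -[leLHS]add0r lerD // ler_peMr //.
    rewrite -[leLHS]expR0 ler_expR -mulrN -mulrDr; apply: mulr_ge0.
      by case/andP: t12.
    by rewrite addrC subr_ge0 ltW.
  apply: (le_trans (ler_normB _ _)).
  have h1 := taylor_bound m cb g1 s01 x01.
  have h2 : `|c 0%N x| <= m.+1%:R * A * g ^+ m.
    have := cb 0%N x x01; rewrite expr0 mulr1 => /le_trans; apply.
    rewrite -[leLHS]mulr1 -[X in X * 1]mul1r; apply: ler_pM; rewrite ?mul1r //.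
      by rewrite ler_peMl // ler1n.
    exact: exprn_ege1.
  by rewrite /B; lra.
under eq_bigr do rewrite mulrDr.
rewrite big_split /= -mulr_suml sum_bern [1 * G]mul1r.
under eq_bigr do rewrite mulrCA.
rewrite -mulr_sumr.
have h := bern_mgf_abs n x01' t12.
have : B * expR (- (t * (n%:R * d))) * (2 * expR (2 * n%:R * t ^+ 2)) <= 4 * G.
  have -> : B * expR (- (t * (n%:R * d))) * (2 * expR (2 * n%:R * t ^+ 2)) =
     4 * m.+1%:R * A * (g ^+ m * expR (- (n%:R * d ^+ 2 / 8))).
    have -> : - (n%:R * d ^+ 2 / 8) = - (t * (n%:R * d)) + 2 * n%:R * t ^+ 2.
      by rewrite /t; field.
    by rewrite expRD /B; ring.
  rewrite (_ : 4 * G = 4 * m.+1%:R * A * (1 / 2) ^+ m.+1); last by rewrite /G !mulrA.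
  rewrite ler_wpM2l ?mulr_ge0 //.
  (* The size of [n] gives [n * d ^+ 2 / 8 >= 2 * g * m.+1], and [g * expR (- (2 * g)) <= 1 / 2]. *)
  apply: (@le_trans _ _ ((g * expR (- (2 * g))) ^+ m.+1)).
    rewrite exprMn -expRM_natl ler_pM ?exprn_ge0 ?expR_ge0 //; try exact: ltW.
      by rewrite ler_weXn2l.
    rewrite ler_expR mulrN lerN2.
    have -> : n%:R * d ^+ 2 / 8 = n%:R / (128 * g ^+ 2) by rewrite /d; field; lra.
    by rewrite ler_pdivlMr ?mulr_gt0 ?exprn_gt0 //; apply: le_trans hn; lra.
  rewrite lerXn2r ?nnegrE ?mulr_ge0 ?expR_ge0 ?(ltW g0) //; try lra.
  have := expR_ge1Dx (2 * g); have := expRxMexpNx_1 (2 * g).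
  have := expR_gt0 (- (2 * g)); move: (expR _) (expR _) => u v; nra.
have Bt0 : 0 <= B * expR (- (t * (n%:R * d))) by rewrite mulr_ge0 ?expR_ge0.
have := ler_wpM2l Bt0 h.
rewrite /G; lra.
Qed.

Lemma approx_analytic g : 1 <= g -> exists sg C : R, [/\ 0 < sg, 0 < C &
  forall A c p, jet 0 1 c -> jbound 0 1 A g c -> exists2 q : {poly R},
    (size q <= p)%N &
    forall x, 0 < x < 1 -> `|c 0%N x - q.[x]| <= C * A * expR (- sg * p%:R)].
Proof.
move=> g1; pose L := (Num.bound (128 * g ^+ 2 * (2 * g))).+1.
have hL : 128 * g ^+ 2 * (2 * g) <= L%:R.
  apply: ltW; apply: (lt_le_trans (archi_boundP _)); last by rewrite ler_nat.
  by rewrite !mulr_ge0 ?exprn_ge0 //; lra.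
pose sg : R := (4 * L.+1%:R)^-1.
exists sg, 20; split => [| //|A c p cj cb]; first by rewrite invr_gt0 mulr_gt0.
(* Degree budget: [L * N] for the Bernstein weights and [N] for the Taylor polynomials, so that the
   size is at most [L.+1 * N <= p]. *)
pose N := (p %/ L.+1)%N.
have half01 : 0 < (1 / 2 : R) < 1 by lra.
have A0 : 0 <= A by have := cb 0%N _ half01; rewrite expr0 mulr1; exact: le_trans.
have decay : (3 / 4) ^+ N <= 2 * expR (- sg * p%:R).
  have h1 : expR (- (1 / 4)) ^+ N.+1 <= expR (- sg * p%:R).
    rewrite -expRM_natl ler_expR mulrN mulNr lerN2.
    rewrite /sg mulrC ler_pdivrMr ?mulr_gt0 //.
    have : p%:R <= (N.+1 * L.+1)%:R :> R by rewrite ler_nat ltnW // ltn_ceil.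
    rewrite natrM; lra.
  apply: (@le_trans _ _ (2 * (3 / 4) ^+ N.+1)).
    by rewrite exprS; have : 0 <= (3 / 4) ^+ N :> R by []; lra.
  rewrite ler_wpM2l //; apply: le_trans h1; rewrite lerXn2r ?nnegrE ?expR_ge0 //.
  have := expR_ge1Dx (- (1 / 4) : R); lra.
suff [q sq hq] : exists2 q : {poly R}, (size q <= p)%N & forall x, 0 < x < 1 ->
    `|c 0%N x - q.[x]| <= 10 * A * (3 / 4) ^+ N.
  exists q => // x /hq /le_trans; apply.
  have := ler_wpM2l (_ : 0 <= 10 * A) decay; rewrite mulr_ge0 // => /(_ isT); lra.
case: (posnP N) => [N0|N0].
  exists 0; rewrite ?size_poly0 // => x x01; rewrite horner0 subr0 N0.
  have := cb 0%N x x01; rewrite !expr0; lra.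
exists (bern_taylor c (4 * g)^-1 (L * N) N.-1).
  apply: (leq_trans (size_bern_taylor _ _ _ _)); rewrite prednK //.
  by rewrite -mulSnr mulnC leq_trunc_div.
move=> x x01.
have hn : 128 * g ^+ 2 * (2 * g) * N.-1.+1%:R <= (L * N)%:R.
  by rewrite prednK // natrM ler_wpM2r.
have := bern_taylor_error cj cb g1 x01 _ hn; rewrite muln_gt0 N0 => /(_ isT).
move=> /le_trans; apply; rewrite prednK //.
(* The factor [N] in the error is paid for by raising the ratio from [1 / 2] to [3 / 4]. *)
have hN : N%:R <= 2 * (3 / 2) ^+ N :> R.
  have : forall k, 1 + k%:R / 2 <= (3 / 2) ^+ k :> R.
    elim=> [|k IH]; first by rewrite expr0; lra.
    rewrite exprS -natr1; have : 0 <= k%:R :> R by []; lra.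
  move=> /(_ N); lra.
have -> : (3 / 4) ^+ N = (3 / 2) ^+ N * (1 / 2) ^+ N :> R.
  by rewrite -exprMn; congr (_ ^+ _); field.
have h0 : 0 <= A * (1 / 2) ^+ N by rewrite mulr_ge0.
have := ler_wpM2r h0 hN; lra.
Qed.

(** The constant coefficient is 0, by the convention on division by 0; constants of integration are
    added where they are needed. *)
Definition prim (q : {poly R}) : {poly R} :=
  \poly_(i < (size q).+1) (q`_i.-1 / i%:R).

Lemma size_prim q : (size (prim q) <= (size q).+1)%N.
Proof. exact: size_poly. Qed.

Lemma deriv_prim q : (prim q)^`() = q.
Proof.
apply/polyP => i; rewrite coef_deriv coef_poly ltnS.
case: ltnP => [iq|/leq_sizeP/(_ i (leqnn _)) ->]; last by rewrite mul0rn.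
by rewrite /= -[LHS]mulr_natr divfK ?pnatr_eq0.
Qed.

Lemma is_derive_horner (q : {poly R}) x : is_derive x 1 (horner q) q^`().[x].
Proof.
apply: DeriveDef; first exact: derivable_horner.
by rewrite -derive1E -derivE.
Qed.

Definition approximable g sg C : Prop := forall A c p,
  jet 0 1 c -> jbound 0 1 A g c -> exists2 q : {poly R}, (size q <= p.+1)%N &
  forall x, 0 < x < 1 -> let d := C * A * expR (- sg * p%:R) in
    [/\ `|c 0%N x - q.[x]| <= d, `|c 1%N x - q^`().[x]| <= d &
        `|2 * c 2%N x - q^`()^`().[x]| <= d].

(** The second derivative is approximated and integrated twice from [1 / 2], with constants matching
    [c 1] and [c 0] there. Points of (0, 1) are within distance 1 of [1 / 2], so the error does not
    grow; the rate [4 * g] covers the factors due to differentiation. *)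
Lemma approx_analytic2 g : 1 <= g ->
  exists sg C : R, [/\ 0 < sg, 0 < C & approximable g sg C].
Proof.
move=> g1; have [|sg [C [sg0 C0 hC]]] := @approx_analytic (4 * g); first lra.
exists sg, (2 * g ^+ 2 * (1 + C * expR sg)).
have g2 : 1 <= g ^+ 2 by rewrite exprn_ege1.
split => [//||A c p cj cb].
  rewrite !mulr_gt0 //; try lra.
  by rewrite addr_gt0 // mulr_gt0 ?expR_gt0.
have half01 : 0 < (1 / 2 : R) < 1 by lra.
have A0 : 0 <= A by have := cb 0%N _ half01; rewrite expr0 mulr1; exact: le_trans.
case: p => [|p].
  exists 0; rewrite ?size_poly0 // => x x01 /=.
  rewrite mulr0 expR0 mulr1 !deriv0 !horner0 !subr0.
  have := cb 0%N x x01; have := cb 1%N x x01; have := cb 2%N x x01.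
  rewrite expr0 expr1 mulr1 normrM [`|2|]ger0_norm //.
  have e0 : 0 <= C * expR sg by rewrite mulr_ge0 ?expR_ge0 // ltW.
  have h : 2 * (A * g ^+ 2) <= 2 * g ^+ 2 * (1 + C * expR sg) * A.
    have -> : 2 * g ^+ 2 * (1 + C * expR sg) * A = 2 * (A * g ^+ 2) + 2 * (A * g ^+ 2) * (C * expR sg) by ring.
    by rewrite lerDl !mulr_ge0 //; lra.
  have h1 : A <= A * g ^+ 2 by rewrite ler_peMr.
  have h2 : A * g <= A * g ^+ 2 by rewrite ler_wpM2l // expr2 ler_peMl //; lra.
  by split; lra.
pose c2 n x := (n.+1 * n.+2)%:R * c n.+2 x.
have c2j : jet 0 1 c2.
  move=> n x x01; have h := cj n.+2 x x01.
  have -> : n.+1%:R * c2 n.+1 x = (n.+1 * n.+2)%:R *: (n.+3%:R * c n.+3 x).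
    by rewrite /c2 /GRing.scale /= !natrM; ring.
  exact: is_deriveZ.
have c2b : jbound 0 1 (2 * g ^+ 2 * A) (4 * g) c2.
  move=> n x x01; rewrite /c2 normrM ger0_norm //.
  have h : (n.+1 * n.+2)%:R <= 2 * 4 ^+ n :> R.
    have -> : 2 * 4 ^+ n = (2 ^ n * 2 ^ n.+1)%:R :> R.
      by rewrite expnS mulnCA -expnMn natrM natrX.
    by rewrite ler_nat leq_mul // ltn_expl.
  apply: (@le_trans _ _ (2 * 4 ^+ n * (A * g ^+ n.+2))).
    by apply: ler_pM => //; exact: cb.
  rewrite exprMn exprS exprS; lra.
have [q2 sq2 hq2] := hC _ _ p c2j c2b.
pose e := C * (2 * g ^+ 2 * A) * expR (- sg * p%:R).
pose P1 := prim q2 + (c 1%N (1 / 2) - (prim q2).[1 / 2])%:P.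
pose P := prim P1 + (c 0%N (1 / 2) - (prim P1).[1 / 2])%:P.
have dP1 : P1^`() = q2 by rewrite derivD deriv_prim derivC addr0.
have dP : P^`() = P1 by rewrite derivD deriv_prim derivC addr0.
have sP1 : (size P1 <= p.+1)%N.
  apply: (leq_trans (size_polyD _ _)); rewrite geq_max.
  rewrite (leq_trans (size_prim _)) //= (leq_trans (size_polyC_leq1 _)) //.
have sP : (size P <= p.+2)%N.
  apply: (leq_trans (size_polyD _ _)); rewrite geq_max.
  rewrite (leq_trans (size_prim _)) //= (leq_trans (size_polyC_leq1 _)) //.
have e0 : 0 <= e by rewrite /e !mulr_ge0 ?expR_ge0 ?(ltW C0) //; lra.
have h2 x : 0 < x < 1 -> `|2 * c 2%N x - q2.[x]| <= e.
  by move=> /hq2; rewrite /c2 mul1n.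
have h1 x : 0 < x < 1 -> `|c 1%N x - P1.[x]| <= e.
  move=> x01.
  have d1 y : 0 < y < 1 -> is_derive y 1 (fun y => c 1%N y - P1.[y]) (2 * c 2%N y - q2.[y]).
    move=> y01; rewrite -dP1; apply: is_deriveB; first exact: cj.
  have := lip_oo d1 h2 x01 half01.
  have -> : c 1%N (1 / 2) - P1.[1 / 2] = 0 by rewrite /P1 hornerD hornerC; ring.
  rewrite subr0 => /le_trans; apply; rewrite ler_piMr // ler_norml; lra.
have h0 x : 0 < x < 1 -> `|c 0%N x - P.[x]| <= e.
  move=> x01.
  have d1 y : 0 < y < 1 -> is_derive y 1 (fun y => c 0%N y - P.[y]) (c 1%N y - P1.[y]).
    move=> y01; rewrite -dP; apply: is_deriveB.
    by have := cj 0%N y y01; rewrite mul1r.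
  have := lip_oo d1 h1 x01 half01.
  have -> : c 0%N (1 / 2) - P.[1 / 2] = 0 by rewrite /P hornerD hornerC; ring.
  rewrite subr0 => /le_trans; apply; rewrite ler_piMr // ler_norml; lra.
(* Two integrations raise the size by two, so [q2] is chosen for [p] while the claim is at [p.+1];
   [expR sg] in the constant makes up for it. *)
have eE : e <= 2 * g ^+ 2 * (1 + C * expR sg) * A * expR (- sg * p.+1%:R).
  have -> : e = 2 * g ^+ 2 * (C * expR sg) * A * expR (- sg * p.+1%:R).
    rewrite /e; have -> : - sg * p%:R = sg + - sg * p.+1%:R by rewrite -natr1; ring.
    by rewrite expRD; ring.
  rewrite ler_wpM2r ?expR_ge0 // ler_wpM2r // ler_wpM2l //; lra.
exists P => // x x01; rewrite dP dP1.
by split; apply: le_trans eE; [exact: h0|exact: h1|exact: h2].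
Qed.

End Jets.

(** * Growth of the derivatives of the solution *)

Section JetAlgebra.
Context {R : realType}.
Implicit Types (x y A B C F g : R) (c d e : nat -> R -> R).

Definition cprod c d n x := \sum_(k < n.+1) c k x * d (n - k)%N x.

Lemma cprod_recl c d n x :
  cprod c d n x = c 0%N x * d n x + \sum_(k < n) c k.+1 x * d (n - k.+1)%N x.
Proof. by rewrite /cprod big_ord_recl subn0. Qed.

Definition jder c n x : R := n.+1%:R * c n.+1 x.

Lemma cprod_derE c d n x :
  \sum_(k < n.+1) (c k x * jder d (n - k)%N x + d (n - k)%N x * jder c k x) =
  n.+1%:R * cprod c d n.+1 x.
Proof.
rewrite mulr_sumr.
under [RHS]eq_bigr => k _.
  have -> : n.+1%:R = (n.+1 - k)%:R + k%:R :> R by rewrite -natrD subnK // -ltnS.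
  rewrite mulrDl; over.
rewrite !big_split /=; congr (_ + _).
  rewrite [RHS]big_ord_recr /= subnn mul0r addr0; apply: eq_bigr => k _.
  have kn : (k <= n)%N by rewrite -ltnS.
  by rewrite /jder (subSn kn) mulrCA.
rewrite [RHS]big_ord_recl /= mul0r add0r; apply: eq_bigr => k _.
by rewrite /jder /bump /= add1n subSS mulrCA [d _ x * _]mulrC.
Qed.

Lemma is_derive_cprod c d n x :
  (forall k, (k <= n)%N -> is_derive x 1 (c k) (jder c k x)) ->
  (forall k, (k <= n)%N -> is_derive x 1 (d k) (jder d k x)) ->
  is_derive x 1 (cprod c d n) (n.+1%:R * cprod c d n.+1 x).
Proof.
move=> hc hd; rewrite -cprod_derE.
rewrite (_ : cprod c d n = \sum_(k < n.+1) (c k * d (n - k)%N)); last first.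
  by apply/funext => y; rewrite fct_sumE.
apply: is_derive_sum => k; apply: is_deriveM.
  by apply: hc; rewrite -ltnS.
by apply: hd; exact: leq_subr.
Qed.

Lemma sum_half n : \sum_(k < n.+1) (1 / 2) ^+ k <= 2 :> R.
Proof.
suff -> : \sum_(k < n.+1) (1 / 2) ^+ k = 2 - (1 / 2) ^+ n :> R.
  by have : 0 <= (1 / 2) ^+ n :> R by []; lra.
elim: n => [|n IH]; first by rewrite big_ord1 expr0; lra.
by rewrite big_ord_recr /= IH exprS; lra.
Qed.

(** As [g'] is at most half of [g], the convolution is dominated by a geometric series of ratio
    [1 / 2]: the product keeps the rate [g] and no power of [n] is lost. *)
Lemma cprod_le c d n x A B g' g : 0 <= g' -> 2 * g' <= g ->
  (forall k, (k <= n)%N -> `|c k x| <= A * g' ^+ k) ->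
  (forall k, (k <= n)%N -> `|d k x| <= B * g ^+ k) ->
  `|cprod c d n x| <= 2 * A * B * g ^+ n.
Proof.
move=> g'0 gg hc hd; have g0 : 0 <= g by lra.
have A0 : 0 <= A by have := hc 0%N (leq0n _); rewrite expr0 mulr1; exact: le_trans.
have B0 : 0 <= B by have := hd 0%N (leq0n _); rewrite expr0 mulr1; exact: le_trans.
apply: (le_trans (ler_norm_sum _ _ _)).
apply: (@le_trans _ _ (\sum_(k < n.+1) (1 / 2) ^+ k * (A * B * g ^+ n))).
  apply: ler_sum => k _; have kn : (k <= n)%N by rewrite -ltnS.
  rewrite normrM; apply: le_trans (ler_pM _ _ (hc k kn) (hd _ (leq_subr k n))) _ => //.
  have -> : g ^+ n = g ^+ k * g ^+ (n - k) by rewrite -exprD subnKC.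
  have h : g' ^+ k <= (1 / 2) ^+ k * g ^+ k.
    by rewrite -exprMn lerXn2r ?nnegrE //; lra.
  have : 0 <= A * B * g ^+ (n - k) by rewrite !mulr_ge0 ?exprn_ge0.
  move=> /ler_wpM2r/(_ _ _ h); lra.
rewrite -mulr_suml.
have h0 : 0 <= A * B * g ^+ n by rewrite !mulr_ge0 ?exprn_ge0.
have := ler_wpM2r h0 (sum_half n); lra.
Qed.

Lemma jboundW a b A B g g' c : 0 <= g -> A <= B -> g <= g' -> 0 <= B ->
  jbound a b A g c -> jbound a b B g' c.
Proof.
move=> g0 AB gg B0 h n x xab; apply: (le_trans (h n x xab)).
apply: (@le_trans _ _ (B * g ^+ n)); first by rewrite ler_wpM2r ?exprn_ge0.
by rewrite ler_wpM2l // lerXn2r ?nnegrE //; lra.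
Qed.

Lemma jet_der a b c : jet a b c -> jet a b (jder c).
Proof.
move=> cj n x xab; have h := cj n.+1 x xab.
exact: (is_deriveZ _ h).
Qed.

(** Cauchy estimate: a derivative is paid for by enlarging the rate, through
    [n.+1 * g ^+ n * (g' - g) <= g' ^+ n.+1]. *)
Lemma jder_bound a b A g g' c : 0 < g < g' -> 0 <= A -> jbound a b A g c ->
  jbound a b (A * (g * g' / (g' - g))) g' (jder c).
Proof.
move=> /andP[g0 gg] A0 h n x xab; rewrite /jder normrM ger0_norm //.
apply: (le_trans (ler_wpM2l _ (h n.+1 x xab))) => //.
have key : n.+1%:R * g ^+ n * (g' - g) <= g' ^+ n.+1.
  have gg' : 0 <= g' - g by lra.
  elim: n => [|n IH]; first by rewrite expr0 expr1; lra.
  have gn : g ^+ n.+1 <= g' ^+ n.+1 by rewrite lerXn2r ?nnegrE //; lra.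
  rewrite [g' ^+ n.+2]exprS [g ^+ n.+1]exprS -natr1.
  have := ler_wpM2l (ltW g0) IH; have := ler_wpM2r gg' gn.
  rewrite [g ^+ n.+1]exprS; lra.
have -> : n.+1%:R * (A * g ^+ n.+1) =
   A * g / (g' - g) * (n.+1%:R * g ^+ n * (g' - g)).
  by rewrite exprS; field; lra.
have -> : A * (g * g' / (g' - g)) * g' ^+ n = A * g / (g' - g) * g' ^+ n.+1.
  by rewrite exprS; field; lra.
rewrite ler_wpM2l // divr_ge0 ?mulr_ge0 //; lra.
Qed.

Lemma jet_cprod a b c d : jet a b c -> jet a b d -> jet a b (cprod c d).
Proof.
move=> hc hd n x xab.
apply: (@is_derive_cprod c d n x) => k _.
  exact: hc.
exact: hd.
Qed.

Lemma jet_lin a b c d (k l : R) : jet a b c -> jet a b d ->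
  jet a b (fun n x => k * c n x + l * d n x).
Proof.
move=> hc hd n x xab; have h1 := hc n x xab; have h2 := hd n x xab.
have -> : n.+1%:R * (k * c n.+1 x + l * d n.+1 x) =
  k *: (n.+1%:R * c n.+1 x) + l *: (n.+1%:R * d n.+1 x).
  by rewrite /GRing.scale /=; ring.
by apply: is_deriveD; apply: is_deriveZ.
Qed.

Definition tjet (u : R -> R) n x := derive1n n u x / n`!%:R.

Lemma tjet_der (u : R -> R) n x : derivable (derive1n n u) x 1 ->
  is_derive x 1 (tjet u n) (n.+1%:R * tjet u n.+1 x).
Proof.
move=> h.
have -> : n.+1%:R * tjet u n.+1 x = n`!%:R^-1 *: derive1n n.+1 u x.
  rewrite /tjet factS natrM /GRing.scale /=; field.
  by rewrite pnatr_eq0 -lt0n fact_gt0 /= addrC natr1 pnatr_eq0.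
rewrite (_ : tjet u n = (n`!%:R^-1 \*: derive1n n u)); last first.
  by apply/funext => y; rewrite /tjet mulrC.
have h1 : is_derive x 1 (derive1n n u) (derive1n n.+1 u x).
  by apply: DeriveDef => //; rewrite -derive1E.
exact: (is_deriveZ n`!%:R^-1 h1).
Qed.

Lemma analytic_jet C g (u : R -> R) : analytic01 C g u ->
  jet 0 1 (tjet u) /\ jbound 0 1 C g (tjet u).
Proof.
move=> [_ du Bu].
have du' n x : 0 < x < 1 -> derivable (derive1n n u) x 1.
  by move=> x01; apply: du; rewrite in_itv.
split => n x x01; first by apply: tjet_der; exact: du'.
rewrite /tjet normrM normfV [`|n`!%:R|]ger0_norm // ler_pdivrMr; last first.
  by rewrite ltr0n fact_gt0.
rewrite mulrAC; apply: Lnorm_pointwise (Bu n) _ x01 => y y01.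
by apply: differentiable_continuous; apply/derivable1_diffP; exact: du'.
Qed.

Lemma is_derive_eq_oo a b (u v : R -> R) dv x : a < x < b ->
  (forall y, a < y < b -> u y = v y) -> is_derive x 1 v dv -> is_derive x 1 u dv.
Proof.
move=> xab uv h; apply: (near_eq_is_derive (f := v)) => //.
near=> y; rewrite uv //; near: y; exact: nbhs_oo.
Unshelve. all: by end_near. Qed.

Lemma is_derive_unique x (u : R -> R) (d1 d2 : R) :
  is_derive x 1 u d1 -> is_derive x 1 u d2 -> d1 = d2.
Proof. by move=> [_ <-] [_ <-]. Qed.

(** The relation of order [n] expresses the [n]-th derivative of [h] through lower ones, hence that
    derivative is differentiable; differentiating the relation gives the one of order [n.+1]. Both
    claims therefore share one induction. *)
Lemma jet_quotient (rj fj : nat -> R -> R) : jet 0 1 rj -> jet 0 1 fj ->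
  (forall x, 0 < x < 1 -> rj 0%N x != 0) ->
  let h x := fj 0%N x / rj 0%N x in
  jet 0 1 (tjet h) /\
  forall n x, 0 < x < 1 -> cprod rj (tjet h) n x = fj n x.
Proof.
move=> jr jf r0 h.
suff key n : (forall k x, (k < n)%N -> 0 < x < 1 -> derivable (derive1n k h) x 1) /\
    (forall k x, (k <= n)%N -> 0 < x < 1 -> cprod rj (tjet h) k x = fj k x).
  split=> n x x01; last exact: (key n).2.
  by apply: tjet_der; apply: (key n.+1).1.
elim: n => [|n [IH1 IH2]].
  split=> // k x; rewrite leqn0 => /eqP -> x01.
  rewrite /cprod big_ord1 subnn /tjet /= fact0 divr1 /h mulrC divfK ?r0 //.
have dn x : 0 < x < 1 -> derivable (derive1n n h) x 1.
  move=> x01.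
  have E y : 0 < y < 1 -> derive1n n h y =
      n`!%:R * ((fj n y - \sum_(k < n) rj k.+1 y * tjet h (n - k.+1)%N y) / rj 0%N y).
    move=> y01; have := IH2 n y (leqnn n) y01.
    rewrite cprod_recl => <-.
    rewrite addrK [rj _ _ * _]mulrC mulfK ?r0 //.
    by rewrite /tjet mulrC divfK // pnatr_eq0 -lt0n fact_gt0.
  have [d hd] : exists d : R, is_derive x 1 (fun y => n`!%:R * ((fj n y - \sum_(k < n) rj k.+1 y * tjet h (n - k.+1)%N y) / rj 0%N y)) d.
    eexists; apply: (is_deriveZ (n`!%:R)).
    apply: is_deriveM; last first.
      by apply: (is_deriveV (r0 x x01)); exact: jr.
    apply: is_deriveB; first exact: jf.
    rewrite (_ : (fun y => _) = \sum_(k < n) (rj k.+1 * tjet h (n - k.+1)%N)); last first.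
      by apply/funext => y; rewrite fct_sumE.
    apply: is_derive_sum => k; apply: is_deriveM; first exact: jr.
    by apply: tjet_der; apply: IH1 => //; rewrite ltn_subrL /= (leq_ltn_trans _ (ltn_ord k)).
  by have [] := is_derive_eq_oo x01 E hd.
have S k x : (k < n.+1)%N -> 0 < x < 1 -> derivable (derive1n k h) x 1.
  by rewrite ltnS leq_eqVlt => /predU1P[-> | /IH1]; [exact: dn | exact].
split => // k x; rewrite leq_eqVlt => /predU1P[-> | /IH2]; last exact.
move=> x01.
have d1 : is_derive x 1 (cprod rj (tjet h) n) (n.+1%:R * cprod rj (tjet h) n.+1 x).
  apply: (@is_derive_cprod rj (tjet h) n x) => j jn.
    exact: jr.
  by apply: tjet_der; apply: S.
have d2 : is_derive x 1 (cprod rj (tjet h) n) (n.+1%:R * fj n.+1 x).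
  apply: (is_derive_eq_oo x01 _ (jf n x x01)) => y y01; exact: IH2.
have /mulfI := is_derive_unique d1 d2; apply; by rewrite pnatr_eq0.
Qed.

(** The Cauchy product is solved for [c n]. The terms with higher coefficients of [rj] are at most
    [F * g ^+ n] because [4 * C * g' <= r0 * g], so the rate of the numerator survives the
    division. *)
Lemma quotient_bound (rj fj c : nat -> R -> R) r0 C F g' g : 0 < r0 -> 0 <= g' ->
  2 * g' <= g -> 4 * C * g' <= r0 * g ->
  (forall x, 0 < x < 1 -> r0 <= rj 0%N x) -> jbound 0 1 C g' rj ->
  jbound 0 1 F g fj ->
  (forall n x, 0 < x < 1 -> cprod rj c n x = fj n x) ->
  jbound 0 1 (2 / r0 * F) g c.
Proof.
move=> r00 g'0 gg Cg hr br bf E n x x01.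
have F0 : 0 <= F by have := bf 0%N x x01; rewrite expr0 mulr1; exact: le_trans.
have C0 : 0 <= C by have := br 0%N x x01; rewrite expr0 mulr1; exact: le_trans.
have g0 : 0 <= g by lra.
have r_gt0 : 0 < rj 0%N x by apply: lt_le_trans (hr x x01).
elim/ltn_ind: n => n IH.
have -> : c n x = (fj n x - \sum_(k < n) rj k.+1 x * c (n - k.+1)%N x) / rj 0%N x.
  rewrite -E // cprod_recl addrK [rj _ _ * _]mulrC mulfK //; rewrite gt_eqF //.
rewrite normrM normfV [`|rj 0%N x|]gtr0_norm // ler_pdivrMr //.
apply: (@le_trans _ _ (2 * F * g ^+ n)); last first.
  have -> : 2 * F * g ^+ n = 2 / r0 * F * g ^+ n * r0 by field; lra.
  by rewrite ler_wpM2l ?hr // !mulr_ge0 ?exprn_ge0 // invr_ge0 ltW.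
apply: (le_trans (ler_normB _ _)).
have h1 : `|\sum_(k < n) rj k.+1 x * c (n - k.+1)%N x| <= F * g ^+ n.
  case: n IH => [|n] IH; first by rewrite big_ord0 normr0 !mulr_ge0 ?exprn_ge0.
  have := @cprod_le (fun k => rj k.+1) c n x (C * g') (2 / r0 * F) g' g g'0 gg.
  rewrite /cprod => /(_ _ _)/le_trans; apply.
  - by move=> k _; have := br k.+1 x x01; rewrite exprS mulrA.
  - by move=> k kn; apply: IH; rewrite ltnS.
  have -> : 2 * (C * g') * (2 / r0 * F) * g ^+ n = 4 * C * g' * (F * g ^+ n / r0) by field; lra.
  have -> : F * g ^+ n.+1 = r0 * g * (F * g ^+ n / r0) by rewrite exprS; field; lra.
  by rewrite ler_wpM2r // !mulr_ge0 ?exprn_ge0 // invr_ge0 ltW.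
have := bf n x x01; lra.
Qed.

Lemma is_derive_jder c k x : is_derive x 1 (c k.+1) (jder c k.+1 x) ->
  is_derive x 1 (jder c k) (jder (jder c) k x).
Proof. by move=> h; exact: (is_deriveZ _ h). Qed.

Definition ode_rhs (e2 : R) (bj rj fj : nat -> R -> R) c n x : R :=
  e2 * cprod bj (jder c) n x + cprod rj c n x - fj n x.

(** Bootstrap: a solution has two derivatives by definition, and the equation expresses each further
    one through terms already known to be differentiable. The recurrence is the [n]-th derivative of
    the equation divided by [n!]. *)
Lemma ode_jet (e1 e2 : R) (bj rj fj : nat -> R -> R) (u : R -> R) : e1 != 0 ->
  jet 0 1 bj -> jet 0 1 rj -> jet 0 1 fj ->
  (forall x, 0 < x < 1 -> [/\ derivable u x 1, derivable (derive1 u) x 1 &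
    - e1 * derive1n 2 u x + e2 * bj 0%N x * derive1 u x + rj 0%N x * u x = fj 0%N x]) ->
  jet 0 1 (tjet u) /\
  forall n x, 0 < x < 1 ->
    e1 * (n.+1%:R * n.+2%:R) * tjet u n.+2 x = ode_rhs e2 bj rj fj (tjet u) n x.
Proof.
move=> e10 jb jr jf hu.
suff key n : (forall k x, (k <= n.+1)%N -> 0 < x < 1 -> derivable (derive1n k u) x 1) /\
    (forall k x, (k <= n)%N -> 0 < x < 1 ->
    e1 * (k.+1%:R * k.+2%:R) * tjet u k.+2 x = ode_rhs e2 bj rj fj (tjet u) k x).
  split=> n x x01; last exact: (key n).2.
  by apply: tjet_der; apply: (key n).1.
elim: n => [|n [IH1 IH2]].
  split=> k x.
    by case: k => [|[|]] // _ /hu[].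
  rewrite leqn0 => /eqP -> x01; have [_ _ E] := hu x x01.
  rewrite /ode_rhs -E /cprod !big_ord1 subnn /jder /tjet !factS fact0 /= !muln1 !divr1.
  by rewrite -[derive1 (derive1 u)]/(derive1n 2 u); field.
have dnum x : 0 < x < 1 -> is_derive x 1 (ode_rhs e2 bj rj fj (tjet u) n)
     (n.+1%:R * ode_rhs e2 bj rj fj (tjet u) n.+1 x).
  move=> x01.
  have -> : n.+1%:R * ode_rhs e2 bj rj fj (tjet u) n.+1 x =
     e2 *: (n.+1%:R * cprod bj (jder (tjet u)) n.+1 x) +
     n.+1%:R * cprod rj (tjet u) n.+1 x - n.+1%:R * fj n.+1 x.
    by rewrite /ode_rhs /GRing.scale /=; ring.
  have h1 : is_derive x 1 (cprod bj (jder (tjet u)) n) (n.+1%:R * cprod bj (jder (tjet u)) n.+1 x).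
    apply: (@is_derive_cprod bj (jder (tjet u)) n x) => j jn.
      exact: jb.
    apply: is_derive_jder; apply: tjet_der; exact: IH1.
  have h2 : is_derive x 1 (cprod rj (tjet u) n) (n.+1%:R * cprod rj (tjet u) n.+1 x).
    apply: (@is_derive_cprod rj (tjet u) n x) => j jn.
      exact: jr.
    by apply: tjet_der; apply: IH1 => //; apply: leqW.
  by apply: is_deriveB; last exact: jf.
have nz : e1 * (n.+1%:R * n.+2%:R) != 0 by rewrite !mulf_neq0 // pnatr_eq0.
have fz k : (k`!%:R : R) != 0 by rewrite pnatr_eq0 -lt0n fact_gt0.
have E y : 0 < y < 1 -> derive1n n.+2 u y =
    n.+2`!%:R / (e1 * (n.+1%:R * n.+2%:R)) * ode_rhs e2 bj rj fj (tjet u) n y.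
  move=> y01; rewrite -IH2 // /tjet; field.
  have n0 := ler0n R n; rewrite fz e10 /= andbT.
  by apply/andP; split; rewrite gt_eqF //; lra.
have dn x : 0 < x < 1 -> derivable (derive1n n.+2 u) x 1.
  move=> x01; have h := is_deriveZ (n.+2`!%:R / (e1 * (n.+1%:R * n.+2%:R))) (dnum x x01).
  by have [] := is_derive_eq_oo x01 E h.
split=> k x; rewrite leq_eqVlt => /predU1P[-> | hk] x01.
- exact: dn.
- by apply: IH1.
- have hE y : 0 < y < 1 -> ode_rhs e2 bj rj fj (tjet u) n y =
      e1 * (n.+1%:R * n.+2%:R) * tjet u n.+2 y by move=> y01; rewrite -IH2.
  have h3 := is_deriveZ (e1 * (n.+1%:R * n.+2%:R)) (tjet_der (dn x x01)).
  have d1 := is_derive_eq_oo x01 hE h3.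
  have E2 := is_derive_unique d1 (dnum x x01).
  apply: (@mulfI _ n.+1%:R); first by rewrite pnatr_eq0.
  by rewrite -E2 /GRing.scale /= ; move: (tjet u _ x) => t; rewrite !mulrA; congr (_ * t); rewrite -!mulrA mulrCA; congr (_ * _); rewrite mulrA mulrC.
- by apply: IH2.
Qed.

(* With [s = sqrt eps1], the n-th normalised derivative of the solution is at
   most a geometric factor times [growth s n]: s^-n / n! while n < 1 / s, then
   only geometric growth. *)
Definition growth (s : R) n : R := \prod_(k < n) (1 + (k.+1%:R * s)^-1).

Lemma growthS s n : growth s n.+1 = growth s n * (1 + (n.+1%:R * s)^-1).
Proof. by rewrite /growth big_ord_recr. Qed.

Lemma growth_ge1 s n : 0 < s -> 1 <= growth s n.
Proof.
move=> s0; elim: n => [|n IH]; first by rewrite /growth big_ord0.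
by rewrite growthS; apply: mulr_ege1 => //; rewrite lerDl invr_ge0 mulr_ge0 // ltW.
Qed.

Lemma growth_mono s m n : 0 < s -> (m <= n)%N -> growth s m <= growth s n.
Proof.
move=> s0; elim: n => [|n IH]; first by rewrite leqn0 => /eqP ->.
rewrite leq_eqVlt => /predU1P[-> //|/IH h]; apply: (le_trans h).
rewrite growthS ler_peMr // ?(le_trans _ (growth_ge1 n s0)) //.
by rewrite lerDl invr_ge0 mulr_ge0 // ltW.
Qed.

(** Up to constants and powers of [K], the convection term has size [s * n.+1 * growth s n.+1],
    since [e2 <= s], and the other terms have size [growth s n]. Both are at most
    [s ^+ 2 * (n.+1 * n.+2) * growth s n.+2], and [K] is large enough for
    [2 * C * K + 2 * C + 1 <= K ^+ 2]. *)
Lemma ode_jet_bound (s e2 : R) (bj rj fj c : nat -> R -> R) C G A K x :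
  0 < s -> 0 <= e2 <= s -> 0 <= G -> 2 * G <= K -> 4 * C + 2 <= K ->
  (forall k, `|bj k x| <= C * G ^+ k) -> (forall k, `|rj k x| <= C * G ^+ k) ->
  (forall k, `|fj k x| <= C * G ^+ k) -> C <= A ->
  `|c 0%N x| <= A -> s * `|c 1%N x| <= A ->
  (forall n, s ^+ 2 * (n.+1%:R * n.+2%:R) * c n.+2 x = ode_rhs e2 bj rj fj c n x) ->
  forall n, `|c n x| <= A * K ^+ n * growth s n.
Proof.
move=> s0 /andP[e20 es] G0 GK CK hb hr hf CA h0 h1 E.
have C0 : 0 <= C by have := hf 0%N; rewrite expr0 mulr1; exact: le_trans.
have A0 : 0 <= A by lra.
have K2 : 2 <= K by lra.
have K0 : 0 <= K by lra.
suff key n : forall k, (k <= n.+1)%N -> `|c k x| <= A * K ^+ k * growth s k.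
  by move=> n; apply: (key n); exact: leqnSn.
elim: n => [|n IH] k.
  case: k => [|[|]] // _; first by rewrite /growth big_ord0 expr0 !mulr1.
  rewrite growthS /growth big_ord0 mul1r mul1r expr1.
  have h2 : `|c 1%N x| <= A / s by rewrite ler_pdivlMr // mulrC.
  apply: (le_trans h2).
  have : A / s <= A * K * s^-1.
    by rewrite ler_wpM2r ?invr_ge0 ?(ltW s0) // ler_peMr //; lra.
  have : 0 <= A * K by exact: mulr_ge0.
  rewrite mulrDr mulr1; lra.
rewrite leq_eqVlt => /predU1P[-> {k} | ]; last exact: IH.
set P := growth s.
have P1 m : 0 <= P m by apply: le_trans (growth_ge1 m s0).
have b1 : `|cprod bj (jder c) n x| <= 2 * C * (n.+1%:R * A * K * P n.+1) * K ^+ n.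
  apply: (cprod_le G0 GK) => // k kn.
  rewrite /jder normrM ger0_norm //.
  apply: (@le_trans _ _ (n.+1%:R * (A * K ^+ k.+1 * P n.+1))); last by rewrite exprS; lra.
  apply: ler_pM => //; first by rewrite ler_nat.
  apply: (le_trans (IH k.+1 _)) => //.
  by rewrite ler_wpM2l ?mulr_ge0 ?exprn_ge0 // growth_mono.
have b2 : `|cprod rj c n x| <= 2 * C * (A * P n) * K ^+ n.
  apply: (cprod_le G0 GK) => // k kn.
  apply: (le_trans (IH k _)); first exact: leqW.
  rewrite mulrAC; apply: ler_wpM2r; first exact: exprn_ge0.
  by rewrite ler_wpM2l // growth_mono.
have b3 : `|fj n x| <= A * P n * K ^+ n.
  apply: (le_trans (hf n)); apply: ler_pM => //; first exact: exprn_ge0.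
    by apply: (le_trans CA); rewrite ler_peMr // growth_ge1.
  by rewrite lerXn2r ?nnegrE //; lra.
(* A factor [1 + (m * s)^-1] of [growth] multiplied by [m * s] is [m * s + 1 >= 1]; this is used for
   [m = n.+2] and then for [m = n.+1]. *)
pose X := s ^+ 2 * (n.+1%:R * n.+2%:R) * P n.+2.
have n1 : 0 < n.+1%:R :> R by [].
have n2 : 0 < n.+2%:R :> R by [].
have X1 : s * n.+1%:R * P n.+1 <= X.
  have -> : X = s * n.+1%:R * P n.+1 + s ^+ 2 * (n.+1%:R * n.+2%:R) * P n.+1.
    rewrite /X /P (growthS s n.+1); move: (growth s n.+1) n.+1%:R n.+2%:R n1 n2.
    by move=> p a b a0 b0; field; lra.
  by rewrite lerDl !mulr_ge0 ?exprn_ge0 // ltW.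
have X2 : P n <= X.
  apply: le_trans X1.
  have -> : s * n.+1%:R * P n.+1 = P n + s * n.+1%:R * P n.
    rewrite /P (growthS s n); move: (growth s n) n.+1%:R n1.
    by move=> p a a0; field; lra.
  by rewrite lerDl !mulr_ge0 // ltW.
have Kn : 0 <= K ^+ n by exact: exprn_ge0.
have nz : 0 < s ^+ 2 * (n.+1%:R * n.+2%:R) by rewrite !mulr_gt0 ?exprn_gt0.
rewrite -(ler_pM2l nz) -[X in X * `|_| <= _](gtr0_norm nz) -normrM E.
have -> : s ^+ 2 * (n.+1%:R * n.+2%:R) * (A * K ^+ n.+2 * P n.+2) = A * K ^+ n * X * K ^+ 2.
  by rewrite /X (exprSr K n.+1) (exprSr K n); ring.
rewrite /ode_rhs; apply: (le_trans (ler_normB _ _)).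
apply: (le_trans (lerD (ler_normD _ _) (lexx _))).
rewrite normrM (ger0_norm e20).
have t1 : e2 * `|cprod bj (jder c) n x| <= 2 * C * K * (A * K ^+ n * X).
  apply: (le_trans (ler_pM e20 _ es b1)) => //.
  have -> : s * (2 * C * (n.+1%:R * A * K * P n.+1) * K ^+ n) =
    2 * C * K * (A * K ^+ n * (s * n.+1%:R * P n.+1)) by ring.
  by rewrite ler_wpM2l ?mulr_ge0 // ler_wpM2l // mulr_ge0.
have t2 : `|cprod rj c n x| <= 2 * C * (A * K ^+ n * X).
  apply: (le_trans b2); rewrite -!mulrA ler_wpM2l // ler_wpM2l // ler_wpM2l //.
  by rewrite mulrC ler_wpM2l.
have t3 : `|fj n x| <= A * K ^+ n * X.
  by apply: (le_trans b3); rewrite mulrAC ler_wpM2l // mulr_ge0.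
have Y0 : 0 <= A * K ^+ n * X by apply: le_trans t3.
have : (2 * C * K + 2 * C + 1) * (A * K ^+ n * X) <= K ^+ 2 * (A * K ^+ n * X).
  by rewrite ler_wpM2r // expr2; nra.
lra.
Qed.

Lemma bin_le_exp2 n m : ('C(n, m) <= 2 ^ n)%N.
Proof.
elim: n m => [|n IH] [|m] //; first by rewrite bin0 expn_gt0.
by rewrite binS expnS mul2n -addnn leq_add.
Qed.

(** For [a = N] the product is the binomial coefficient ['C(n + N, n)]. *)
Lemma prod_growth_le (a : R) (N n : nat) : 0 <= a <= N%:R ->
  \prod_(k < n) (1 + a / k.+1%:R) <= 2 ^+ (n + N).
Proof.
move=> /andP[a0 aN].
apply: (@le_trans _ _ ('C(n + N, n)%:R)); last first.
  by rewrite -natrX ler_nat bin_le_exp2.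
elim: n => [|n IH]; first by rewrite big_ord0 bin0.
rewrite big_ord_recr /=.
have E : 'C(n.+1 + N, n.+1)%:R = 'C(n + N, n)%:R * (1 + N%:R / n.+1%:R) :> R.
  have := mul_bin_diag (n.+1 + N) n; rewrite addSn /= => /(congr1 (fun k => k%:R : R)).
  rewrite !natrM -addSn natrD => h.
  apply: (@mulfI _ n.+1%:R); first by rewrite pnatr_eq0.
  have nz : n.+1%:R != 0 :> R by rewrite pnatr_eq0.
  rewrite -h; move: n.+1%:R nz => z nz; field.
  by [].
rewrite E; apply: ler_pM => //.
- by apply: prodr_ge0 => k _; rewrite addr_ge0 // divr_ge0.
- by rewrite addr_ge0 // divr_ge0.
- by rewrite lerD2l ler_wpM2r ?invr_ge0.
Qed.

End JetAlgebra.

(** * Maximum principle and boundary layers *)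

Section MaximumPrinciple.
Context {R : realType}.
Implicit Types (a b s x y e tau C d p r be Z : R) (v z bb rr : R -> R) (c : nat -> R -> R).

Lemma min_second_derivative a b v v1 v2 x :
  (forall y, a < y < b -> is_derive y 1 v (v1 y)) ->
  (forall y, a < y < b -> is_derive y 1 v1 (v2 y)) ->
  a < x < b -> {for x, continuous v2} ->
  (forall y, a < y < b -> v x <= v y) -> v1 x = 0 /\ 0 <= v2 x.
Proof.
move=> dv dv1 /[dup] xab /andP[ax xb] cv2 vmin.
have v1x : v1 x = 0.
  have h : is_derive x 1 v 0.
    apply: (@derive1_at_min _ v a b x); [lra| | by rewrite in_itv | ].
      by move=> y; rewrite in_itv /= => /dv[].
    by move=> y; rewrite in_itv /= => /vmin.
  exact: is_derive_unique (dv x xab) h.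
split=> //; rewrite leNgt; apply/negP => v2x.
have : \forall y \near x, v2 y < 0 by exact: (cvgr_lt _ cv2).
move=> /nbhs_ballP [e /= e0 he].
pose d := Num.min (e / 2) ((b - x) / 2).
have d0 : 0 < d by rewrite lt_min; apply/andP; split; lra.
have de : d <= e / 2 by rewrite ge_min lexx.
have db : d <= (b - x) / 2 by rewrite ge_min lexx orbT.
have v2neg y : x <= y <= x + d -> v2 y < 0.
  move=> /andP[? ?]; apply: he; rewrite /ball /= ler0_norm; lra.
have v1neg y : x < y <= x + d -> v1 y < 0.
  move=> /andP[xy yd].
  have [t] : exists2 t, t \in `]x, y[ & v1 y - v1 x = v2 t * (y - x).
    apply: MVT => //.
      by move=> t; rewrite in_itv /= => /andP[? ?]; apply: dv1; lra.
    by apply: (@derive_within _ _ _ _ v2) => t /andP[? ?]; apply: dv1; lra.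
  rewrite in_itv /= v1x subr0 => /andP[? ?] ->.
  by rewrite nmulr_rlt0 ?subr_gt0 // v2neg //; lra.
have [t] : exists2 t, t \in `]x, x + d[ & v (x + d) - v x = v1 t * (x + d - x).
  apply: MVT; first lra.
    by move=> t; rewrite in_itv /= => /andP[? ?]; apply: dv; lra.
  by apply: (@derive_within _ _ _ _ v1) => t /andP[? ?]; apply: dv; lra.
rewrite in_itv /= => /andP[? ?] E.
have : v1 t * (x + d - x) < 0 by rewrite nmulr_rlt0 ?v1neg //; lra.
have := vmin (x + d); lra.
Qed.

(** A negative minimum would be interior, with zero slope and nonnegative second derivative, and the
    operator would be negative there. *)
Lemma maximum_principle a b e1 e2 bb rr v v1 v2 : a < b -> 0 < e1 ->
  {within `[a, b], continuous v} ->
  (forall y, a < y < b -> is_derive y 1 v (v1 y)) ->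
  (forall y, a < y < b -> is_derive y 1 v1 (v2 y)) ->
  (forall y, a < y < b -> {for y, continuous v2}) ->
  (forall y, a < y < b -> 0 < rr y) ->
  (forall y, a < y < b -> 0 <= - e1 * v2 y + e2 * bb y * v1 y + rr y * v y) ->
  0 <= v a -> 0 <= v b -> forall x, a <= x <= b -> 0 <= v x.
Proof.
move=> ab e10 cv dv dv1 cv2 r0 Lv va vb x xab.
have [c cab cmin] := EVT_min (ltW ab) cv.
suff vc : 0 <= v c by apply: (le_trans vc); apply: cmin; rewrite in_itv.
rewrite leNgt; apply/negP => vc0.
move: cab; rewrite in_itv /= !le_eqVlt => /andP[/predU1P[ac|ac]].
  by move: vc0; rewrite -ac ltNge va.
move=> /predU1P[cb|cb]; first by move: vc0; rewrite cb ltNge vb.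
have cab : a < c < b by rewrite ac cb.
have [|v1c v2c] := min_second_derivative dv dv1 cab (cv2 c cab).
  by move=> y /andP[? ?]; apply: cmin; rewrite in_itv /= !ltW.
have := Lv c cab; rewrite v1c mulr0 addr0.
have : rr c * v c < 0 by rewrite pmulr_rlt0 // r0.
have : 0 <= e1 * v2 c by rewrite mulr_ge0 // ltW.
lra.
Qed.

(* Landau-Kolmogorov: the slope is controlled by the size of [z] at some point
   of an interval of length about [s], and the equation propagates this bound. *)
Lemma landau_bound a b s tau e2 bb rr z z1 z2 C d p : 0 < s -> 0 < tau ->
  tau * s <= b - a <= s -> 0 <= e2 -> 0 <= C -> e2 * C <= s / 2 ->
  (forall y, a <= y <= b -> is_derive y 1 z (z1 y)) ->
  (forall y, a <= y <= b -> is_derive y 1 z1 (z2 y)) ->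
  (forall y, a <= y <= b -> `|bb y| <= C) ->
  (forall y, a <= y <= b -> `|rr y| <= C) ->
  (forall y, a <= y <= b -> `|z y| <= d) ->
  (forall y, a <= y <= b -> `|- s ^+ 2 * z2 y + e2 * bb y * z1 y + rr y * z y| <= p) ->
  forall x, a <= x <= b -> s * `|z1 x| <= 2 * (2 * d / tau + C * d + p).
Proof.
move=> s0 tau0 /andP[h1 h2] e20 C0 e2C dz dz1 bC rC zd Lp.
have ts : 0 < tau * s by exact: mulr_gt0.
have ab : a < b by lra.
have cz : {within `[a, b], continuous (fun y => `|z1 y|)}.
  apply: continuous_in_subspaceT => y; rewrite inE /= in_itv /= => yab.
  by apply: cvg_norm; apply: is_derive_cvg (dz1 y yab).
have [y] := EVT_max (ltW ab) cz; rewrite in_itv /= => yab ymax.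
move=> x xab; apply: (@le_trans _ _ (s * `|z1 y|)).
  by apply: ler_wpM2l; [exact: ltW | apply: ymax; rewrite in_itv].
set m := `|z1 y|.
have d0 : 0 <= d by apply: le_trans (zd y yab).
have [xi] : exists2 t, t \in `]a, b[ & z b - z a = z1 t * (b - a).
  apply: MVT => //.
    by move=> t; rewrite in_itv /= => /andP[? ?]; apply: dz; lra.
  exact: (derive_within dz).
rewrite in_itv /= => xiab Exi.
have xi1 : s * `|z1 xi| <= 2 * d / tau.
  rewrite ler_pdivlMr //.
  have : `|z1 xi| * (b - a) <= 2 * d.
    have -> : `|z1 xi| * (b - a) = `|z b - z a|.
      by rewrite Exi normrM [`|b - a|]gtr0_norm // subr_gt0.
    have ha : `|z a| <= d by apply: zd; rewrite lexx ltW.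
    have hb : `|z b| <= d by apply: zd; rewrite lexx ltW.
    apply: (le_trans (ler_normB _ _)); lra.
  have := ler_wpM2l (normr_ge0 (z1 xi)) h1; lra.
(* The convection term contributes [s / 2 * m], which is absorbed into the left-hand side at the
   end; hence the outer factor 2 of the conclusion. *)
have z2b t : a <= t <= b -> s ^+ 2 * `|z2 t| <= s / 2 * m + C * d + p.
  move=> tab.
  have s2 : 0 < s ^+ 2 by rewrite exprn_gt0.
  rewrite -[X in X * _](gtr0_norm s2) -normrM.
  have -> : s ^+ 2 * z2 t = e2 * bb t * z1 t + rr t * z t - (- s ^+ 2 * z2 t + e2 * bb t * z1 t + rr t * z t) by ring.
  apply: (le_trans (ler_normB _ _)); apply: lerD (Lp t tab).
  apply: (le_trans (ler_normD _ _)); apply: lerD; rewrite !normrM.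
    rewrite (ger0_norm e20); apply: ler_pM => //; rewrite ?mulr_ge0 //.
      by apply: le_trans e2C; rewrite ler_wpM2l // bC.
    by apply: ymax; rewrite in_itv.
  by apply: ler_pM => //; [exact: rC | exact: zd].
have [t [tab Et]] : exists t, a <= t <= b /\ `|z1 y - z1 xi| = `|z2 t| * `|y - xi|.
  have [le1|/ltW le1] := leP xi y.
    have [t] : exists2 t, t \in `[xi, y] & z1 y - z1 xi = z2 t * (y - xi).
      apply: MVT_segment => //.
        by move=> t; rewrite in_itv /= => /andP[? ?]; apply: dz1; lra.
      by apply: (@derive_within _ _ _ _ z2) => t /andP[? ?]; apply: dz1; lra.
    rewrite in_itv /= => ht ->; exists t; rewrite normrM; split=> //; lra.
  have [t] : exists2 t, t \in `[y, xi] & z1 xi - z1 y = z2 t * (xi - y).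
    apply: MVT_segment => //.
      by move=> t; rewrite in_itv /= => /andP[? ?]; apply: dz1; lra.
    by apply: (@derive_within _ _ _ _ z2) => t /andP[? ?]; apply: dz1; lra.
  rewrite in_itv /= distrC => ht ->; exists t; rewrite normrM [`|xi - y|]distrC; split=> //; lra.
have yxi : `|y - xi| <= s by rewrite ler_norml; lra.
have m1 : m <= `|z1 xi| + `|z1 y - z1 xi|.
  by have := ler_normD (z1 xi) (z1 y - z1 xi); rewrite subrKC.
have key : s * `|z1 y - z1 xi| <= s / 2 * m + C * d + p.
  apply: le_trans (z2b t tab); rewrite Et expr2 -!mulrA ler_wpM2l ?(ltW s0) //.
  by rewrite mulrC ler_wpM2r.
have := ler_wpM2l (ltW s0) m1; lra.
Qed.

Lemma is_derive_expR_affine (k m x : R) :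
  is_derive x 1 (fun y => expR (k * y + m)) (k * expR (k * x + m)).
Proof.
have h1 : is_derive x 1 (fun y => k * y + m) k.
  have h := is_deriveD (is_deriveZ k (is_derive_id x 1)) (is_derive_cst m x 1).
  by rewrite addr0 [_ *: _]mulr1 in h.
have h2 : is_derive (k * x + m) 1 expR (expR (k * x + m)) by exact: is_derive_expR.
have := @is_derive1_comp R expR (fun y => k * y + m) x _ _ h2 h1.
by rewrite mulrC.
Qed.

(* Barrier argument; it is run on [[d, 1 - d]] because [z] need not extend
   continuously to the end points, which costs the factor 2. *)
Lemma layer_decay s e2 bb rr z z1 z2 C r0 be Z p : 0 < s -> 0 <= e2 <= s ->
  0 < r0 -> 0 < be -> be ^+ 2 + be * C <= r0 -> 0 <= p -> 0 <= Z ->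
  (forall y, 0 < y < 1 -> is_derive y 1 z (z1 y)) ->
  (forall y, 0 < y < 1 -> is_derive y 1 z1 (z2 y)) ->
  (forall y, 0 < y < 1 -> {for y, continuous z2}) ->
  (forall y, 0 < y < 1 -> `|bb y| <= C) ->
  (forall y, 0 < y < 1 -> r0 <= rr y) ->
  (forall y, 0 < y < 1 -> `|z y| <= Z) ->
  (forall y, 0 < y < 1 -> `|- s ^+ 2 * z2 y + e2 * bb y * z1 y + rr y * z y| <= p) ->
  forall x, 0 < x < 1 ->
   `|z x| <= p / r0 + 2 * Z * (expR (- (be / s) * x) + expR (- (be / s) * (1 - x))).
Proof.
move=> s0 /andP[e20 es] r00 be0 beC p0 Z0 dz dz1 cz2 bC rr0 zZ Lp x /[dup] x01 /andP[x0 x1].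
(* The last bound gives [expR (- (be / s) * d) >= 1 / 2], so that [2 * Z] times the barrier
   dominates [|z|] at [d] and [1 - d]. *)
pose d := Num.min (Num.min (x / 2) ((1 - x) / 2)) (s / (2 * be)).
have bes : 0 < s / (2 * be) by rewrite divr_gt0 // mulr_gt0.
have d0 : 0 < d by rewrite !lt_min bes andbT; apply/andP; split; lra.
have dx : d <= x / 2 by rewrite !ge_min lexx.
have dx1 : d <= (1 - x) / 2 by rewrite !ge_min lexx orbT.
have ds : d <= s / (2 * be) by rewrite ge_min lexx orbT.
pose k := be / s.
have k0 : 0 < k by rewrite divr_gt0.
have kd : k * d <= 1 / 2.
  have := ler_wpM2l (ltW k0) ds.
  by rewrite /k (_ : be / s * (s / (2 * be)) = 1 / 2) //; field; lra.
pose E0 y := expR (- k * y + 0); pose E1 y := expR (k * y + - k).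
suff key (sg : R) : `|sg| = 1 ->
    0 <= p / r0 + 2 * Z * (E0 x + E1 x) + sg * z x.
  have := key 1; have := key (-1); rewrite normrN normr1 => /(_ erefl) h1 /(_ erefl) h2.
  have -> : - (be / s) * x = - k * x + 0 by rewrite /k; ring.
  have -> : - (be / s) * (1 - x) = k * x + - k by rewrite /k; ring.
  rewrite ler_norml; move: h1 h2; rewrite /E0 /E1; lra.
move=> sg1.
have E0p y : 0 <= E0 y by exact: expR_ge0.
have E1p y : 0 <= E1 y by exact: expR_ge0.
have zle y : 0 < y < 1 -> - Z <= sg * z y.
  move=> y01; have : `|sg * z y| <= Z by rewrite normrM sg1 mul1r zZ.
  by rewrite ler_norml => /andP[].
have in01 y : d <= y <= 1 - d -> 0 < y < 1 by move=> /andP[? ?]; lra.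
have half_exp : 1 / 2 <= expR (- (k * d)).
  by apply: le_trans (expR_ge1Dx _); lra.
pose v y := p / r0 + 2 * Z * (E0 y + E1 y) + sg * z y.
pose v1 y := 2 * Z * (- k * E0 y + k * E1 y) + sg * z1 y.
pose v2 y := 2 * Z * (- k * (- k * E0 y) + k * (k * E1 y)) + sg * z2 y.
have dE0 y : is_derive y 1 E0 (- k * E0 y) by exact: is_derive_expR_affine.
have dE1 y : is_derive y 1 E1 (k * E1 y) by exact: is_derive_expR_affine.
have dv y : 0 < y < 1 -> is_derive y 1 v (v1 y).
  move=> y01; rewrite /v1 -[2 * Z * _]add0r.
  have hz := is_deriveZ sg (dz y y01).
  have hE := is_deriveZ (2 * Z) (is_deriveD (dE0 y) (dE1 y)).
  exact: (is_deriveD (is_deriveD (is_derive_cst (p / r0) y 1) hE) hz).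
have dv1 y : 0 < y < 1 -> is_derive y 1 v1 (v2 y).
  move=> y01; have hz := is_deriveZ sg (dz1 y y01).
  have hE := is_deriveZ (2 * Z) (is_deriveD (is_deriveZ (- k) (dE0 y)) (is_deriveZ k (dE1 y))).
  exact: (is_deriveD hE hz).
have s2 : 0 < s ^+ 2 by rewrite exprn_gt0.
have dd : d < 1 - d by lra.
have inoo y : d < y < 1 - d -> 0 < y < 1.
  by move=> /andP[? ?]; apply: in01; rewrite !ltW.
have cv : {within `[d, 1 - d], continuous v}.
  by apply: (@derive_within _ _ _ _ v1) => y /in01/dv.
have dv' y : d < y < 1 - d -> is_derive y 1 v (v1 y) by move=> /inoo/dv.
have dv1' y : d < y < 1 - d -> is_derive y 1 v1 (v2 y) by move=> /inoo/dv1.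
have cv2 y : d < y < 1 - d -> {for y, continuous v2}.
  move=> /inoo y01.
  have c0 := is_derive_cvg (dE0 y); have c1 := is_derive_cvg (dE1 y).
  apply: cvgD; last by apply: cvgMr; exact: cz2.
  by apply: cvgMr; apply: cvgD; do 2 apply: cvgMr.
have r' y : d < y < 1 - d -> 0 < rr y by move=> /inoo/rr0/(lt_le_trans r00).
have Lv y : d < y < 1 - d ->
    0 <= - s ^+ 2 * v2 y + e2 * bb y * v1 y + rr y * v y.
  move=> /inoo y01.
  have h1 : 0 <= p + sg * (- s ^+ 2 * z2 y + e2 * bb y * z1 y + rr y * z y).
    have : `|sg * (- s ^+ 2 * z2 y + e2 * bb y * z1 y + rr y * z y)| <= p.
      by rewrite normrM sg1 mul1r Lp.
    by rewrite ler_norml => /andP[]; lra.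
  have h2 : p <= p / r0 * rr y.
    by rewrite mulrAC ler_pdivlMr // ler_wpM2l // rr0.
  have ebk : `|e2 * bb y * k| <= be * C.
    rewrite normrM normrM (ger0_norm e20) (gtr0_norm k0).
    apply: (@le_trans _ _ (s * C * k)).
      by rewrite ler_wpM2r ?(ltW k0) // ler_pM // bC.
    by rewrite /k (_ : s * C * (be / s) = be * C) //; field; lra.
  have sk : s ^+ 2 * k ^+ 2 = be ^+ 2 by rewrite /k; field; lra.
  have rry := rr0 y y01.
  move: ebk; rewrite ler_norml => /andP[eb1 eb2].
  (* By [be ^+ 2 + be * C <= r0] both exponentials are supersolutions. *)
  have f0 : 0 <= (- s ^+ 2 * k ^+ 2 - e2 * bb y * k + rr y) * E0 y by rewrite mulr_ge0 //; lra.
  have f1 : 0 <= (- s ^+ 2 * k ^+ 2 + e2 * bb y * k + rr y) * E1 y by rewrite mulr_ge0 //; lra.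
  have := mulr_ge0 Z0 f0; have := mulr_ge0 Z0 f1.
  rewrite /v /v1 /v2; move: (E0 y) (E1 y) (z y) (z1 y) (z2 y) (p / r0) h1 h2 => *; lra.
have pr : 0 <= p / r0 by rewrite divr_ge0 // ltW.
have va : 0 <= v d.
  have d01 : 0 < d < 1 by apply: in01; lra.
  have hz := zle d d01.
  have h : 1 / 2 <= E0 d by rewrite /E0 addr0 mulNr.
  have := E1p d; rewrite /v; move: (E0 d) (E1 d) h => e f h f0; nra.
have vb : 0 <= v (1 - d).
  have d01 : 0 < 1 - d < 1 by apply: in01; lra.
  have hz := zle _ d01.
  have h : 1 / 2 <= E1 (1 - d) by rewrite /E1 (_ : k * (1 - d) + - k = - (k * d)) //; ring.
  have := E0p (1 - d); rewrite /v; move: (E0 _) (E1 _) h => e f h f0; nra.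
have xd : d <= x <= 1 - d by lra.
exact: (maximum_principle dd s2 cv dv' dv1' cv2 r' Lv va vb xd).
Qed.

End MaximumPrinciple.

(** * A priori bounds and the smooth part of the solution *)

Section Regularity.
Context {R : realType}.
Implicit Types (x y s e C G K r : R) (bj rj fj c : nat -> R -> R) (u : R -> R).

(** The factor 2 undoes the normalisation of the second derivative. *)
Definition ode (s e : R) bj rj c x : R :=
  - s ^+ 2 * (2 * c 2%N x) + e * bj 0%N x * c 1%N x + rj 0%N x * c 0%N x.

Lemma ode_lin s e bj rj c d (k l : R) x :
  ode s e bj rj (fun n y => k * c n y + l * d n y) x =
  k * ode s e bj rj c x + l * ode s e bj rj d x.
Proof. by rewrite /ode; ring. Qed.

Lemma jbound_ge0 A g c : jbound 0 1 A g c -> 0 <= A.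
Proof.
move=> h; have h12 : 0 < (1 / 2 : R) < 1 by lra.
by have := h 0%N _ h12; rewrite expr0 mulr1; exact: le_trans.
Qed.

Lemma jbound0 A g c x : jbound 0 1 A g c -> 0 < x < 1 -> `|c 0%N x| <= A.
Proof. by move=> h x01; have := h 0%N x x01; rewrite expr0 mulr1. Qed.

Lemma jet_der0 c x : jet 0 1 c -> 0 < x < 1 -> is_derive x 1 (c 0%N) (c 1%N x).
Proof. by move=> h /(h 0%N); rewrite mul1r. Qed.

Lemma jet_der1 c x : jet 0 1 c -> 0 < x < 1 ->
  is_derive x 1 (c 1%N) (2 * c 2%N x).
Proof. by move=> h /(h 1%N). Qed.

Lemma jet_cont c n x : jet 0 1 c -> 0 < x < 1 -> {for x, continuous (c n)}.
Proof. by move=> h /(h n); exact: is_derive_cvg. Qed.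

(** Maximum principle with the constant barrier [C / r0]. *)
Lemma solution_sup s e bj rj fj c C r0 : 0 < s -> 0 < r0 -> jet 0 1 c ->
  {within `[0, 1], continuous (c 0%N)} -> c 0%N 0 = 0 -> c 0%N 1 = 0 ->
  (forall x, 0 < x < 1 -> r0 <= rj 0%N x) ->
  (forall x, 0 < x < 1 -> `|fj 0%N x| <= C) ->
  (forall x, 0 < x < 1 -> ode s e bj rj c x = fj 0%N x) ->
  forall x, 0 <= x <= 1 -> `|c 0%N x| <= C / r0.
Proof.
move=> s0 r00 cj cc c0 c1 hr hf E.
have h12 : 0 < (1 / 2 : R) < 1 by lra.
have C0 : 0 <= C by apply: le_trans (hf _ h12).
have Cr : 0 <= C / r0 by rewrite divr_ge0 // ltW.
suff key (sg : R) : `|sg| = 1 -> forall x, 0 <= x <= 1 -> 0 <= C / r0 + sg * c 0%N x.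
  move=> x x01; have := key 1; have := key (-1); rewrite normrN normr1.
  move=> /(_ erefl _ x01) h1 /(_ erefl _ x01) h2.
  rewrite ler_norml; move: h1 h2; lra.
move=> sg1; have s2 : 0 < s ^+ 2 by rewrite exprn_gt0.
apply: (@maximum_principle _ 0 1 (s ^+ 2) e (bj 0%N) (rj 0%N)
  (fun x => C / r0 + sg * c 0%N x) (fun x => sg * c 1%N x) (fun x => sg * (2 * c 2%N x))).
- exact: ltr01.
- exact: s2.
- move=> x; apply: cvgD; first exact: cvg_cst.
  by apply: cvgMr; exact: cc.
- move=> y y01; rewrite -[sg * _]add0r.
  exact: (is_deriveD (is_derive_cst (C / r0) y 1) (is_deriveZ sg (jet_der0 cj y01))).
- move=> y y01; exact: (is_deriveZ sg (jet_der1 cj y01)).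
- by move=> y y01; do 2 apply: cvgMr; exact: jet_cont cj y01.
- by move=> y y01; apply: lt_le_trans r00 (hr y y01).
- move=> y y01; have := E y y01; rewrite /ode => Ey.
  have h2 : C <= C / r0 * rj 0%N y by rewrite mulrAC ler_pdivlMr // ler_wpM2l // hr.
  have : `|sg * fj 0%N y| <= C by rewrite normrM sg1 mul1r hf.
  rewrite ler_norml => /andP[h3 _].
  have -> : - s ^+ 2 * (sg * (2 * c 2%N y)) + e * bj 0%N y * (sg * c 1%N y) +
     rj 0%N y * (C / r0 + sg * c 0%N y) = C / r0 * rj 0%N y + sg * fj 0%N y.
    by rewrite -Ey; ring.
  lra.
- by rewrite c0 mulr0 addr0.
- by rewrite c1 mulr0 addr0.
Qed.

(** [landau_bound] is applied on an interval of length [s / 4] with [x] as an end point, on the side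
    that keeps it inside (0, 1). *)
Lemma solution_slope s e bj rj fj c C U : 0 < s -> s <= 1 -> 0 <= e -> 0 <= C ->
  e * C <= s / 2 -> jet 0 1 c ->
  (forall x, 0 < x < 1 -> `|bj 0%N x| <= C) ->
  (forall x, 0 < x < 1 -> `|rj 0%N x| <= C) ->
  (forall x, 0 < x < 1 -> `|fj 0%N x| <= C) ->
  (forall x, 0 < x < 1 -> `|c 0%N x| <= U) ->
  (forall x, 0 < x < 1 -> ode s e bj rj c x = fj 0%N x) ->
  forall x, 0 < x < 1 -> s * `|c 1%N x| <= 2 * (8 * U + C * U + C).
Proof.
move=> s0 s1 e0 C0 eC cj hb hr hf hU E x x01.
have main a b : 0 < a -> b < 1 -> b - a = s / 4 -> a <= x <= b ->
   s * `|c 1%N x| <= 2 * (8 * U + C * U + C).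
  move=> a0 b1 ba xab.
  have sub y : a <= y <= b -> 0 < y < 1 by move=> /andP[? ?]; lra.
  have -> : 8 * U = 2 * U / (1 / 4) by field.
  apply: (@landau_bound _ a b s (1 / 4) e (bj 0%N) (rj 0%N) (c 0%N) (c 1%N)
    (fun y => 2 * c 2%N y)) xab => //; try lra.
  - by move=> y /sub; exact: jet_der0.
  - by move=> y /sub; exact: jet_der1.
  - by move=> y /sub; exact: hb.
  - by move=> y /sub; exact: hr.
  - by move=> y /sub; exact: hU.
  - by move=> y /sub y01; have := E y y01; rewrite /ode => ->; exact: hf.
have [x12|x12] := leP x (1 / 2).
  by apply: (main x (x + s / 4)); lra.
by apply: (main (x - s / 4) x); lra.
Qed.

(** One correction of the expansion. Two derivatives raise the rate from [g] to [g'] through the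
    midpoint [m], each at a cost of at most [D]; multiplication by [bj] and division by [rj] keep
    the rate [g']. *)
Lemma smooth_step s e bj rj c A C G g g' r0 : 0 < s -> 0 <= e <= s -> 0 < r0 ->
  0 <= G -> 0 < g < g' -> 2 * G <= g' -> 4 * C * G <= r0 * g' ->
  jet 0 1 bj -> jet 0 1 rj -> jbound 0 1 C G bj -> jbound 0 1 C G rj ->
  (forall x, 0 < x < 1 -> r0 <= rj 0%N x) ->
  jet 0 1 c -> jbound 0 1 A g c ->
  let D := 2 * g' ^+ 2 / (g' - g) in
  exists c', [/\ jet 0 1 c',
    jbound 0 1 (A * (2 / r0 * ((s * D) ^+ 2 + 2 * C * (s * D)))) g' c' &
    forall x, 0 < x < 1 ->
      rj 0%N x * c' 0%N x = s ^+ 2 * (2 * c 2%N x) - e * bj 0%N x * c 1%N x].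
Proof.
move=> s0 /andP[e0 es] r00 G0 /andP[g0 gg] Gg CG jb jr bb br hr cj cb D.
have A0 := jbound_ge0 cb; have C0 := jbound_ge0 bb.
pose m := (g + g') / 2.
have gm : 0 < g < m by rewrite /m; lra.
have mg : 0 < m < g' by rewrite /m; lra.
have d0 : 0 < g' - g by lra.
have gp : 0 < g' by lra.
have D1 : 0 <= g * m / (m - g) <= D.
  have -> : g * m / (m - g) = 2 * (g * m) / (g' - g).
    by rewrite /m; field; lra.
  rewrite divr_ge0 /=; [|by rewrite !mulr_ge0 //; lra|lra].
  by rewrite /D ler_wpM2r ?invr_ge0 ?(ltW d0) // ler_wpM2l // expr2 ler_pM //; lra.
have D2 : 0 <= m * g' / (g' - m) <= D.
  have -> : m * g' / (g' - m) = 2 * (m * g') / (g' - g).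
    by rewrite /m; field; lra.
  rewrite divr_ge0 /=; [|by rewrite !mulr_ge0 //; lra|lra].
  by rewrite /D ler_wpM2r ?invr_ge0 ?(ltW d0) // ler_wpM2l // expr2 ler_pM //; lra.
have D0 : 0 <= D by lra.
have j1 := jet_der cj; have j2 := jet_der j1.
have AD : 0 <= A * (g * m / (m - g)) by rewrite mulr_ge0 //; lra.
have b1 := jder_bound gm A0 cb.
have b2 := jder_bound mg AD b1.
have b1' : jbound 0 1 (A * D) g' (jder c).
  apply: jboundW b1; [lra | by rewrite ler_wpM2l //; lra | lra | exact: mulr_ge0].
have b2' : jbound 0 1 (A * D ^+ 2) g' (jder (jder c)).
  apply: jboundW b2 => //; [lra| | by apply: mulr_ge0 => //; apply: exprn_ge0].
  by rewrite -mulrA ler_wpM2l // expr2 ler_pM //; lra.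
pose h n x := s ^+ 2 * jder (jder c) n x + (- e) * cprod bj (jder c) n x.
have jh : jet 0 1 h by apply: jet_lin => //; exact: jet_cprod.
have bh : jbound 0 1 (A * ((s * D) ^+ 2 + 2 * C * (s * D))) g' h.
  move=> n x x01; apply: (le_trans (ler_normD _ _)).
  rewrite (normrM (s ^+ 2)) (normrM (- e)) normrN (ger0_norm e0).
  rewrite [`|s ^+ 2|]ger0_norm ?exprn_ge0 ?(ltW s0) //.
  have h1 := b2' n x x01.
  have h2 : `|cprod bj (jder c) n x| <= 2 * C * (A * D) * g' ^+ n.
    by apply: (cprod_le G0 Gg) => k _; [exact: bb | exact: b1'].
  have h3 : e * `|cprod bj (jder c) n x| <= s * (2 * C * (A * D) * g' ^+ n).
    by apply: ler_pM.
  have -> : A * ((s * D) ^+ 2 + 2 * C * (s * D)) * g' ^+ n =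
      s ^+ 2 * (A * D ^+ 2 * g' ^+ n) + s * (2 * C * (A * D) * g' ^+ n) by ring.
  by apply: lerD h3; exact: (ler_wpM2l (exprn_ge0 2 (ltW s0)) h1).
have rn0 x : 0 < x < 1 -> rj 0%N x != 0.
  by move=> /hr h0; rewrite gt_eqF // (lt_le_trans r00).
have [jc' Ec'] := jet_quotient jr jh rn0.
exists (tjet (fun x => h 0%N x / rj 0%N x)); split => //.
  by have := quotient_bound r00 G0 Gg CG hr br bh Ec'; rewrite mulrCA.
move=> x x01; have := Ec' 0%N x x01; rewrite /cprod big_ord1 subnn => ->.
by rewrite /h /cprod big_ord1 /jder subnn; ring.
Qed.

(* [w] is a partial sum of the formal expansion: the defect [r c] of the first j
   terms is removed by adding [c], which leaves the defect
   s^2 c'' - e b c'. The rate of [c] grows by [g / M] at each of the M steps. *)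
Lemma smooth_part s e bj rj fj C G g r0 (M : nat) : 0 < s -> 0 <= e <= s ->
  0 < r0 -> 0 <= G -> 0 < g -> 2 * G <= g -> 4 * C * G <= r0 * g ->
  jet 0 1 bj -> jet 0 1 rj -> jet 0 1 fj ->
  jbound 0 1 C G bj -> jbound 0 1 C G rj -> jbound 0 1 C G fj ->
  (forall x, 0 < x < 1 -> r0 <= rj 0%N x) ->
  let X := 8 * g * (M%:R * s) in
  2 / r0 * (X ^+ 2 + 2 * C * X) <= expR (-1) ->
  exists c, [/\ jet 0 1 c, jbound 0 1 (4 * C / r0) (2 * g) c &
   forall x, 0 < x < 1 ->
     `|ode s e bj rj c x - fj 0%N x| <= 2 * C ^+ 2 / r0 * expR (- M%:R)].
Proof.
move=> s0 hes r00 G0 g0 Gg CG jb jr jf bb br bf hr X hX.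
have C0 := jbound_ge0 bb.
pose A0 := 2 / r0 * C.
have A00 : 0 <= A0 by rewrite mulr_ge0 // divr_ge0 // ltW.
pose gj (j : nat) : R := g * (1 + j%:R / M%:R).
have gj_ge j : g <= gj j.
  by rewrite /gj ler_peMr ?(ltW g0) // lerDl divr_ge0.
have gj_le j : (j <= M)%N -> gj j <= 2 * g.
  move=> jM; rewrite /gj mulrC ler_wpM2r ?(ltW g0) //.
  case: (posnP M) => [->|M0]; first by rewrite invr0 mulr0; lra.
  have : j%:R / M%:R <= 1 :> R by rewrite ler_pdivrMr ?ltr0n // mul1r ler_nat.
  lra.
(* The hypothesis on [X] shrinks each correction by the factor [th]: after [M] steps the defect is
   of order [expR (- M)], and since [th <= 1 / 2] the partial sums stay bounded. *)
pose th := expR (-1) : R.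
have th0 : 0 <= th by exact: expR_ge0.
have th12 : th <= 1 / 2.
  have h1 := expR_ge1Dx (1 : R); have := expRxMexpNx_1 (1 : R).
  have := expR_gt0 (-1 : R); rewrite -/th; nra.
have rn0 x : 0 < x < 1 -> rj 0%N x != 0.
  by move=> /hr h0; rewrite gt_eqF // (lt_le_trans r00).
suff [w [c [jw bw jc bc E]]] : exists w c, [/\ jet 0 1 w,
    jbound 0 1 (A0 * (2 - 2 * (1 / 2) ^+ M)) (2 * g) w, jet 0 1 c,
    jbound 0 1 (A0 * th ^+ M) (gj M) c &
    forall x, 0 < x < 1 -> ode s e bj rj w x = fj 0%N x - rj 0%N x * c 0%N x].
  exists w; split => // [|x x01].
    have B0 : 0 <= 4 * C / r0 by rewrite divr_ge0 ?mulr_ge0 // ltW.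
    apply: jboundW bw => //; first lra.
    have -> : 4 * C / r0 = A0 * 2 by rewrite /A0; field; lra.
    by rewrite ler_wpM2l // lerBlDr lerDl mulr_ge0.
  rewrite E // addrAC subrr add0r normrN normrM.
  have -> : 2 * C ^+ 2 / r0 * expR (- M%:R) = C * (A0 * th ^+ M).
    by rewrite /A0 /th -expRM_natl mulrN1; field; lra.
  by apply: ler_pM => //; [exact: jbound0 br x01 | exact: jbound0 bc x01].
have {gj_le}gj_le j := @gj_le j.
suff step j : (j <= M)%N -> exists w c, [/\ jet 0 1 w,
    jbound 0 1 (A0 * (2 - 2 * (1 / 2) ^+ j)) (2 * g) w, jet 0 1 c,
    jbound 0 1 (A0 * th ^+ j) (gj j) c &
    forall x, 0 < x < 1 -> ode s e bj rj w x = fj 0%N x - rj 0%N x * c 0%N x].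
  exact: step.
elim: j => [_|j IH jM].
  have [jc Ec] := jet_quotient jr jf rn0.
  exists (fun _ _ => 0), (tjet (fun x => fj 0%N x / rj 0%N x)); split => //.
  - by move=> n x _; rewrite mulr0; exact: is_derive_cst.
  - by move=> n x _; rewrite expr0 mulr1 subrr mulr0 mul0r normr0.
  - have -> : gj 0%N = g by rewrite /gj mul0r addr0 mulr1.
    rewrite expr0 mulr1.
    apply: (quotient_bound r00 G0 Gg CG hr br _ Ec).
    apply: jboundW bf => //; lra.
  - move=> x x01; have := Ec 0%N x x01; rewrite /cprod big_ord1 subnn => ->.
    by rewrite /ode; ring.
have [w [c [jw bw jc bc E]]] := IH (ltnW jM).
have M0 : 0 < M%:R :> R by rewrite ltr0n (leq_trans _ jM).
have gap : gj j.+1 - gj j = g / M%:R by rewrite /gj -natr1; field; lra.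
have gM : 0 < g / M%:R by rewrite divr_gt0.
have gg : 0 < gj j < gj j.+1.
  by rewrite (lt_le_trans g0 (gj_ge j)) /=; lra.
have Gg' : 2 * G <= gj j.+1 by apply: le_trans (gj_ge _).
have CG' : 4 * C * G <= r0 * gj j.+1.
  by apply: (le_trans CG); rewrite ler_wpM2l ?(ltW r00).
have [c' [jc' bc' Ec']] := smooth_step s0 hes r00 G0 gg Gg' CG' jb jr bb br hr jc bc.
exists (fun n x => 1 * w n x + 1 * c n x), c'; split => //.
- exact: jet_lin.
- move=> n x x01; rewrite [1 * w n x]mul1r [1 * c n x]mul1r; apply: (le_trans (ler_normD _ _)).
  have h1 := bw n x x01.
  have h2 : `|c n x| <= A0 * (1 / 2) ^+ j * (2 * g) ^+ n.
    apply: (le_trans (bc n x x01)); apply: ler_pM.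
    - by rewrite mulr_ge0 ?exprn_ge0.
    - by rewrite exprn_ge0 // (le_trans (ltW g0)).
    - by rewrite ler_wpM2l // lerXn2r ?nnegrE.
    - by rewrite lerXn2r ?nnegrE ?(le_trans (ltW g0)) ?gj_le ?(ltnW jM) //; lra.
  rewrite exprS; lra.
- apply: jboundW bc' => //; [exact: (le_trans (ltW g0) (gj_ge _)) | |].
    2: by apply: mulr_ge0 => //; apply: exprn_ge0.
  rewrite (exprSr th) [leRHS]mulrA; apply: ler_wpM2l.
    by apply: mulr_ge0 => //; apply: exprn_ge0.
  apply: le_trans hX; rewrite gap.
  (* With the gap [g / M] and rates at most [2 * g], one has [D <= 8 * g * M]; this is the origin of
     [X]. *)
  set D := 2 * _ / _.
  have DX : s * D <= X.
    rewrite /D /X; have -> : s * (2 * gj j.+1 ^+ 2 / (g / M%:R)) = (2 * gj j.+1 ^+ 2) * (M%:R * s / g).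
      by field; lra.
    have -> : 8 * g * (M%:R * s) = 2 * (2 * g) ^+ 2 * (M%:R * s / g) by field; lra.
    rewrite ler_wpM2r ?divr_ge0 ?mulr_ge0 ?(ltW s0) ?(ltW g0) // ler_wpM2l //.
    by rewrite lerXn2r ?nnegrE ?(le_trans (ltW g0)) ?gj_le //; lra.
  have D0 : 0 <= s * D.
    apply: mulr_ge0; first exact: ltW.
    apply: divr_ge0; last exact: ltW.
    by apply: mulr_ge0 => //; apply: exprn_ge0; apply: le_trans (gj_ge _); exact: ltW.
  rewrite ler_wpM2l ?divr_ge0 ?(ltW r00) //; apply: lerD.
    by rewrite lerXn2r ?nnegrE // (le_trans D0).
  by rewrite ler_wpM2l // mulr_ge0.
- move=> x x01; rewrite ode_lin E // Ec' // /ode; ring.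
Qed.

End Regularity.

(** * Weak derivatives on a mesh *)

Section PiecewiseIntegrals.
Context {R : realType}.
Notation mu := (@lebesgue_measure R).
Implicit Types (a b x l M : R) (f g h : R -> R).

Lemma bdcont_measurable a b f : bdcont a b f -> measurable_fun `]a, b[ f.
Proof. by move=> /bdcont_integrable /measurable_int /measurable_EFinP. Qed.

Lemma Rint_pieces (X : nat -> R) N g :
  (forall k, (k < N)%N -> X k < X k.+1) ->
  (forall k, (k < N)%N -> bdcont (X k) (X k.+1) g) ->
  measurable_fun `]X 0%N, X N[ g /\
  \int[mu]_(x in `]X 0%N, X N[) g x = \sum_(k < N) \int[mu]_(x in `]X k, X k.+1[) g x.
Proof.
move=> Xlt bg.
suff [mg Eg] : measurable_fun `]X 0%N, X N[ g /\
   (\int[mu]_(x in `]X 0%N, X N[) (g x)%:E =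
   (\sum_(k < N) \int[mu]_(x in `]X k, X k.+1[) g x)%:E)%E.
  by split=> //; rewrite /Rintegral Eg.
elim: N Xlt bg => [|N IH] Xlt bg.
  by rewrite set_itvoo0 ?lexx // big_ord0 integral_set0; split => //; exact: measurable_fun_set0.
have [|k kN|mg Eg] := IH; first by move=> k /ltnW kN; exact: Xlt.
  by apply: bg; exact: ltnW.
have X0N : X 0%N <= X N.
  elim: N Xlt {bg IH mg Eg} => // N IH Xlt.
  have h := Xlt N (ltnW (ltnSn N.+1)); apply: le_trans (ltW h).
  by apply: IH => k kN; apply: Xlt; exact: ltnW.
have XN : X N < X N.+1 by exact: Xlt.
have mg1 : measurable_fun `]X 0%N, X N] g.
  move: X0N; rewrite le_eqVlt => /predU1P[<-|X0N].
    by rewrite set_itvoc0 ?lexx //; exact: measurable_fun_set0.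
  rewrite -(@setUitv1 _ _ (BRight (X 0%N)) (X N) true) ?bnd_simp //.
  by apply/measurable_funU => //; split => //; exact: measurable_fun_set1.
have mg2 := bdcont_measurable (bg N (ltnSn N)).
have E : `]X 0%N, X N.+1[%classic = `]X 0%N, X N] `|` `]X N, X N.+1[.
  by rewrite -itv_bndbnd_setU // ?bnd_simp.
rewrite E; split; first by apply/measurable_funU.
rewrite integral_setU //; last 2 first.
- by apply/measurable_EFinP; apply/measurable_funU.
- apply/disj_setPS => y [] /=; rewrite !in_itv /= => /andP[_ h] /andP[h' _].
  by move: (lt_le_trans h' h); rewrite ltxx.
rewrite big_ord_recr /= EFinD -Eg; congr (_ + _)%E.
  by rewrite integral_itv_bndo_bndc //; exact/measurable_EFinP.
rewrite /Rintegral fineK //; apply: integrable_fin_num => //.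
exact: bdcont_integrable (bg N (ltnSn N)).
Qed.

Lemma L2_bounded a b f M : measurable_fun `]a, b[ f ->
  (forall x, a < x < b -> `|f x| <= M) -> L2 `]a, b[ f.
Proof.
move=> mf fM; have mD : measurable (`]a, b[ : set R) by [].
have mr := (measurable_restrictT f mD).1 mf.
rewrite /L2 inE; apply/andP; split; first by rewrite inE.
rewrite inE /= /finite_norm unlock /= poweR_lty //.
apply: (@le_lt_trans _ _ (\int[mu]_x ((M ^+ 2)%:E * (\1_(`]a, b[ : set R) x)%:E))%E).
  apply: ge0_le_integral => //.
  - apply/measurable_EFinP.
    apply/(@measurableT_comp _ _ _ _ _ _ (fun x : R => x `^ 2)%R) => //.
    by apply: measurableT_comp => //; exact: mr.
  - apply/measurable_EFinP; apply: measurable_funM => //.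
  move=> x _; rewrite /= -EFinM lee_fin patchE indicE.
  case: ifPn => xab; last by rewrite normr0 powR0 // mulr0.
  rewrite mulr1 powR_mulrn // lerXn2r ?nnegrE //.
    by apply: (le_trans (normr_ge0 (f x))); apply: fM; move: xab; rewrite inE /= in_itv.
  by apply: fM; move: xab; rewrite inE /= in_itv.
rewrite integralZl //; last exact: integrable_indic_itv.
rewrite integral_indic // setIT /= lebesgue_measure_itv /=.
by case: ifP => _; rewrite ?mule0 ?ltry // -EFinB -EFinM ltry.
Qed.

Lemma within_cvg_right f a : {within `[0, 1], continuous f} -> 0 <= a < 1 ->
  f x @[x --> a^'+] --> f a.
Proof.
move=> cf /andP[a0 a1].
have cf' : {within `[a, 1], continuous f}.
  by apply: continuous_subspaceW cf; apply: subset_itvr; rewrite bnd_simp.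
by have /continuous_within_itvP[] := cf'.
Qed.

Lemma within_cvg_left f a : {within `[0, 1], continuous f} -> 0 < a <= 1 ->
  f x @[x --> a^'-] --> f a.
Proof.
move=> cf /andP[a0 a1].
have cf' : {within `[0, a], continuous f}.
  by apply: continuous_subspaceW cf; apply: subset_itvl; rewrite bnd_simp.
by have /continuous_within_itvP[] := cf'.
Qed.

Lemma cvg_right_eq f g a b l : a < b -> (forall x, a < x < b -> f x = g x) ->
  g x @[x --> a^'+] --> l -> f x @[x --> a^'+] --> l.
Proof.
move=> ab fg; apply: cvg_trans; apply: near_eq_cvg; near=> x.
by apply: esym; apply: fg; apply/andP; split.
Unshelve. all: by end_near. Qed.

Lemma cvg_left_eq f g a b l : a < b -> (forall x, a < x < b -> f x = g x) ->
  g x @[x --> b^'-] --> l -> f x @[x --> b^'-] --> l.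
Proof.
move=> ab fg; apply: cvg_trans; apply: near_eq_cvg; near=> x.
by apply: esym; apply: fg; apply/andP; split.
Unshelve. all: by end_near. Qed.

Lemma horner_cvg_right (p : {poly R}) a : p.[x] @[x --> a^'+] --> p.[a].
Proof. by apply: cvg_at_right_filter; exact: continuous_horner. Qed.

Lemma horner_cvg_left (p : {poly R}) a : p.[x] @[x --> a^'-] --> p.[a].
Proof. by apply: cvg_at_left_filter; exact: continuous_horner. Qed.

Lemma H1_poly a b (p : {poly R}) f : a < b ->
  (forall x, a < x < b -> f x = p.[x]) -> H1 a b f.
Proof.
move=> ab fp.
have bf : bdcont a b f.
  apply: bdcont_eq (bdcont_horner a b p) => x xab; by rewrite fp.
have L2p (q : {poly R}) : L2 `]a, b[ (horner q).
  have bq := bdcont_horner a b q; have [_ [M hM]] := bq.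
  by apply: L2_bounded hM; exact: bdcont_measurable.
split.
- have [_ [M hM]] := bf.
  by apply: L2_bounded hM; exact: bdcont_measurable.
- by move=> x; rewrite in_itv => /= xab; case: bf => cf _; exact: cf.
exists (horner p^`()) => // phi [sphi [c [d [ac db hcd]]]].
have dphi x : is_derive x 1 phi (derive1 phi x).
  by apply: DeriveDef; [exact: (sphi 0%N) | rewrite derive1E].
have dphi1 x : is_derive x 1 (derive1 phi) (derive1n 2 phi x).
  by apply: DeriveDef; [exact: (sphi 1%N) | rewrite [RHS]/= [RHS]derive1E].
have phi0 x : ~~ (c <= x <= d) -> phi x = 0.
  by move=> h; apply: contraNeq h; exact: hcd.
have bphi : bdcont a b phi.
  by apply: bdcont_within => //; apply: (@derive_within _ _ _ _ (derive1 phi)).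
have bphi1 : bdcont a b (derive1 phi).
  by apply: bdcont_within => //; apply: (@derive_within _ _ _ _ (derive1n 2 phi)).
have bp := bdcont_horner a b p; have bp1 := bdcont_horner a b p^`().
have := @FTC_open _ a b (fun x => p.[x] * phi x)
   (fun x => p.[x] * derive1 phi x + p^`().[x] * phi x) 0 0 ab.
rewrite subrr bdcont_RintD; [|exact: bdcontM|exact: bdcontM].
rewrite (eq_Rint_oo (f := fun x => f x * _) (g := fun x => p.[x] * derive1 phi x)); last first.
  by move=> x xab; rewrite fp.
move=> H; apply/eqP; rewrite -addr_eq0; apply/eqP; apply: H.
- move=> x _; have h := is_deriveM (is_derive_horner p x) (dphi x).
  have -> : p.[x] * derive1 phi x + p^`().[x] * phi x = p.[x] *: derive1 phi x + phi x *: p^`().[x].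
    by rewrite [phi x *: _]mulrC.
  exact: h.
- by apply: bdcontD; exact: bdcontM.
- have -> : 0 = p.[a] * phi a.
    by rewrite phi0 ?mulr0 //; apply/negP => /andP[h _]; move: (lt_le_trans ac h); rewrite ltxx.
  apply: cvgM; first exact: horner_cvg_right.
  by apply: cvg_at_right_filter; exact: is_derive_cvg (dphi a).
- have -> : 0 = p.[b] * phi b.
    by rewrite phi0 ?mulr0 //; apply/negP => /andP[_ h]; move: (le_lt_trans h db); rewrite ltxx.
  apply: cvgM; first exact: horner_cvg_left.
  by apply: cvg_at_left_filter; exact: is_derive_cvg (dphi b).
Qed.

(** A nonzero value inside the interval would give, by continuity, a subinterval with a positive
    contribution. So every interior point is a root, and [size p] roots are too many for a nonzero
    polynomial. *)
Lemma Rint_sqr_eq0 a b (p : {poly R}) : a < b ->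
  \int[mu]_(x in `]a, b[) (p.[x] * p.[x]) = 0 -> p = 0.
Proof.
move=> ab int0; apply/eqP; apply/negPn/negP => p0.
have bp := bdcont_horner a b p.
have root_ab x0 : a < x0 < b -> root p x0.
  move=> x0ab; apply/negPn/negP; rewrite /root => px0.
  have pos : 0 < `|p.[x0]| by rewrite normr_gt0.
  have h2 : `|p.[x0]| / 2 < `|p.[x0]| by lra.
  have : \forall y \near x0, a < y < b /\ `|p.[x0]| / 2 < `|p.[y]|.
    apply: filterI; first exact: nbhs_oo.
    apply: (cvgr_gt _ (cvg_norm (_ : p.[y] @[y --> x0] --> p.[x0]))) => //.
    exact: continuous_horner.
  move=> /nbhs_ballP [e /= e0 he].
  pose c := x0 - e / 2; pose d := x0 + e / 2.
  have ball_cd y : c <= y <= d -> a < y < b /\ `|p.[x0]| / 2 < `|p.[y]|.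
    by rewrite /c /d => /andP[? ?]; apply: he; rewrite /ball /= ltr_norml; lra.
  have [cab _] : a < c < b /\ `|p.[x0]| / 2 < `|p.[c]| by apply: ball_cd; rewrite /c /d; lra.
  have [dab _] : a < d < b /\ `|p.[x0]| / 2 < `|p.[d]| by apply: ball_cd; rewrite /c /d; lra.
  have cd : c < d by rewrite /c /d; lra.
  have bpp : bdcont a b (fun x => p.[x] * p.[x]) by exact: bdcontM.
  have sq x : 0 <= p.[x] * p.[x] by rewrite -expr2 sqr_ge0.
  have cdb : c < d < b by rewrite cd; lra.
  move: int0; rewrite (Rint_oo_split cab bpp) (Rint_oo_split cdb); last first.
    by apply: bdcontW bpp; lra.
  have i1 : 0 <= \int[mu]_(x in `]a, c[) (p.[x] * p.[x]) by apply: Rintegral_ge0.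
  have i3 : 0 <= \int[mu]_(x in `]d, b[) (p.[x] * p.[x]) by apply: Rintegral_ge0.
  have i2 : (`|p.[x0]| / 2) ^+ 2 * (d - c) <= \int[mu]_(x in `]c, d[) (p.[x] * p.[x]).
    rewrite -Rint_oo_cst ?(ltW cd) //; apply: le_Rint_oo; first exact: bdcont_cst.
      by apply: bdcontW bpp; lra.
    move=> x /andP[xc xd]; have [|_ h] := ball_cd x; first by rewrite !ltW.
    rewrite -expr2 -(real_normK (num_real p.[x])) lerXn2r ?nnegrE ?(ltW h) //.
  have : 0 < (`|p.[x0]| / 2) ^+ 2 * (d - c).
    by rewrite mulr_gt0 ?exprn_gt0 ?subr_gt0 // divr_gt0.
  move=> h4 /eqP; rewrite gt_eqF //; apply: ltr_wpDl => //; apply: ltr_wpDr => //.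
  exact: lt_le_trans h4 i2.
pose s := [seq a + (b - a) * (k.+1%:R / (size p).+1%:R) | k <- iota 0 (size p)].
have n0 : 0 < (size p).+1%:R :> R by [].
have sall : all (root p) s.
  apply/allP => y /mapP [k]; rewrite mem_iota add0n => /andP[_ kp] ->.
  apply: root_ab; have k1 : 0 < k.+1%:R / (size p).+1%:R :> R by rewrite divr_gt0.
  have k2 : k.+1%:R / (size p).+1%:R < 1 :> R by rewrite ltr_pdivrMr // mul1r ltr_nat.
  by rewrite ltrDl mulr_gt0 ?subr_gt0 //= -ltrBrDl gtr_pMr ?subr_gt0.
have suniq : uniq s.
  rewrite map_inj_uniq ?iota_uniq // => k l /addrI /mulfI.
  rewrite subr_eq0 gt_eqF // => /(_ isT) /mulIf.
  rewrite invr_eq0 gt_eqF // => /(_ isT) /eqP.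
  by rewrite eqr_nat => /eqP [].
by have := max_poly_roots p0 sall suniq; rewrite size_map size_iota ltnn.
Qed.

(* Nondegeneracy of the Gram matrix of the monomials. *)
Lemma poly_riesz a b n (L : {poly R} -> R) : a < b ->
  (forall (k : R) p q, L (k *: p + q) = k * L p + L q) ->
  exists2 d : {poly R}, (size d <= n)%N & forall q : {poly R}, (size q <= n)%N ->
    \int[mu]_(x in `]a, b[) (d.[x] * q.[x]) = L q.
Proof.
move=> ab Llin.
have L0 : L 0 = 0 by have := Llin (-1) 0 0; rewrite scaler0 addr0; lra.
have Lsum (I : finType) (F : I -> {poly R}) (k : I -> R) :
    L (\sum_i k i *: F i) = \sum_i k i * L (F i).
  by elim/big_rec2: _ => [|i y x _ <-]; rewrite ?L0 // Llin.
pose ip (p q : {poly R}) := \int[mu]_(x in `]a, b[) (p.[x] * q.[x]).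
have bM (p q : {poly R}) : bdcont a b (fun x => p.[x] * q.[x]).
  by apply: bdcontM; exact: bdcont_horner.
have ipC p q : ip p q = ip q p by apply: eq_Rint_oo => x _; rewrite mulrC.
have iplin r (k : R) p q : ip (k *: p + q) r = k * ip p r + ip q r.
  rewrite /ip -bdcont_RintZ // -bdcont_RintD //; last first.
    by apply: bdcontM => //; exact: bdcont_cst.
  by apply: eq_Rint_oo => x _; rewrite hornerD hornerZ mulrDl mulrA.
have ip0 r : ip 0 r = 0 by have := iplin r (-1) 0 0; rewrite scaler0 addr0; lra.
have ipsum r (I : finType) (F : I -> {poly R}) (k : I -> R) :
    ip (\sum_i k i *: F i) r = \sum_i k i * ip (F i) r.
  by elim/big_rec2: _ => [|i y x _ <-]; rewrite ?ip0 // iplin.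
pose G : 'M[R]_n := \matrix_(i, j) ip 'X^i 'X^j.
have rVE (v : 'rV[R]_n) : rVpoly v = \sum_i v 0 i *: 'X^i.
  apply/polyP => k; rewrite coef_rVpoly coef_sum.
  case: insubP => [i _ <-|].
    rewrite (bigD1 i) //= coefZ coefXn eqxx mulr1 big1 ?addr0 // => j ji.
    by rewrite coefZ coefXn [_ == _](_ : _ = false) ?mulr0 //; apply/negbTE; rewrite eq_sym.
  rewrite -leqNgt => nk; rewrite big1 // => j _; rewrite coefZ coefXn.
  by rewrite gtn_eqF ?mulr0 // (leq_trans (ltn_ord j)).
have vG (v : 'rV[R]_n) j : (v *m G) 0 j = ip (rVpoly v) 'X^j.
  by rewrite rVE ipsum mxE; apply: eq_bigr => i _; rewrite mxE.
have Gu : G \in unitmx.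
  rewrite -row_free_unit; apply: inj_row_free => v v0.
  have h : ip (rVpoly v) (rVpoly v) = 0.
    rewrite {1}rVE ipsum big1 // => j _.
    by rewrite ipC -vG v0 mxE mulr0.
  by rewrite -(rVpolyK v) (Rint_sqr_eq0 ab h) linear0.
pose v : 'rV[R]_n := (\row_j L 'X^j) *m invmx G.
exists (rVpoly v) => [|q sq]; first exact: size_poly.
have [u qE] : exists u : 'rV[R]_n, q = \sum_i u 0 i *: 'X^i.
  by exists (poly_rV q); rewrite -rVE poly_rV_K.
transitivity (ip q (rVpoly v)); first exact: ipC.
rewrite qE ipsum Lsum.
apply: eq_bigr => j _; congr (_ * _).
by rewrite ipC -vG /v mulmxKV // mxE.
Qed.

End PiecewiseIntegrals.

Lemma bdcont_lin {R : realType} (a b k l : R) (f g : R -> R) :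
  bdcont a b f -> bdcont a b g -> bdcont a b (fun x => k * f x + l * g x).
Proof. by move=> hf hg; apply: bdcontD; apply: bdcontM => //; exact: bdcont_cst. Qed.

(** * Energy identities on one element *)

Section ElementIdentities.
Context {R : realType}.
Notation mu := (@lebesgue_measure R).
Context (a c : R) (b b1 r f : R -> R) (a0 : 0 <= a) (ac : a < c) (c1 : c <= 1).
Context (cb : {within `[0, 1], continuous b}).
Context (db : forall x : R, 0 < x < 1 -> is_derive x 1 b (b1 x)).
Context (bb1 : bdcont 0 1 b1) (br : bdcont 0 1 r) (bf : bdcont 0 1 f).

Let bd g : bdcont 0 1 g -> bdcont a c g.
Proof. by apply: bdcontW. Qed.

Let bb : bdcont 0 1 b.
Proof. by apply: bdcont_within. Qed.

Let in01 x : a < x < c -> 0 < x < 1.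
Proof. by move=> /andP[ax xc]; rewrite (le_lt_trans a0) // (lt_le_trans xc). Qed.

Lemma Rint_lin (k l : R) g h : bdcont a c g -> bdcont a c h ->
  \int[mu]_(x in `]a, c[) (k * g x + l * h x) = k * \int[mu]_(x in `]a, c[) g x + l * \int[mu]_(x in `]a, c[) h x.
Proof.
move=> hg hh; rewrite bdcont_RintD ?bdcont_RintZ //;
  by apply: bdcontM => //; exact: bdcont_cst.
Qed.

Lemma FTC_poly (T : {poly R}) : \int[mu]_(x in `]a, c[) T^`().[x] = T.[c] - T.[a].
Proof.
apply: (FTC_open ac (F := horner T)).
- exact: bdcont_horner.
- exact: horner_cvg_right.
- exact: horner_cvg_left.
Qed.

Lemma is_derive_weighted (T : {poly R}) x : a < x < c ->
  is_derive x 1 (fun x => b x * T.[x]) (b1 x * T.[x] + b x * T^`().[x]).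
Proof.
move=> /in01 x01; have h := is_deriveM (db x01) (is_derive_horner T x).
have -> : b1 x * T.[x] + b x * T^`().[x] = b x *: T^`().[x] + T.[x] *: b1 x.
  by rewrite addrC [b1 x * _]mulrC.
exact: h.
Qed.

Lemma FTC_weighted (T : {poly R}) :
  \int[mu]_(x in `]a, c[) (b1 x * T.[x] + b x * T^`().[x]) =
  b c * T.[c] - b a * T.[a].
Proof.
apply: (FTC_open ac (F := fun x => b x * T.[x])).
- by move=> x xac; exact: is_derive_weighted.
- by apply: bdcontD; apply: bdcontM; [exact: bd | exact: bdcont_horner | exact: bd | exact: bdcont_horner].
- by apply: cvgM; [apply: within_cvg_right => //; rewrite a0 (lt_le_trans ac) | exact: horner_cvg_right].
- by apply: cvgM; [apply: within_cvg_left => //; rewrite c1 (le_lt_trans a0) | exact: horner_cvg_left].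
Qed.

Lemma derive1_weighted (q : {poly R}) x : a < x < c ->
  derive1 (fun x => b x * q.[x]) x = b1 x * q.[x] + b x * q^`().[x].
Proof.
by move=> xac; rewrite derive1E; have [_ ->] := is_derive_weighted q xac.
Qed.

(** Here [n] bounds sizes, not degrees: the weak derivative of order [p.-1] satisfies this with
    [n = p], and the convection derivative of order [p] satisfies [wc_rel] with [p.+1]. *)
Definition wd_rel n (P : {poly R}) (bl br : R) (d : {poly R}) :=
  forall q : {poly R}, (size q <= n)%N ->
  \int[mu]_(x in `]a, c[) (d.[x] * q.[x]) =
  - (\int[mu]_(x in `]a, c[) (P.[x] * q^`().[x])) + br * q.[c] - bl * q.[a].

Definition wc_rel n (P : {poly R}) (bl br : R) (d : {poly R}) :=
  forall q : {poly R}, (size q <= n)%N ->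
  \int[mu]_(x in `]a, c[) (d.[x] * q.[x]) =
  - (\int[mu]_(x in `]a, c[) (P.[x] * (b1 x * q.[x] + b x * q^`().[x])))
    + br * (b c * q.[c]) - bl * (b a * q.[a]).

Let bh q : bdcont a c (horner q) := bdcont_horner a c q.

Let bpp (p q : {poly R}) : bdcont a c (fun x => p.[x] * q.[x]).
Proof. exact: bdcontM. Qed.

Let bgpp g (p q : {poly R}) : bdcont 0 1 g -> bdcont a c (fun x => g x * p.[x] * q.[x]).
Proof. by move=> /bd hg; apply: bdcontM => //; apply: bdcontM. Qed.

Context (e1 e2 : R) (n : nat) (S U dU dE cU : {poly R}) (ubl ubr ebl ebr : R).
Let E := S - U.
Context (n0 : (0 < n)%N) (sS : (size S <= n.+1)%N) (sU : (size U <= n.+1)%N).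
Context (sdE : (size dE <= n)%N) (Sa : S.[a] = ebl + ubl) (Sc : S.[c] = ebr + ubr).
Context (hdU : wd_rel n U ubl ubr dU) (hdE : wd_rel n E ebl ebr dE).
Context (hcU : wc_rel n.+1 U ubl ubr cU).

Definition strong_form x := - e1 * S^`()^`().[x] + e2 * b x * S^`().[x] + r x * S.[x].

(* [cU] is tested with [E], [dU] with [dE]; each occurrence of [U] is replaced by
   [S - E], and the boundary terms of [S] are collected in the last bracket, which
   telescopes over the elements once [S] is globally C^1. *)
Lemma element_identity :
  e1 * \int[mu]_(x in `]a, c[) (dU.[x] * dE.[x])
  + e2 * \int[mu]_(x in `]a, c[) (cU.[x] * E.[x])
  + \int[mu]_(x in `]a, c[) (r x * U.[x] * E.[x])
  - \int[mu]_(x in `]a, c[) (f x * E.[x])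
  - e2 * b c * (E.[c] - ebr) ^+ 2 =
  \int[mu]_(x in `]a, c[) ((strong_form x - f x) * E.[x])
  - e1 * \int[mu]_(x in `]a, c[) (dE.[x] * dE.[x])
  - \int[mu]_(x in `]a, c[) ((r x - e2 / 2 * b1 x) * (E.[x] * E.[x]))
  - 1 / 2 * (e2 * b c * (E.[c] - ebr) ^+ 2)
  - 1 / 2 * (e2 * b a * (E.[a] - ebl) ^+ 2)
  + ((e1 * ebr * S^`().[c] - 1 / 2 * e2 * b c * ebr ^+ 2)
     - (e1 * ebl * S^`().[a] - 1 / 2 * e2 * b a * ebl ^+ 2)).
Proof.
have sE : (size E <= n.+1)%N.
  by rewrite (leq_trans (size_polyD _ _)) // size_polyN geq_max sS.
have sS1 : (size S^`() <= n)%N.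
  by apply: (leq_trans (size_poly _ _)); case: (size S) sS.
have SE x : S.[x] = E.[x] + U.[x] by rewrite /E hornerD hornerN subrK.
(* The end values of [dE] cancel by [Sa] and [Sc]. Testing [hdE] with the derivative of [S], whose
   size is at most [n], produces the fluxes that must later telescope. *)
have E1 : \int[mu]_(x in `]a, c[) (dU.[x] * dE.[x]) =
   - (\int[mu]_(x in `]a, c[) (S^`()^`().[x] * E.[x])) + ebr * S^`().[c] - ebl * S^`().[a]
   - \int[mu]_(x in `]a, c[) (dE.[x] * dE.[x]).
  have i1 := FTC_poly (S * dE).
  rewrite !hornerM Sa Sc in i1.
  have i1' : \int[mu]_(x in `]a, c[) (S * dE)^`().[x] =
     1 * \int[mu]_(x in `]a, c[) (dE.[x] * S^`().[x]) + 1 * \int[mu]_(x in `]a, c[) (S.[x] * dE^`().[x]).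
    rewrite -Rint_lin //; apply: eq_Rint_oo => x _.
    by rewrite derivM !hornerE /= mulrC.
  have i2 : \int[mu]_(x in `]a, c[) (S.[x] * dE^`().[x]) =
     1 * \int[mu]_(x in `]a, c[) (E.[x] * dE^`().[x]) + 1 * \int[mu]_(x in `]a, c[) (U.[x] * dE^`().[x]).
    by rewrite -Rint_lin //; apply: eq_Rint_oo => x _; rewrite SE !mul1r mulrDl.
  have i3 : \int[mu]_(x in `]a, c[) (S^`()^`().[x] * E.[x]) =
     \int[mu]_(x in `]a, c[) (E.[x] * S^`()^`().[x]).
    by apply: eq_Rint_oo => x _; rewrite mulrC.
  have r1 := hdU sdE; have r2 := hdE sdE; have r3 := hdE sS1.
  rewrite i1' in i1; lra.
(* Integrating the derivative of [b * E ^+ 2] gives the term in [b1] that joins [r] in the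
   coercivity coefficient. *)
have E2 : \int[mu]_(x in `]a, c[) (cU.[x] * E.[x]) =
   \int[mu]_(x in `]a, c[) (b x * S^`().[x] * E.[x])
   + 1 / 2 * \int[mu]_(x in `]a, c[) (b1 x * E.[x] * E.[x])
   + 1 / 2 * (b c * E.[c] ^+ 2 - b a * E.[a] ^+ 2)
   - ebr * (b c * E.[c]) + ebl * (b a * E.[a]).
  have j1 := FTC_weighted (S * E); have j2 := FTC_weighted (E * E).
  rewrite !hornerM Sa Sc in j1; rewrite !hornerM in j2.
  have bdq (P : {poly R}) : bdcont a c (fun x => P.[x] * (b1 x * E.[x] + b x * E^`().[x])).
    by apply: bdcontM => //; apply: bdcontD; apply: bdcontM => //; exact: bd.
  have k1 : \int[mu]_(x in `]a, c[) (U.[x] * (b1 x * E.[x] + b x * E^`().[x])) =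
      1 * \int[mu]_(x in `]a, c[) (S.[x] * (b1 x * E.[x] + b x * E^`().[x]))
      + (-1) * \int[mu]_(x in `]a, c[) (E.[x] * (b1 x * E.[x] + b x * E^`().[x])).
    by rewrite -Rint_lin //; apply: eq_Rint_oo => x _; rewrite SE; ring.
  have k2 : \int[mu]_(x in `]a, c[) (b1 x * (S * E).[x] + b x * (S * E)^`().[x]) =
      1 * \int[mu]_(x in `]a, c[) (S.[x] * (b1 x * E.[x] + b x * E^`().[x]))
      + 1 * \int[mu]_(x in `]a, c[) (b x * S^`().[x] * E.[x]).
    rewrite -Rint_lin //; last exact: bgpp.
    by apply: eq_Rint_oo => x _; rewrite derivM !hornerE /=; ring.
  have k3 : \int[mu]_(x in `]a, c[) (b1 x * (E * E).[x] + b x * (E * E)^`().[x]) =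
      2 * \int[mu]_(x in `]a, c[) (E.[x] * (b1 x * E.[x] + b x * E^`().[x]))
      + (-1) * \int[mu]_(x in `]a, c[) (b1 x * E.[x] * E.[x]).
    rewrite -Rint_lin //; last exact: bgpp.
    by apply: eq_Rint_oo => x _; rewrite derivM !hornerE /=; ring.
  have r1 := hcU sE.
  rewrite k2 in j1; rewrite k3 in j2; rewrite k1 in r1; lra.
have E3 : \int[mu]_(x in `]a, c[) ((strong_form x - f x) * E.[x]) =
   1 * (- e1 * \int[mu]_(x in `]a, c[) (S^`()^`().[x] * E.[x])
   + e2 * \int[mu]_(x in `]a, c[) (b x * S^`().[x] * E.[x]))
   + 1 * (1 * \int[mu]_(x in `]a, c[) (r x * S.[x] * E.[x])
     + (-1) * \int[mu]_(x in `]a, c[) (f x * E.[x])).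
  have bS2 : bdcont a c (fun x => S^`()^`().[x] * E.[x]) by exact: bpp.
  have bS1 := bgpp S^`() E bb; have bS0 := bgpp S E br.
  have bfE : bdcont a c (fun x => f x * E.[x]) by apply: bdcontM => //; exact: bd.
  rewrite -!Rint_lin //; last 2 first.
    by apply: bdcontD; apply: bdcontM => //; exact: bdcont_cst.
    by apply: bdcontD; apply: bdcontM => //; exact: bdcont_cst.
  by apply: eq_Rint_oo => x _; rewrite /strong_form; ring.
have E4 : \int[mu]_(x in `]a, c[) (r x * U.[x] * E.[x]) =
   1 * \int[mu]_(x in `]a, c[) (r x * S.[x] * E.[x])
   + (-1) * \int[mu]_(x in `]a, c[) (r x * E.[x] * E.[x]).
  rewrite -Rint_lin; [|exact: bgpp|exact: bgpp].
  by apply: eq_Rint_oo => x _; rewrite SE; ring.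
have E5 : \int[mu]_(x in `]a, c[) ((r x - e2 / 2 * b1 x) * (E.[x] * E.[x])) =
   1 * \int[mu]_(x in `]a, c[) (r x * E.[x] * E.[x])
   + (- (e2 / 2)) * \int[mu]_(x in `]a, c[) (b1 x * E.[x] * E.[x]).
  rewrite -Rint_lin; [|exact: bgpp|exact: bgpp].
  by apply: eq_Rint_oo => x _; ring.
by rewrite E1 E2 E3 E4 E5; field.
Qed.

Lemma young (k t g rho : R) : 0 < g -> `|t| <= rho ->
  t * k <= rho ^+ 2 / (2 * g) + g / 2 * (k * k).
Proof.
move=> g0; rewrite ler_norml => /andP[t1 t2].
have h : t ^+ 2 / (2 * g) <= rho ^+ 2 / (2 * g).
  rewrite ler_wpM2r ?invr_ge0 ?mulr_ge0 ?(ltW g0) //; nra.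
have : 0 <= (t - g * k) ^+ 2 / (2 * g) by rewrite divr_ge0 ?sqr_ge0 // mulr_ge0 // ltW.
have -> : (t - g * k) ^+ 2 / (2 * g) = t ^+ 2 / (2 * g) - t * k + g / 2 * (k * k) by field; lra.
lra.
Qed.

Lemma element_defect_bound g rho : 0 < g -> 0 <= e2 -> 0 <= b a ->
  (forall x, a < x < c -> g <= r x - e2 / 2 * b1 x) ->
  (forall x, a < x < c -> `|strong_form x - f x| <= rho) ->
  e1 * \int[mu]_(x in `]a, c[) (dU.[x] * dE.[x])
  + e2 * \int[mu]_(x in `]a, c[) (cU.[x] * E.[x])
  + \int[mu]_(x in `]a, c[) (r x * U.[x] * E.[x])
  - \int[mu]_(x in `]a, c[) (f x * E.[x])
  - e2 * b c * (E.[c] - ebr) ^+ 2 <=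
  rho ^+ 2 / (2 * g) * (c - a)
  - e1 * \int[mu]_(x in `]a, c[) (dE.[x] * dE.[x])
  - g / 2 * \int[mu]_(x in `]a, c[) (E.[x] * E.[x])
  - 1 / 2 * (e2 * b c * (E.[c] - ebr) ^+ 2)
  + ((e1 * ebr * S^`().[c] - 1 / 2 * e2 * b c * ebr ^+ 2)
     - (e1 * ebl * S^`().[a] - 1 / 2 * e2 * b a * ebl ^+ 2)).
Proof.
move=> g0 e20 ba0 hr hrho; rewrite element_identity.
have bEE := bpp E E.
have h1 : \int[mu]_(x in `]a, c[) ((strong_form x - f x) * E.[x]) <=
   rho ^+ 2 / (2 * g) * (c - a) + g / 2 * \int[mu]_(x in `]a, c[) (E.[x] * E.[x]).
  rewrite -(Rint_oo_cst _ (ltW ac)) -bdcont_RintZ // -bdcont_RintD; last 2 first.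
  - exact: bdcont_cst.
  - by apply: bdcontM => //; exact: bdcont_cst.
  apply: le_Rint_oo.
  - apply: bdcontM => //; apply: bdcontB; last exact: bd.
    apply: bdcontD; last by apply: bdcontM => //; exact: bd.
    apply: bdcontD; apply: bdcontM => //; first exact: bdcont_cst.
    by apply: bdcontM; [exact: bdcont_cst | exact: bd].
  - by apply: bdcontD; [exact: bdcont_cst | apply: bdcontM => //; exact: bdcont_cst].
  - by move=> x xac; apply: young => //; exact: hrho.
have h2 : g * \int[mu]_(x in `]a, c[) (E.[x] * E.[x]) <=
    \int[mu]_(x in `]a, c[) ((r x - e2 / 2 * b1 x) * (E.[x] * E.[x])).
  rewrite -bdcont_RintZ //; apply: le_Rint_oo.
  - by apply: bdcontM => //; exact: bdcont_cst.
  - apply: bdcontM => //; apply: bdcontB; first exact: bd.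
    by apply: bdcontM; [exact: bdcont_cst | exact: bd].
  - by move=> x xac; rewrite ler_wpM2r ?hr // -expr2 sqr_ge0.
have h3 : 0 <= e2 * b a * (E.[a] - ebl) ^+ 2 by apply: mulr_ge0; [exact: mulr_ge0 | exact: sqr_ge0].
lra.
Qed.

End ElementIdentities.

Section ElementEnergy.
Context {R : realType}.
Notation mu := (@lebesgue_measure R).
Context (a c : R) (b b1 r f u u1 u2 : R -> R) (a0 : 0 <= a) (ac : a < c) (c1 : c <= 1).
Context (cb : {within `[0, 1], continuous b}).
Context (db : forall x : R, 0 < x < 1 -> is_derive x 1 b (b1 x)).
Context (bb1 : bdcont 0 1 b1) (br : bdcont 0 1 r).
Context (du : forall x : R, 0 < x < 1 -> is_derive x 1 u (u1 x)).
Context (du1 : forall x : R, 0 < x < 1 -> is_derive x 1 u1 (u2 x)).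
Context (bu : bdcont 0 1 u) (bu1 : bdcont 0 1 u1) (bu2 : bdcont 0 1 u2).
Context (e1 e2 g rho : R) (S : {poly R}) (Fl Fr Gl Gr : R).
Let h x := u x - S.[x].
Let h1 x := u1 x - S^`().[x].
Let h2 x := u2 x - S^`()^`().[x].

(** The end values are prescribed as one-sided limits of products, because [u1] alone need not
    converge at 0 and 1. *)
Lemma element_energy : 0 < g ->
  (forall x, a < x < c -> g <= r x - e2 / 2 * b1 x) ->
  (forall x, a < x < c -> - e1 * u2 x + e2 * b x * u1 x + r x * u x = f x) ->
  (forall x, a < x < c -> `|strong_form b r e1 e2 S x - f x| <= rho) ->
  h1 x * h x @[x --> a^'+] --> Fl -> h1 x * h x @[x --> c^'-] --> Fr ->
  b x * (h x * h x) @[x --> a^'+] --> Gl -> b x * (h x * h x) @[x --> c^'-] --> Gr ->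
  e1 * \int[mu]_(x in `]a, c[) (h1 x * h1 x)
  + g / 2 * \int[mu]_(x in `]a, c[) (h x * h x) <=
  rho ^+ 2 / (2 * g) * (c - a) + e1 * (Fr - Fl) - e2 / 2 * (Gr - Gl).
Proof.
move=> g0 hr Lu hrho hFl hFr hGl hGr.
have in01 x : a < x < c -> 0 < x < 1.
  by move=> /andP[ax xc]; rewrite (le_lt_trans a0) // (lt_le_trans xc).
have bd v : bdcont 0 1 v -> bdcont a c v by apply: bdcontW.
have bb : bdcont a c b by apply: bd; apply: bdcont_within.
have bh : bdcont a c h by apply: bdcontB; [exact: bd | exact: bdcont_horner].
have bh1 : bdcont a c h1 by apply: bdcontB; [exact: bd | exact: bdcont_horner].
have bh2 : bdcont a c h2 by apply: bdcontB; [exact: bd | exact: bdcont_horner].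
have dh x : a < x < c -> is_derive x 1 h (h1 x).
  by move=> /in01 x01; exact: (is_deriveB (du x01) (is_derive_horner S x)).
have dh1 x : a < x < c -> is_derive x 1 h1 (h2 x).
  by move=> /in01 x01; exact: (is_deriveB (du1 x01) (is_derive_horner S^`() x)).
have bhh := bdcontM bh bh; have b11 := bdcontM bh1 bh1; have b2h := bdcontM bh2 bh.
have b1h := bdcontM bh1 bh.
have iF : \int[mu]_(x in `]a, c[) (h2 x * h x + h1 x * h1 x) = Fr - Fl.
  apply: (FTC_open ac (F := fun x => h1 x * h x)) => //; last exact: bdcontD.
  move=> x xac; have := is_deriveM (dh1 x xac) (dh x xac).
  by rewrite addrC [h2 x * _]mulrC.
have iG : \int[mu]_(x in `]a, c[) (b1 x * (h x * h x) + 2 * (b x * (h1 x * h x))) = Gr - Gl.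
  apply: (FTC_open ac (F := fun x => b x * (h x * h x))) => //; last first.
    by apply: bdcontD; apply: bdcontM => //; [exact: bd | exact: bdcont_cst | exact: bdcontM].
  move=> x xac.
  have := is_deriveM (db (in01 _ xac)) (is_deriveM (dh x xac) (dh x xac)).
  have -> : b1 x * (h x * h x) + 2 * (b x * (h1 x * h x)) =
     b x *: (h x *: h1 x + h x *: h1 x) + (h * h) x *: b1 x.
    by rewrite /GRing.scale /= fctE; ring.
  by [].
pose W x := - e1 * h2 x * h x + e2 * b x * h1 x * h x + r x * (h x * h x).
have bW : bdcont a c W.
  apply: bdcontD; last by apply: bdcontM => //; exact: bd.
  apply: bdcontD; apply: bdcontM => //; apply: bdcontM => //; try exact: bdcont_cst.
  by apply: bdcontM => //; exact: bdcont_cst.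
have iW : \int[mu]_(x in `]a, c[) W x <=
   rho ^+ 2 / (2 * g) * (c - a) + g / 2 * \int[mu]_(x in `]a, c[) (h x * h x).
  rewrite -(Rint_oo_cst _ (ltW ac)) -bdcont_RintZ // -bdcont_RintD; last 2 first.
  - exact: bdcont_cst.
  - by apply: bdcontM => //; exact: bdcont_cst.
  apply: le_Rint_oo => //.
    by apply: bdcontD; [exact: bdcont_cst | apply: bdcontM => //; exact: bdcont_cst].
  move=> x xac; have -> : W x = (f x - strong_form b r e1 e2 S x) * h x.
    by rewrite -Lu // /W /h2 /h1 /strong_form /h; ring.
  by apply: young => //; rewrite distrC hrho.
have split_W : \int[mu]_(x in `]a, c[) W x =
   - e1 * (Fr - Fl) + e1 * \int[mu]_(x in `]a, c[) (h1 x * h1 x)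
   + e2 / 2 * (Gr - Gl)
   + \int[mu]_(x in `]a, c[) ((r x - e2 / 2 * b1 x) * (h x * h x)).
  have bF : bdcont a c (fun x => h2 x * h x + h1 x * h1 x) by exact: bdcontD.
  have bG : bdcont a c (fun x => b1 x * (h x * h x) + 2 * (b x * (h1 x * h x))).
    apply: bdcontD; apply: bdcontM => //; [exact: bd | exact: bdcont_cst | exact: bdcontM].
  have bRR : bdcont a c (fun x => (r x - e2 / 2 * b1 x) * (h x * h x)).
    apply: bdcontM => //; apply: bdcontB; first exact: bd.
    by apply: bdcontM; [exact: bdcont_cst | exact: bd].
  have -> : \int[mu]_(x in `]a, c[) W x =
     1 * (- e1 * \int[mu]_(x in `]a, c[) (h2 x * h x + h1 x * h1 x)
          + e1 * \int[mu]_(x in `]a, c[) (h1 x * h1 x))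
     + 1 * (e2 / 2 * \int[mu]_(x in `]a, c[) (b1 x * (h x * h x) + 2 * (b x * (h1 x * h x)))
          + 1 * \int[mu]_(x in `]a, c[) ((r x - e2 / 2 * b1 x) * (h x * h x))).
    rewrite -!Rint_lin //; [|exact: bdcont_lin|exact: bdcont_lin].
    by apply: eq_Rint_oo => x _; rewrite /W; field.
  by rewrite iF iG; ring.
have hc : g * \int[mu]_(x in `]a, c[) (h x * h x) <=
    \int[mu]_(x in `]a, c[) ((r x - e2 / 2 * b1 x) * (h x * h x)).
  rewrite -bdcont_RintZ //; apply: le_Rint_oo.
  - by apply: bdcontM => //; exact: bdcont_cst.
  - apply: bdcontM => //; apply: bdcontB; first exact: bd.
    by apply: bdcontM; [exact: bdcont_cst | exact: bd].
  - by move=> x xac; rewrite ler_wpM2r ?hr // -expr2 sqr_ge0.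
lra.
Qed.

End ElementEnergy.

(** * Piecewise polynomials and their weak derivatives *)

Section MeshFunctions.
Context {R : realType} (w : mesh R) (hw : is_mesh w).
Notation mu := (@lebesgue_measure R).
Notation N := (nel w).
Implicit Types (j : 'I_N) (P d : 'I_N -> {poly R}) (x : R).

Let X k := nth 0 (nodes w) k.

Lemma xlE j : xl j = X j.
Proof. by rewrite /xl (tnth_nth 0). Qed.

Lemma xrE j : xr j = X j.+1.
Proof. by rewrite /xr (tnth_nth 0) /ir lift0. Qed.

Lemma node_first : X 0%N = 0.
Proof. by have [<- _ _] := hw; rewrite (tnth_nth 0). Qed.

Lemma node_last : X N = 1.
Proof. by have [_ <- _] := hw; rewrite (tnth_nth 0). Qed.

Lemma node_lt k l : (k < l <= N)%N -> X k < X l.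
Proof.
move=> /andP[kl lN]; have [_ _ h] := hw.
by rewrite (lt_sorted_ltn_nth 0 h) // inE size_tuple ltnS // (leq_trans (ltnW kl)).
Qed.

Lemma node_le k l : (k <= l <= N)%N -> X k <= X l.
Proof.
move=> /andP[]; rewrite leq_eqVlt => /predU1P[-> //|kl] lN.
by apply/ltW/node_lt; rewrite kl.
Qed.

Lemma xl_lt_xr j : xl j < xr j.
Proof. by rewrite xlE xrE node_lt // ltnSn ltn_ord. Qed.

Lemma xl_ge0 j : 0 <= xl j.
Proof. by rewrite xlE -node_first node_le //= ltnW. Qed.

Lemma xr_le1 j : xr j <= 1.
Proof. by rewrite xrE -node_last node_le // ltn_ord /=. Qed.

Lemma eltP j x : elt j x <-> xl j < x < xr j.
Proof. by rewrite /elt /= in_itv. Qed.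

Lemma elt_disjoint j k x : xl j < x < xr j -> xl k < x < xr k -> j = k.
Proof.
move=> /andP[h1 h2] /andP[h3 h4]; apply/val_inj/eqP; rewrite eqn_leq.
apply/andP; split; rewrite leqNgt; apply/negP => lt.
  have : xr k <= xl j by rewrite xlE xrE node_le // lt ltnW.
  lra.
have : xr j <= xl k by rewrite xlE xrE node_le // lt ltnW.
lra.
Qed.

Lemma sum_telescope (T : 'I_N.+1 -> R) :
  \sum_(j < N) (T (ir j) - T (il j)) = T ord_max - T ord0.
Proof.
rewrite sumrB.
have h1 : \sum_(i < N.+1) T i = T ord0 + \sum_(j < N) T (ir j) by rewrite big_ord_recl.
have h2 : \sum_(i < N.+1) T i = \sum_(j < N) T (il j) + T ord_max by rewrite big_ord_recr.
by move: h1; rewrite h2; lra.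
Qed.

Lemma Rint_mesh (g : R -> R) (G : 'I_N -> R -> R) :
  (forall j, bdcont (xl j) (xr j) (G j)) ->
  (forall j x, xl j < x < xr j -> g x = G j x) ->
  measurable_fun (`]0, 1[ : set R) g /\
  \int[mu]_(x in `]0, 1[) g x = \sum_(j < N) \int[mu]_(x in `]xl j, xr j[) G j x.
Proof.
move=> bG gG.
have [k kN|k kN|mg Eg] := @Rint_pieces R X N g.
- by apply: node_lt; rewrite ltnSn.
- have := bG (Ordinal kN); rewrite xlE xrE; apply: bdcont_eq => x xk.
  by rewrite (gG (Ordinal kN)) // xlE xrE.
move: mg Eg; rewrite node_first node_last => mg Eg; split => //; rewrite Eg.
apply: eq_bigr => j _; rewrite xlE xrE; apply: eq_Rint_oo => x xj.
by rewrite (gG j) // xlE xrE.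
Qed.

Definition pw P (x : R) : R :=
  if [pick j | xl j < x < xr j] is Some j then (P j).[x] else 0.

Lemma pwE P j x : xl j < x < xr j -> pw P x = (P j).[x].
Proof.
move=> xj; rewrite /pw; case: pickP => [k xk|/(_ j)]; last by rewrite xj.
by rewrite (elt_disjoint xk xj).
Qed.

Lemma pw_L2 P : L2 `]0, 1[ (pw P).
Proof.
have [mg _] := @Rint_mesh (pw P) (fun j => horner (P j))
  (fun j => bdcont_horner _ _ (P j)) (fun j x => @pwE P j x).
have hM j : exists M, forall x, xl j < x < xr j -> `|(P j).[x]| <= M.
  by have [_ ] := bdcont_horner (xl j) (xr j) (P j).
have [M HM] := choice hM.
apply: (@L2_bounded _ 0 1 _ (\sum_j `|M j|)) => // x _.
rewrite /pw; case: pickP => [j xj|_]; last by rewrite normr0 sumr_ge0.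
rewrite (le_trans (HM j x xj)) // (bigD1 j) //= (le_trans (ler_norm _)) //.
by rewrite lerDl sumr_ge0.
Qed.

Lemma in_M_pw P (c : 'rV[R]_N.+1) : in_M ((pw P, c) : wgfun w).
Proof.
split; first exact: pw_L2.
by move=> j; apply: (H1_poly (p := P j)) => [|x xj]; [exact: xl_lt_xr | exact: pwE].
Qed.

Lemma in_V0_pw n P (c : 'rV[R]_N.+1) : (forall j, (size (P j) <= n.+1)%N) ->
  c 0 ord0 = 0 -> c 0 ord_max = 0 -> in_V0 n ((pw P, c) : wgfun w).
Proof.
move=> sP c0 c1; split => //; split; first exact: in_M_pw.
by move=> j; exists (P j) => // x /eltP; exact: pwE.
Qed.

Lemma piecewise_polyP n (g : R -> R) : piecewise_poly w n g ->
  exists2 P : 'I_N -> {poly R}, forall j, (size (P j) <= n.+1)%N &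
    forall j x, xl j < x < xr j -> g x = (P j).[x].
Proof.
move=> h.
have h' j : exists q : {poly R}, (size q <= n.+1)%N /\
    forall x, xl j < x < xr j -> g x = q.[x].
  by have [q sq gq] := h j; exists q; split => // x xj; apply: gq; exact/eltP.
have [P HP] := choice h'.
by exists P => [j|j x]; [exact: (HP j).1 | exact: (HP j).2].
Qed.

Lemma tracer_lim (v : wgfun w) j l :
  v.1 x @[x --> (xr j)^'-] --> l -> tracer v j = l.
Proof. by move=> h; apply: cvg_lim. Qed.

Lemma tracel_lim (v : wgfun w) j l :
  v.1 x @[x --> (xl j)^'+] --> l -> tracel v j = l.
Proof. by move=> h; apply: cvg_lim. Qed.

Lemma tracer_poly (v : wgfun w) P j :
  (forall x, xl j < x < xr j -> v.1 x = (P j).[x]) -> tracer v j = (P j).[xr j].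
Proof.
move=> vP; apply: tracer_lim; apply: (cvg_left_eq (xl_lt_xr j) vP).
exact: horner_cvg_left.
Qed.

Lemma tracel_poly (v : wgfun w) P j :
  (forall x, xl j < x < xr j -> v.1 x = (P j).[x]) -> tracel v j = (P j).[xl j].
Proof.
move=> vP; apply: tracel_lim; apply: (cvg_right_eq (xl_lt_xr j) vP).
exact: horner_cvg_right.
Qed.

Lemma weak_derivP n (v : wgfun w) dv : is_weak_deriv n v dv ->
  exists d : 'I_N -> {poly R}, [/\ forall j, (size (d j) <= n.+1)%N,
    forall j x, xl j < x < xr j -> dv x = (d j).[x] &
    forall j (q : {poly R}), (size q <= n.+1)%N ->
      \int[mu]_(x in `]xl j, xr j[) ((d j).[x] * q.[x]) =
      - (\int[mu]_(x in `]xl j, xr j[) (v.1 x * q^`().[x]))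
      + br v j * q.[xr j] - bl v j * q.[xl j]].
Proof.
move=> [[_ /piecewise_polyP [d sd dE]] hd]; exists d; split => // j q sq.
by rewrite -hd //; apply: eq_Rint_oo => x xj; rewrite (dE j).
Qed.

(** [wderiv] is chosen by [xget], so it obeys its defining relation only once some weak derivative
    is exhibited; [poly_riesz] provides one on each element. *)
Lemma wderiv_poly n (v : wgfun w) P :
  (forall j x, xl j < x < xr j -> v.1 x = (P j).[x]) ->
  exists d : 'I_N -> {poly R}, [/\ forall j, (size (d j) <= n.+1)%N,
    forall j x, xl j < x < xr j -> wderiv n v x = (d j).[x] &
    forall j, wd_rel (xl j) (xr j) n.+1 (P j) (bl v j) (br v j) (d j)].
Proof.
move=> vP.
pose L j (q : {poly R}) := - (\int[mu]_(x in `]xl j, xr j[) ((P j).[x] * q^`().[x]))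
   + br v j * q.[xr j] - bl v j * q.[xl j].
have Llin j (k : R) (q1 q2 : {poly R}) : L j (k *: q1 + q2) = k * L j q1 + L j q2.
  have E : \int[mu]_(x in `]xl j, xr j[) ((P j).[x] * (k *: q1 + q2)^`().[x]) =
    k * \int[mu]_(x in `]xl j, xr j[) ((P j).[x] * q1^`().[x])
    + 1 * \int[mu]_(x in `]xl j, xr j[) ((P j).[x] * q2^`().[x]).
    rewrite -Rint_lin; try (by apply: bdcontM; exact: bdcont_horner).
    by apply: eq_Rint_oo => x _; rewrite derivD derivZ hornerD hornerZ; ring.
  by rewrite /L E !hornerD !hornerZ; ring.
have ex j : exists d : {poly R}, (size d <= n.+1)%N /\
    wd_rel (xl j) (xr j) n.+1 (P j) (bl v j) (br v j) d.
  have [d sd hd] := poly_riesz n.+1 (xl_lt_xr j) (Llin j).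
  by exists d; split.
have [d Hd] := choice ex.
have wd : is_weak_deriv n v (pw d).
  split.
    split; first exact: pw_L2.
    by move=> j; exists (d j); [exact: (Hd j).1 | move=> x /eltP; exact: pwE].
  move=> q j sq; have := (Hd j).2 q sq.
  rewrite (eq_Rint_oo (f := fun x => (P j).[x] * _) (g := fun x => v.1 x * q^`().[x])); last first.
    by move=> x xj; rewrite (vP j).
  by move=> <-; apply: eq_Rint_oo => x xj; rewrite (pwE _ xj).
have /weak_derivP [d' [sd' d'E hd']] : is_weak_deriv n v (wderiv n v).
  exact: (@xgetPex _ (fun=> 0) [set d0 | is_weak_deriv n v d0] (ex_intro _ _ wd)).
exists d'; split => // j q sq; rewrite hd' //; congr (- _ + _ - _).
by apply: eq_Rint_oo => x xj; rewrite (vP j).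
Qed.

Section Convection.
Context (b b1 : R -> R) (cb : {within `[0, 1], continuous b}).
Context (db : forall x : R, 0 < x < 1 -> is_derive x 1 b (b1 x)).
Context (bb1 : bdcont 0 1 b1).

Lemma wconv_poly n (v : wgfun w) P :
  (forall j x, xl j < x < xr j -> v.1 x = (P j).[x]) ->
  exists d : 'I_N -> {poly R}, [/\ forall j, (size (d j) <= n.+1)%N,
    forall j x, xl j < x < xr j -> wconv b n v x = (d j).[x] &
    forall j, wc_rel (xl j) (xr j) b b1 n.+1 (P j) (bl v j) (br v j) (d j)].
Proof.
move=> vP.
have bd g j : bdcont 0 1 g -> bdcont (xl j) (xr j) g.
  by apply: bdcontW; [exact: xl_ge0 | exact: xr_le1].
have bb j : bdcont (xl j) (xr j) b by apply: bd; exact: bdcont_within.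
pose L j (q : {poly R}) :=
   - (\int[mu]_(x in `]xl j, xr j[) ((P j).[x] * (b1 x * q.[x] + b x * q^`().[x])))
   + br v j * (b (xr j) * q.[xr j]) - bl v j * (b (xl j) * q.[xl j]).
have bq j (q : {poly R}) : bdcont (xl j) (xr j) (fun x => (P j).[x] * (b1 x * q.[x] + b x * q^`().[x])).
  apply: bdcontM; first exact: bdcont_horner.
  by apply: bdcontD; apply: bdcontM => //; [exact: bd | exact: bdcont_horner | exact: bdcont_horner].
have Llin j (k : R) (q1 q2 : {poly R}) : L j (k *: q1 + q2) = k * L j q1 + L j q2.
  have E : \int[mu]_(x in `]xl j, xr j[) ((P j).[x] * (b1 x * (k *: q1 + q2).[x] + b x * (k *: q1 + q2)^`().[x])) =
    k * \int[mu]_(x in `]xl j, xr j[) ((P j).[x] * (b1 x * q1.[x] + b x * q1^`().[x]))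
    + 1 * \int[mu]_(x in `]xl j, xr j[) ((P j).[x] * (b1 x * q2.[x] + b x * q2^`().[x])).
    rewrite -Rint_lin //.
    by apply: eq_Rint_oo => x _; rewrite derivD derivZ !hornerD !hornerZ; ring.
  by rewrite /L E !hornerD !hornerZ; ring.
have ex j : exists d : {poly R}, (size d <= n.+1)%N /\
    wc_rel (xl j) (xr j) b b1 n.+1 (P j) (bl v j) (br v j) d.
  have [d sd hd] := poly_riesz n.+1 (xl_lt_xr j) (Llin j).
  by exists d; split.
have [d Hd] := choice ex.
have conv_int j (q : {poly R}) :
    \int[mu]_(x in `]xl j, xr j[) (v.1 x * derive1 (fun x => b x * q.[x]) x) =
    \int[mu]_(x in `]xl j, xr j[) ((P j).[x] * (b1 x * q.[x] + b x * q^`().[x])).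
  apply: eq_Rint_oo => x xj.
  by rewrite (vP j) // (derive1_weighted (xl_ge0 j) (xr_le1 j) db q xj).
have wd : is_weak_conv_deriv b n v (pw d).
  split.
    split; first exact: pw_L2.
    by move=> j; exists (d j); [exact: (Hd j).1 | move=> x /eltP; exact: pwE].
  move=> q j sq bq'; have := (Hd j).2 q sq; rewrite -conv_int => <-.
  by apply: eq_Rint_oo => x xj; rewrite (pwE _ xj).
have [[_ /piecewise_polyP [d' sd' d'E]] hd'] : is_weak_conv_deriv b n v (wconv b n v).
  exact: (@xgetPex _ (fun=> 0) [set d0 | is_weak_conv_deriv b n v d0] (ex_intro _ _ wd)).
exists d'; split => // j q sq.
rewrite -conv_int -hd' //; apply: eq_Rint_oo => x xj.
by rewrite (d'E j).
Qed.

End Convection.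

End MeshFunctions.

(** Meant for the end points 0 and 1, where the slope of the solution is only known to be bounded
    while the solution minus its interpolant tends to 0. *)
Lemma cvg_bounded_mul0 {R : realType} (F : set_system R) {FF : Filter F} (g h : R -> R) (M : R) :
  (\forall x \near F, `|g x| <= M) -> h x @[x --> F] --> 0 -> g x * h x @[x --> F] --> 0.
Proof.
move=> gM h0.
have hn : `|M| * `|h x| @[x --> F] --> 0.
  by rewrite -(mulr0 `|M|) -(@normr0 _ R); apply: cvgMr; apply: cvg_norm.
have hn' : - (`|M| * `|h x|) @[x --> F] --> 0 by rewrite -oppr0; exact: cvgN.
apply: (squeeze_cvgr _ hn' hn); apply: filterS gM => x gx.
by rewrite -ler_norml normrM ler_wpM2r // (le_trans gx) // ler_norm.
Qed.

(** * Error bound from a C^1 piecewise polynomial *)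

Section GalerkinError.
Context {R : realType} (w : mesh R) (hw : is_mesh w).
Notation mu := (@lebesgue_measure R).
Notation N := (nel w).
Context (b b1 r f : R -> R) (cb : {within `[0, 1], continuous b}).
Context (db : forall x : R, 0 < x < 1 -> is_derive x 1 b (b1 x)).
Context (bb1 : bdcont 0 1 b1) (br_ : bdcont 0 1 r) (bf : bdcont 0 1 f).
Context (bpos : forall x : R, 0 <= x <= 1 -> 0 < b x).
Context (p : nat) (e1 e2 gam rho : R) (p0 : (0 < p)%N).
Context (e10 : 0 < e1) (e20 : 0 < e2) (gam0 : 0 < gam).
Context (hr : forall x : R, 0 < x < 1 -> gam <= r x - e2 / 2 * b1 x).
Context (S : 'I_N -> {poly R}) (vb ds : 'rV[R]_N.+1).
Context (sS : forall j, (size (S j) <= p.+1)%N).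
Context (Sl : forall j, (S j).[xl j] = vb 0 (il j)).
Context (Sr : forall j, (S j).[xr j] = vb 0 (ir j)).
Context (Sl1 : forall j, (S j)^`().[xl j] = ds 0 (il j)).
Context (Sr1 : forall j, (S j)^`().[xr j] = ds 0 (ir j)).
Context (vb0 : vb 0 ord0 = 0) (vb1 : vb 0 ord_max = 0).
Context (hrho : forall j x, xl j < x < xr j ->
  `|strong_form b r e1 e2 (S j) x - f x| <= rho).
Context (u_p : wgfun w) (hup : wg_solution e1 e2 b r p f u_p).

Let eb := vb - u_p.2.

Lemma elt_in01 (j : 'I_N) (x : R) : xl j < x < xr j -> 0 < x < 1.
Proof. by move=> /andP[h1 h2]; have := xl_ge0 hw j; have := xr_le1 hw j; lra. Qed.

Lemma bdcont_elt (g : R -> R) (j : 'I_N) : bdcont 0 1 g -> bdcont (xl j) (xr j) g.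
Proof. by apply: bdcontW; [exact: xl_ge0 | exact: xr_le1]. Qed.

Definition jumpr (E : 'I_N -> {poly R}) j := (E j).[xr j] - eb 0 (ir j).
Definition jumpl (E : 'I_N -> {poly R}) j := (E j).[xl j] - eb 0 (il j).

Lemma meshsize_gt0 j : 0 < meshsize (w := w) j.
Proof. by rewrite /meshsize subr_gt0; exact: xl_lt_xr. Qed.

Lemma sum_meshsize : \sum_(j < N) (xr j - xl j) = 1.
Proof.
have := @sum_telescope R w (fun i => tnth (nodes w) i).
rewrite /xl /xr => ->; have [-> -> _] := hw; exact: subr0.
Qed.

(** The scheme is tested with [(E, eb)], interpolant minus [u_p]. The interpolant agrees with its
    nodal values, so the jumps of [u_p] are opposite to [jumpr E] and [jumpl E], and the
    stabilisation terms become squares. *)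
Lemma galerkin_defect : exists U dE : 'I_N -> {poly R},
  let E := fun j => S j - U j in
  [/\ forall j x, xl j < x < xr j -> u_p.1 x = (U j).[x],
      forall j, wd_rel (xl j) (xr j) p (E j) (eb 0 (il j)) (eb 0 (ir j)) (dE j) &
      e1 * \sum_(j < N) \int[mu]_(x in `]xl j, xr j[) ((dE j).[x] * (dE j).[x])
      + gam / 2 * \sum_(j < N) \int[mu]_(x in `]xl j, xr j[) ((E j).[x] * (E j).[x])
      + \sum_(j < N) penalty e1 p j * (jumpr E j ^+ 2 + jumpl E j ^+ 2)
      + 1 / 2 * \sum_(j < N) (e2 * b (xr j) * jumpr E j ^+ 2)
      <= rho ^+ 2 / (2 * gam)].
Proof.
have [[[_ pU] up0 up1] hsol] := hup.
have [U sU uU] := piecewise_polyP pU.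
pose E j := S j - U j.
have sE j : (size (E j) <= p.+1)%N.
  by rewrite (leq_trans (size_polyD _ _)) // size_polyN geq_max sS sU.
pose v : wgfun w := (pw (w := w) E, eb).
have vE j x : xl j < x < xr j -> v.1 x = (E j).[x] by exact: pwE.
have vV : in_V0 p v.
  by apply: in_V0_pw => //; rewrite /eb !mxE ?vb0 ?up0 ?vb1 ?up1 subr0.
have [dU [sdU dUE hdU]] := wderiv_poly hw p.-1 uU.
have [dE [sdE dEE hdE]] := wderiv_poly hw p.-1 vE.
have [cU [scU cUE hcU]] := wconv_poly hw cb db bb1 p uU.
rewrite prednK // in sdU hdU sdE hdE.
exists U, dE => /=; split => //.
have bh (j : 'I_N) (q : {poly R}) : bdcont (xl j) (xr j) (horner q) by exact: bdcont_horner.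
have Eq := hsol v vV; move: Eq; rewrite /bilin /inner.
rewrite (Rint_mesh hw (g := fun x => wderiv p.-1 u_p x * wderiv p.-1 v x)
  (G := fun j x => (dU j).[x] * (dE j).[x]) _ _).2; first last.
  by move=> j x xj; rewrite (dUE _ _ xj) (dEE _ _ xj).
  by move=> j; exact: bdcontM.
rewrite (Rint_mesh hw (g := fun x => wconv b p u_p x * v.1 x)
  (G := fun j x => (cU j).[x] * (E j).[x]) _ _).2; first last.
  by move=> j x xj; rewrite (cUE _ _ xj) (vE _ _ xj).
  by move=> j; exact: bdcontM.
rewrite (Rint_mesh hw (g := fun x => r x * u_p.1 x * v.1 x)
  (G := fun j x => r x * (U j).[x] * (E j).[x]) _ _).2; first last.
  by move=> j x xj; rewrite (uU _ _ xj) (vE _ _ xj).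
  by move=> j; apply: bdcontM => //; apply: bdcontM => //; exact: bdcont_elt.
rewrite (Rint_mesh hw (g := fun x => f x * v.1 x) (G := fun j x => f x * (E j).[x]) _ _).2; first last.
  by move=> j x xj; rewrite (vE _ _ xj).
  by move=> j; apply: bdcontM => //; exact: bdcont_elt.
have JrU j : tracer u_p j - br u_p j = - jumpr E j.
  rewrite (tracer_poly hw (uU j)) /jumpr /E /eb hornerD hornerN Sr !mxE /br; ring.
have JlU j : tracel u_p j - bl u_p j = - jumpl E j.
  rewrite (tracel_poly hw (uU j)) /jumpl /E /eb hornerD hornerN Sl !mxE /bl; ring.
have JrE j : tracer v j - br v j = jumpr E j by rewrite (tracer_poly hw (vE j)).
have JlE j : tracel v j - bl v j = jumpl E j by rewrite (tracel_poly hw (vE j)).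
rewrite /stab /stabc.
under [X in _ + X + _]eq_bigr => j _ do rewrite JrU JlU JrE JlE.
under [X in _ + X = _]eq_bigr => j _ do rewrite JrU JrE.
move=> Eq.
have key j :
  e1 * \int[mu]_(x in `]xl j, xr j[) ((dU j).[x] * (dE j).[x])
  + e2 * \int[mu]_(x in `]xl j, xr j[) ((cU j).[x] * (E j).[x])
  + \int[mu]_(x in `]xl j, xr j[) (r x * (U j).[x] * (E j).[x])
  - \int[mu]_(x in `]xl j, xr j[) (f x * (E j).[x])
  - e2 * b (xr j) * jumpr E j ^+ 2 <=
  rho ^+ 2 / (2 * gam) * (xr j - xl j)
  - e1 * \int[mu]_(x in `]xl j, xr j[) ((dE j).[x] * (dE j).[x])
  - gam / 2 * \int[mu]_(x in `]xl j, xr j[) ((E j).[x] * (E j).[x])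
  - 1 / 2 * (e2 * b (xr j) * jumpr E j ^+ 2)
  + ((e1 * eb 0 (ir j) * ds 0 (ir j) - 1 / 2 * e2 * b (xr j) * eb 0 (ir j) ^+ 2)
     - (e1 * eb 0 (il j) * ds 0 (il j) - 1 / 2 * e2 * b (xl j) * eb 0 (il j) ^+ 2)).
  rewrite -Sl1 -Sr1.
  apply: (element_defect_bound (xl_ge0 hw j) (xl_lt_xr hw j) (xr_le1 hw j) cb db bb1 br_ bf
     (n := p) (S := S j) (U := U j) (dU := dU j) (dE := dE j) (cU := cU j)
     (ubl := u_p.2 0 (il j)) (ubr := u_p.2 0 (ir j)) (ebl := eb 0 (il j)) (ebr := eb 0 (ir j))) => //.
  - by rewrite Sl /eb !mxE subrK.
  - by rewrite Sr /eb !mxE subrK.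
  - exact: ltW.
  - apply/ltW/bpos; rewrite xl_ge0 //=; apply: ltW; apply: lt_le_trans (xl_lt_xr hw j) (xr_le1 hw j).
  - by move=> x /elt_in01; exact: hr.
  - by move=> x; exact: hrho.
have := @ler_sum _ _ (index_enum 'I_N) xpredT _ _ (fun j _ => key j).
(* Telescoping is possible because the slope [ds] belongs to the node and not to the element; the
   two remaining end terms vanish with [eb]. *)
have T0 := @sum_telescope R w (fun i => e1 * eb 0 i * ds 0 i - 1 / 2 * e2 * b (tnth (nodes w) i) * eb 0 i ^+ 2).
have eb0 : eb 0 ord0 = 0 by rewrite /eb !mxE vb0 up0 subr0.
have ebm : eb 0 ord_max = 0 by rewrite /eb !mxE vb1 up1 subr0.
rewrite eb0 ebm expr0n /= !mulr0 !mul0r !subr0 in T0.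
rewrite [X in _ <= X -> _]big_split /= T0 addr0.
rewrite !(sumrB, big_split) /= -!mulr_sumr sum_meshsize mulr1.
have S1 : \sum_(i < N) penalty e1 p i * (- jumpr E i * jumpr E i + - jumpl E i * jumpl E i) =
   - \sum_(i < N) penalty e1 p i * (jumpr E i ^+ 2 + jumpl E i ^+ 2).
  by rewrite -sumrN; apply: eq_bigr => j _; ring.
have S2 : \sum_(i < N) e2 * b (xr i) * - jumpr E i * jumpr E i =
   - \sum_(i < N) e2 * b (xr i) * jumpr E i ^+ 2.
  by rewrite -sumrN; apply: eq_bigr => j _; ring.
move: Eq; rewrite S1 S2; lra.
Qed.

Context (u u1 u2 : R -> R) (cu : {within `[0, 1], continuous u}) (u0 : u 0 = 0) (u_1 : u 1 = 0).
Context (du : forall x : R, 0 < x < 1 -> is_derive x 1 u (u1 x)).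
Context (du1 : forall x : R, 0 < x < 1 -> is_derive x 1 u1 (u2 x)).
Context (bu1 : bdcont 0 1 u1) (bu2 : bdcont 0 1 u2).
Context (Lu : forall x, 0 < x < 1 -> - e1 * u2 x + e2 * b x * u1 x + r x * u x = f x).

Let bu : bdcont 0 1 u.
Proof. exact: bdcont_within. Qed.

Lemma xl_lt1 (j : 'I_N) : xl j < 1.
Proof. exact: lt_le_trans (xl_lt_xr hw j) (xr_le1 hw j). Qed.

Lemma xr_gt0 (j : 'I_N) : 0 < xr j.
Proof. exact: le_lt_trans (xl_ge0 hw j) (xl_lt_xr hw j). Qed.

Lemma xl_eq0 (j : 'I_N) : xl j = 0 -> il j = ord0.
Proof.
rewrite xlE; case: (posnP j) => [j0 _|j0]; first exact/val_inj.
have := @node_lt _ _ hw 0 j; rewrite j0 /= (ltnW (ltn_ord j)) => /(_ isT).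
by rewrite node_first // => lt0 e0; rewrite e0 ltxx in lt0.
Qed.

Lemma xr_eq1 (j : 'I_N) : xr j = 1 -> ir j = ord_max.
Proof.
rewrite xrE => e; apply: val_inj; rewrite /= /bump leq0n add1n.
have := ltn_ord j; rewrite leq_eqVlt => /predU1P[//|jN].
have := @node_lt _ _ hw j.+1 N; rewrite jN leqnn => /(_ isT).
by rewrite node_last // e ltxx.
Qed.

(** Nodal limits of [h1 * h]. At 0 and 1 the limit is 0, because [u1] stays bounded and [h] tends to
    0. *)
Let Fn i := if 0 < tnth (nodes w) i < 1
  then (u1 (tnth (nodes w) i) - ds 0 i) * (u (tnth (nodes w) i) - vb 0 i) else 0.
Let Gn i := b (tnth (nodes w) i) * ((u (tnth (nodes w) i) - vb 0 i) * (u (tnth (nodes w) i) - vb 0 i)).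
Let h j x := u x - (S j).[x].
Let h1 j x := u1 x - (S j)^`().[x].

Let cvg_hl j : h j x @[x --> (xl j)^'+] --> u (xl j) - vb 0 (il j).
Proof.
rewrite -Sl; apply: cvgB; last exact: horner_cvg_right.
by apply: within_cvg_right => //; rewrite xl_ge0 // xl_lt1.
Qed.

Let cvg_hr j : h j x @[x --> (xr j)^'-] --> u (xr j) - vb 0 (ir j).
Proof.
rewrite -Sr; apply: cvgB; last exact: horner_cvg_left.
by apply: within_cvg_left => //; rewrite xr_gt0 xr_le1.
Qed.

Let bh1 j : bdcont (xl j) (xr j) (h1 j).
Proof. by apply: bdcontB; [exact: bdcont_elt | exact: bdcont_horner]. Qed.

Let cvg_Fl j : h1 j x * h j x @[x --> (xl j)^'+] --> Fn (il j).
Proof.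
rewrite /Fn; case: ifP => [x01|].
  apply: cvgM; last exact: cvg_hl.
  rewrite -Sl1; apply: cvgB; last exact: horner_cvg_right.
  by apply: cvg_at_right_filter; exact: is_derive_cvg (du1 x01).
rewrite -/(xl j) xl_lt1 andbT lt_neqAle (xl_ge0 hw) andbT => /negbFE /eqP e0.
have [_ [M hM]] := bh1 j.
apply: (@cvg_bounded_mul0 _ _ _ _ _ M).
  near=> x; apply: hM; apply/andP; split; near: x; first exact: nbhs_right_gt.
  exact/nbhs_right_lt/xl_lt_xr.
by have := @cvg_hl j; rewrite -e0 u0 (xl_eq0 (esym e0)) vb0 subrr.
Unshelve. all: by end_near. Qed.

Let cvg_Fr j : h1 j x * h j x @[x --> (xr j)^'-] --> Fn (ir j).
Proof.
rewrite /Fn; case: ifP => [x01|].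
  apply: cvgM; last exact: cvg_hr.
  rewrite -Sr1; apply: cvgB; last exact: horner_cvg_left.
  by apply: cvg_at_left_filter; exact: is_derive_cvg (du1 x01).
rewrite -/(xr j) xr_gt0 lt_neqAle (xr_le1 hw) andbT => /negbFE /eqP e0.
have [_ [M hM]] := bh1 j.
apply: (@cvg_bounded_mul0 _ _ _ _ _ M).
  near=> x; apply: hM; apply/andP; split; near: x; last exact: nbhs_left_lt.
  exact/nbhs_left_gt/xl_lt_xr.
by have := @cvg_hr j; rewrite e0 u_1 (xr_eq1 e0) vb1 subrr.
Unshelve. all: by end_near. Qed.

Lemma energy_error :
  e1 * \sum_(j < N) \int[mu]_(x in `]xl j, xr j[) (h1 j x * h1 j x)
  + gam / 2 * \sum_(j < N) \int[mu]_(x in `]xl j, xr j[) (h j x * h j x)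
  <= rho ^+ 2 / (2 * gam).
Proof.
have key j : e1 * \int[mu]_(x in `]xl j, xr j[) (h1 j x * h1 j x)
  + gam / 2 * \int[mu]_(x in `]xl j, xr j[) (h j x * h j x) <=
  rho ^+ 2 / (2 * gam) * (xr j - xl j)
  + ((e1 * Fn (ir j) - e2 / 2 * Gn (ir j)) - (e1 * Fn (il j) - e2 / 2 * Gn (il j))).
  have hx x := @elt_in01 j x.
  have := @element_energy R (xl j) (xr j) b b1 r f u u1 u2 (xl_ge0 hw j) (xl_lt_xr hw j) (xr_le1 hw j)
    cb db bb1 br_ du du1 bu bu1 bu2 e1 e2 gam rho (S j) (Fn (il j)) (Fn (ir j)) (Gn (il j)) (Gn (ir j)) gam0
    (fun x xj => hr (hx x xj)) (fun x xj => Lu (hx x xj)) (fun x xj => hrho xj)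
    (@cvg_Fl j) (@cvg_Fr j).
  rewrite -/(h j) -/(h1 j) => H; apply: le_trans (H _ _) _; last by lra.
    apply: cvgM; first by apply: within_cvg_right => //; rewrite xl_ge0 // xl_lt1.
    by apply: cvgM; exact: cvg_hl.
  apply: cvgM; first by apply: within_cvg_left => //; rewrite xr_gt0 xr_le1.
  by apply: cvgM; exact: cvg_hr.
have := @ler_sum _ _ (index_enum 'I_N) xpredT _ _ (fun j _ => key j).
have T0 := @sum_telescope R w (fun i => e1 * Fn i - e2 / 2 * Gn i).
have [n0 n1 _] := hw.
have F0 : Fn ord0 = 0 by rewrite /Fn n0 ltxx.
have F1 : Fn ord_max = 0 by rewrite /Fn n1 ltxx andbF.
have G0 : Gn ord0 = 0 by rewrite /Gn n0 u0 vb0 subrr !mulr0.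
have G1 : Gn ord_max = 0 by rewrite /Gn n1 u_1 vb1 subrr !mulr0.
rewrite F0 F1 G0 G1 !mulr0 subrr in T0.
rewrite [X in _ <= X -> _]big_split /= T0 addr0.
by rewrite !big_split /= -!mulr_sumr sum_meshsize mulr1.
Qed.

(* [u] minus a polynomial always has a weak derivative, but there is no need to
   prove it: otherwise [wderiv] takes the default value 0 of [xget]. *)
Lemma wderiv_error (U dE : 'I_N -> {poly R}) (v : wgfun w := of_H1 w u - u_p) :
  (forall j x, xl j < x < xr j -> u_p.1 x = (U j).[x]) ->
  (forall j, wd_rel (xl j) (xr j) p (S j - U j) (eb 0 (il j)) (eb 0 (ir j)) (dE j)) ->
  inner `]0, 1[ (wderiv p.-1 v) (wderiv p.-1 v) <=
  2 * \sum_(j < N) \int[mu]_(x in `]xl j, xr j[) (h1 j x * h1 j x)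
  + 2 * \sum_(j < N) \int[mu]_(x in `]xl j, xr j[) ((dE j).[x] * (dE j).[x]).
Proof.
move=> uU hdE.
have v1 x : v.1 x = u x - u_p.1 x by [].
have bp (j : 'I_N) (q : {poly R}) : bdcont (xl j) (xr j) (horner q) by exact: bdcont_horner.
have bh j : bdcont (xl j) (xr j) (h j).
  by apply: bdcontB; [exact: bdcont_elt | exact: bp].
have sq0 (j : 'I_N) (g : R -> R) : bdcont (xl j) (xr j) g -> 0 <= \int[mu]_(x in `]xl j, xr j[) (g x * g x).
  by move=> _; apply: Rintegral_ge0 => x _; rewrite -expr2 sqr_ge0.
have [[d wd]|no] := pselect (exists d, is_weak_deriv p.-1 v d); last first.
  have -> : wderiv p.-1 v = fun=> 0.
    by apply: xgetPN => d hd; apply: no; exists d.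
  rewrite /inner (eq_Rint_oo (g := fun=> 0)) => [|x _]; last by rewrite mulr0.
  rewrite Rint_oo_cst // mul0r addr_ge0 // mulr_ge0 // sumr_ge0 // => j _; exact: sq0.
have /weak_derivP [D [sD DE hD]] : is_weak_deriv p.-1 v (wderiv p.-1 v).
  exact: (@xgetPex _ (fun=> 0) [set d0 | is_weak_deriv p.-1 v d0] (ex_intro _ _ wd)).
rewrite prednK // in sD hD.
rewrite /inner (Rint_mesh hw (g := fun x => wderiv p.-1 v x * wderiv p.-1 v x)
  (G := fun j x => (D j).[x] * (D j).[x]) _ _).2; first last.
  by move=> j x xj; rewrite (DE _ _ xj).
  by move=> j; exact: bdcontM.
rewrite !mulr_sumr -big_split /=; apply: ler_sum => j _.
(* Tested with itself, [D] has squared norm equal to the integral of [h1 * D] plus that of [dE * D],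
   as the nodal terms of [h] cancel by integration by parts. Young's inequality puts a quarter of
   the squared norm into each product. *)
have i1 := hD j (D j) (sD j).
have i2 := hdE j (D j) (sD j).
have i3 : \int[mu]_(x in `]xl j, xr j[) (h1 j x * (D j).[x] + h j x * (D j)^`().[x]) =
    (u (xr j) - vb 0 (ir j)) * (D j).[xr j] - (u (xl j) - vb 0 (il j)) * (D j).[xl j].
  apply: (FTC_open (xl_lt_xr hw j) (F := fun x => h j x * (D j).[x])).
  - move=> x /elt_in01 x01.
    have H := is_deriveM (is_deriveB (du x01) (is_derive_horner (S j) x)) (is_derive_horner (D j) x).
    have -> : h1 j x * (D j).[x] + h j x * (D j)^`().[x] =
       h j x *: (D j)^`().[x] + (D j).[x] *: h1 j x by rewrite addrC [h1 j x * _]mulrC.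
    exact: H.
  - by apply: bdcontD; apply: bdcontM.
  - by apply: cvgM; [exact: cvg_hl | exact: horner_cvg_right].
  - by apply: cvgM; [exact: cvg_hr | exact: horner_cvg_left].
rewrite bdcont_RintD in i3; [|exact: bdcontM|exact: bdcontM].
have i4 : \int[mu]_(x in `]xl j, xr j[) (v.1 x * (D j)^`().[x]) =
    \int[mu]_(x in `]xl j, xr j[) (h j x * (D j)^`().[x])
    + \int[mu]_(x in `]xl j, xr j[) ((S j - U j).[x] * (D j)^`().[x]).
  rewrite -bdcont_RintD; [|exact: bdcontM|exact: bdcontM].
  apply: eq_Rint_oo => x xj.
  by rewrite -mulrDl v1 (uU _ _ xj) hornerD hornerN /h; congr (_ * _); ring.
have vl : bl v j = u (xl j) - vb 0 (il j) + eb 0 (il j) by rewrite /bl /v /eb !mxE; ring.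
have vr : br v j = u (xr j) - vb 0 (ir j) + eb 0 (ir j) by rewrite /br /v /eb !mxE; ring.
have b11 := bdcontM (bh1 j) (bh1 j); have bDD := bdcontM (bp j (D j)) (bp j (D j)).
have bEE := bdcontM (bp j (dE j)) (bp j (dE j)).
have bhD := bdcontM (bh1 j) (bp j (D j)); have bED := bdcontM (bp j (dE j)) (bp j (D j)).
have y1 : \int[mu]_(x in `]xl j, xr j[) (h1 j x * (D j).[x]) <=
    1 * \int[mu]_(x in `]xl j, xr j[) (h1 j x * h1 j x)
    + (1 / 4) * \int[mu]_(x in `]xl j, xr j[) ((D j).[x] * (D j).[x]).
  rewrite -Rint_lin //; apply: le_Rint_oo => //; first exact: bdcont_lin.
  by move=> x _; have := sqr_ge0 (h1 j x - 1 / 2 * (D j).[x]); lra.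
have y2 : \int[mu]_(x in `]xl j, xr j[) ((dE j).[x] * (D j).[x]) <=
    1 * \int[mu]_(x in `]xl j, xr j[) ((dE j).[x] * (dE j).[x])
    + (1 / 4) * \int[mu]_(x in `]xl j, xr j[) ((D j).[x] * (D j).[x]).
  rewrite -Rint_lin //; apply: le_Rint_oo => //; first exact: bdcont_lin.
  by move=> x _; have := sqr_ge0 ((dE j).[x] - 1 / 2 * (D j).[x]); lra.
rewrite i4 vl vr in i1; lra.
Qed.

(** The error is [u] minus the interpolant plus the interpolant minus [u_p]. The first part has no
    jumps, so the jumps of the error are those bounded in [galerkin_defect]. *)
Lemma galerkin_error : 0 <= rho ->
  wgnorm e1 e2 b p (of_H1 w u - u_p) <= (2 + 2 / gam) * rho.
Proof.
move=> rho0; have [U [dE /= [uU hdE defect]]] := galerkin_defect.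
pose v : wgfun w := of_H1 w u - u_p; rewrite -/v.
have v1 x : v.1 x = u x - u_p.1 x by [].
have energy := energy_error; have wdv := wderiv_error uU hdE.
pose E j := S j - U j.
have bp (j : 'I_N) (q : {poly R}) : bdcont (xl j) (xr j) (horner q) by exact: bdcont_horner.
have bh j : bdcont (xl j) (xr j) (h j).
  by apply: bdcontB; [exact: bdcont_elt | exact: bp].
have vE j x : xl j < x < xr j -> v.1 x = h j x + (E j).[x].
  by move=> xj; rewrite v1 (uU _ _ xj) /h hornerD hornerN; ring.
have l2 : inner `]0, 1[ v.1 v.1 <=
    2 * \sum_(j < N) \int[mu]_(x in `]xl j, xr j[) (h j x * h j x)
    + 2 * \sum_(j < N) \int[mu]_(x in `]xl j, xr j[) ((E j).[x] * (E j).[x]).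
  have bhE j : bdcont (xl j) (xr j) (fun x => h j x + (E j).[x]) by exact: bdcontD.
  rewrite /inner (Rint_mesh hw (g := fun x => v.1 x * v.1 x)
    (G := fun j x => (h j x + (E j).[x]) * (h j x + (E j).[x])) _ _).2; first last.
    by move=> j x xj; rewrite (vE _ _ xj).
    by move=> j; exact: bdcontM.
  rewrite !mulr_sumr -big_split /=; apply: ler_sum => j _.
  rewrite -Rint_lin; [|exact: bdcontM|exact: bdcontM].
  apply: le_Rint_oo; first exact: bdcontM.
    by apply: bdcont_lin; exact: bdcontM.
  by move=> x _; have := sqr_ge0 (h j x - (E j).[x]); lra.
have tr j : tracer v j - Defs.br v j = jumpr E j.
  rewrite (tracer_lim (l := u (xr j) - (U j).[xr j])).
    by rewrite /Defs.br /v /jumpr /E /eb !mxE hornerD hornerN Sr; ring.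
  apply: (cvg_left_eq (xl_lt_xr hw j) (g := fun x => u x - (U j).[x])).
    by move=> x xj; rewrite v1 (uU _ _ xj).
  apply: cvgB; last exact: horner_cvg_left.
  by apply: within_cvg_left => //; rewrite xr_gt0 xr_le1.
have tl j : tracel v j - bl v j = jumpl E j.
  rewrite (tracel_lim (l := u (xl j) - (U j).[xl j])).
    by rewrite /bl /v /jumpl /E /eb !mxE hornerD hornerN Sl; ring.
  apply: (cvg_right_eq (xl_lt_xr hw j) (g := fun x => u x - (U j).[x])).
    by move=> x xj; rewrite v1 (uU _ _ xj).
  apply: cvgB; last exact: horner_cvg_right.
  by apply: within_cvg_right => //; rewrite xl_ge0 // xl_lt1.
have st : stab e1 p v v = \sum_(j < N) penalty e1 p j * (jumpr E j ^+ 2 + jumpl E j ^+ 2).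
  by apply: eq_bigr => j _; rewrite tr tl !expr2.
have stc : stabc e2 b v v = \sum_(j < N) e2 * b (xr j) * jumpr E j ^+ 2.
  by apply: eq_bigr => j _; rewrite tr expr2 mulrA.
have Jb0 j : 0 <= e2 * b (xr j) * jumpr E j ^+ 2.
  apply: mulr_ge0; last exact: sqr_ge0.
  by apply: mulr_ge0; apply: ltW => //; apply: bpos; rewrite xr_le1 // ltW // xr_gt0.
have j2 : jump2 e2 b v <= \sum_(j < N) e2 * b (xr j) * jumpr E j ^+ 2.
  apply: ler_sum => j _; rewrite tr -!mulrA [_ * (b _ * _)]mulrA.
  rewrite ler_piMl //; rewrite /jump_weight; case: ifP => _; lra.
have P0 : 0 <= \sum_(j < N) penalty e1 p j * (jumpr E j ^+ 2 + jumpl E j ^+ 2).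
  apply: sumr_ge0 => j _; apply: mulr_ge0; last by rewrite addr_ge0 // sqr_ge0.
  apply: divr_ge0; last exact/ltW/meshsize_gt0.
  by apply: mulr_ge0; [exact: ltW | exact: sqr_ge0].
have J0 : 0 <= \sum_(j < N) e2 * b (xr j) * jumpr E j ^+ 2 by apply: sumr_ge0.
have sq0 (j : 'I_N) (g : R -> R) : 0 <= \int[mu]_(x in `]xl j, xr j[) (g x * g x).
  by apply: Rintegral_ge0 => x _; rewrite -expr2 sqr_ge0.
have A0 : 0 <= \sum_(j < N) \int[mu]_(x in `]xl j, xr j[) ((dE j).[x] * (dE j).[x]) by apply: sumr_ge0.
have A'0 : 0 <= \sum_(j < N) \int[mu]_(x in `]xl j, xr j[) (h1 j x * h1 j x) by apply: sumr_ge0.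
have B0 : 0 <= \sum_(j < N) \int[mu]_(x in `]xl j, xr j[) ((E j).[x] * (E j).[x]) by apply: sumr_ge0.
have B'0 : 0 <= \sum_(j < N) \int[mu]_(x in `]xl j, xr j[) (h j x * h j x) by apply: sumr_ge0.
rewrite -/E in defect.
have W0 : 0 <= (2 + 2 / gam) * rho by apply: mulr_ge0 => //; rewrite addr_ge0 // divr_ge0 // ltW.
rewrite -(ger0_norm W0) -sqrtr_sqr /wgnorm ler_wsqrtr // st stc.
move: defect energy wdv l2 j2 P0 J0 A0 A'0 B0 B'0; rewrite -/v.
move: (\sum_(j < N) _ * (_ + _)) (\sum_(j < N) e2 * _ * _) (jump2 _ _ _) => P J JJ.
move: (inner _ v.1 v.1) (inner _ _ _) => I0 I1.
move: (\sum_(j < N) _) => A; move: (\sum_(j < N) _) => B.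
move: (\sum_(j < N) _) => A'; move: (\sum_(j < N) _) => B'.
move=> defect energy hI1 hI0 hJJ P0 J0 A0 A'0 B0 B'0.
have {}hI1 := ler_wpM2l (ltW e10) hI1.
pose K := rho ^+ 2 / (2 * gam).
have eA : 0 <= e1 * A by rewrite mulr_ge0 // ltW.
have eA' : 0 <= e1 * A' by rewrite mulr_ge0 // ltW.
have gB : 0 <= gam * B by rewrite mulr_ge0 // ltW.
have gB' : 0 <= gam * B' by rewrite mulr_ge0 // ltW.
rewrite -/K in defect energy.
have hB : B <= K * 2 / gam by rewrite ler_pdivlMr //; lra.
have hB' : B' <= K * 2 / gam by rewrite ler_pdivlMr //; lra.
(* The first two terms dominate the derivative and jump parts and the L^2 part respectively; the
   remaining ones are nonnegative. *)
have -> : ((2 + 2 / gam) * rho) ^+ 2 = 8 * K + 4 * (K * 2 / gam) + 4 * rho ^+ 2 + 4 * (rho ^+ 2 / gam).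
  by rewrite /K; field; rewrite gt_eqF.
have r1 := sqr_ge0 rho; have r2 : 0 <= rho ^+ 2 / gam by rewrite divr_ge0 // ltW.
lra.
Qed.

End GalerkinError.

(** * Construction of the C^1 piecewise polynomial *)

Section Construction.
Context {R : realType}.
Implicit Types (s e C A k m x t sg K g : R) (bj rj fj c : nat -> R -> R) (p : nat) (q S : {poly R}).

(** The derivative of order [n] carries the weight [s ^+ n], for convection because [e <= s]. *)
Lemma residual_bound s e bj rj c S C d0 d1 d2 x : 0 < s -> 0 <= e <= s ->
  `|bj 0%N x| <= C -> `|rj 0%N x| <= C ->
  `|c 0%N x - S.[x]| <= d0 -> s * `|c 1%N x - S^`().[x]| <= d1 ->
  s ^+ 2 * `|2 * c 2%N x - S^`()^`().[x]| <= d2 ->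
  `|strong_form (bj 0%N) (rj 0%N) (s ^+ 2) e S x - ode s e bj rj c x| <= d2 + C * d1 + C * d0.
Proof.
move=> s0 /andP[e0 es] hb hr h0 h1 h2.
have -> : strong_form (bj 0%N) (rj 0%N) (s ^+ 2) e S x - ode s e bj rj c x =
  s ^+ 2 * (2 * c 2%N x - S^`()^`().[x])
  + (bj 0%N x * (e * - (c 1%N x - S^`().[x])) + rj 0%N x * - (c 0%N x - S.[x])).
  by rewrite /strong_form /ode; ring.
have C0 : 0 <= C by apply: le_trans hb.
apply: (le_trans (ler_normD _ _)); rewrite -addrA; apply: lerD.
  by rewrite normrM ger0_norm // exprn_ge0 // ltW.
apply: (le_trans (ler_normD _ _)); apply: lerD; rewrite normrM.
  apply: ler_pM => //; rewrite normrM normrN (ger0_norm e0).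
  by apply: le_trans h1; rewrite ler_wpM2r.
by apply: ler_pM => //; rewrite normrN.
Qed.

(** An element is parametrised from its end [m] with signed length [k]. A negative [k] lets the
    layer at 1 be treated like the layer at 0, with the boundary at parameter 0. *)
Definition rescale q m k : {poly R} := q \Po (k^-1 *: ('X - m%:P)).

Lemma horner_rescale q m k x : (rescale q m k).[x] = q.[(x - m) / k].
Proof. by rewrite horner_comp !hornerE mulrC. Qed.

Lemma deriv_rescale q m k : (rescale q m k)^`() = k^-1 *: rescale q^`() m k.
Proof. by rewrite deriv_comp derivZ derivB derivX derivC subr0 alg_polyC mulrC mul_polyC. Qed.

Lemma size_rescale q m k : (size (rescale q m k) <= size q)%N.
Proof.
have [->|q0] := eqVneq q 0; first by rewrite /rescale comp_poly0.
apply: (leq_trans (size_comp_poly_leq _ _)).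
have h : ((size (k^-1 *: ('X - m%:P))).-1 <= 1)%N.
  have := leq_trans (size_scale_leq k^-1 ('X - m%:P)) (eq_leq (size_XsubC m)).
  by case: (size _).
apply: (@leq_trans ((size q).-1 * 1).+1); first by rewrite ltnS leq_mul2l h orbT.
by rewrite muln1 prednK // lt0n size_poly_eq0.
Qed.

Definition affine_jet c m k n t := k ^+ n * c n (m + k * t).

Lemma jet_affine c m k : (forall t, 0 < t < 1 -> 0 < m + k * t < 1) -> jet 0 1 c ->
  jet 0 1 (affine_jet c m k).
Proof.
move=> hm cj n t t01; have h := cj n _ (hm t t01).
have h1 : is_derive t 1 (fun y => m + k * y) k.
  have h1 := is_deriveD (is_derive_cst m t 1) (is_deriveZ k (is_derive_id t 1)).
  by rewrite add0r [_ *: _]mulr1 in h1.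
have h2 := @is_derive1_comp R (c n) (fun y => m + k * y) t _ _ h h1.
have := is_deriveZ (k ^+ n) h2.
rewrite (_ : k ^+ n *: _ = n.+1%:R * affine_jet c m k n.+1 t) //.
by rewrite /affine_jet /GRing.scale /= exprS; ring.
Qed.

Lemma rescaled_approx s e bj rj c S q C d m k t : 0 < s -> 0 <= e <= s -> k != 0 ->
  let x := m + k * t in
  `|bj 0%N x| <= C -> `|rj 0%N x| <= C -> S = rescale q m k ->
  forall D, s / `|k| <= D ->
  [/\ `|affine_jet c m k 0 t - q.[t]| <= d, `|affine_jet c m k 1 t - q^`().[t]| <= d &
      `|2 * affine_jet c m k 2 t - q^`()^`().[t]| <= d] ->
  `|strong_form (bj 0%N) (rj 0%N) (s ^+ 2) e S x - ode s e bj rj c x| <= (D ^+ 2 + C * D + C) * d.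
Proof.
move=> s0 es k0 x hb hr -> D hD [h0 h1 h2].
have xt : (x - m) / k = t by rewrite /x; field.
have kp : 0 < `|k| by rewrite normr_gt0.
have D0 : 0 <= s / `|k| by rewrite divr_ge0 // ltW.
have -> : (D ^+ 2 + C * D + C) * d = D ^+ 2 * d + C * (D * d) + C * d by ring.
apply: residual_bound => //.
- by rewrite horner_rescale xt; move: h0; rewrite /affine_jet expr0 mul1r.
- rewrite deriv_rescale hornerZ horner_rescale xt.
  have -> : c 1%N x - k^-1 * q^`().[t] = k^-1 * (affine_jet c m k 1 t - q^`().[t]).
    by rewrite /affine_jet expr1 -/x; field.
  rewrite normrM normfV mulrA; exact: ler_pM.
- rewrite !(deriv_rescale, derivZ, hornerZ) horner_rescale xt.
  have -> : 2 * c 2%N x - k^-1 * (k^-1 * q^`()^`().[t]) = k^-1 ^+ 2 * (2 * affine_jet c m k 2 t - q^`()^`().[t]).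
    by rewrite /affine_jet -/x; field.
  rewrite normrM normrX normfV mulrA -exprMn; apply: ler_pM => //.
    by apply: exprn_ge0.
  by rewrite lerXn2r ?nnegrE // (le_trans D0).
Qed.

Lemma cvg_dist_le {F : set_system R} {FF : ProperFilter F} (g h : R -> R) l l' d :
  g x @[x --> F] --> l -> h x @[x --> F] --> l' ->
  (\forall x \near F, `|g x - h x| <= d) -> `|l - l'| <= d.
Proof.
move=> gl hl gh; have cv : `|g x - h x| @[x --> F] --> `|l - l'|.
  by apply: cvg_norm; apply: cvgB.
have <- := cvg_lim (@norm_hausdorff _ _) cv.
apply: limr_le => //; by apply/cvg_ex; exists `|l - l'|.
Qed.

Lemma dist_le_right (f : R -> R) q d l : (forall t, 0 < t < 1 -> `|f t - q.[t]| <= d) ->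
  f t @[t --> 0^'+] --> l -> `|l - q.[0]| <= d.
Proof.
move=> h fl; apply: (cvg_dist_le fl (@horner_cvg_right _ q 0)).
near=> t; apply: h; apply/andP; split; near: t; first exact: nbhs_right_gt.
exact: nbhs_right_lt.
Unshelve. all: by end_near. Qed.

Lemma dist_le_left (f : R -> R) q d l : (forall t, 0 < t < 1 -> `|f t - q.[t]| <= d) ->
  f t @[t --> 1^'-] --> l -> `|l - q.[1]| <= d.
Proof.
move=> h fl; apply: (cvg_dist_le fl (@horner_cvg_left _ q 1)).
near=> t; apply: h; apply/andP; split; near: t; last exact: nbhs_left_lt.
exact: nbhs_left_gt.
Unshelve. all: by end_near. Qed.

Lemma affine_cvg m k t0 : m + k * t @[t --> t0] --> m + k * t0.
Proof. by apply: cvgD; [exact: cvg_cst | apply: cvgMr; exact: cvg_id]. Qed.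

Lemma affine_cvg_right m k : 0 < k -> m + k * t @[t --> 0^'+] --> m^'+.
Proof.
move=> k0 P hP; have := @affine_cvg m k 0; rewrite mulr0 addr0 => /(_ _ hP) H.
change (nbhs (0 : R) (fun t => 0 < t -> P (m + k * t))); move: H.
by apply: (@filterS _ (nbhs (0 : R))) => t /= h t0; apply: h; rewrite ltrDl mulr_gt0.
Qed.

Lemma affine_cvg_left m k : k < 0 -> m + k * t @[t --> 0^'+] --> m^'-.
Proof.
move=> k0 P hP; have := @affine_cvg m k 0; rewrite mulr0 addr0 => /(_ _ hP) H.
change (nbhs (0 : R) (fun t => 0 < t -> P (m + k * t))); move: H.
by apply: (@filterS _ (nbhs (0 : R))) => t /= h t0; apply: h; rewrite gtrDl nmulr_rlt0.
Qed.

Lemma ceil_exists (a : R) : 0 <= a -> exists2 N : nat, a <= N%:R & N%:R <= a + 1.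
Proof.
move=> a0; exists (Num.truncn a).+1; first exact/ltW/truncnS_gt.
by rewrite -natr1 lerD2r truncn_le.
Qed.

Lemma expR1_le4 : expR 1 <= 4 :> R.
Proof.
have h1 := expR_ge1Dx (- (1 / 2) : R); have := expRxMexpNx_1 (1 / 2 : R).
have h2 := expR_gt0 (1 / 2 : R).
have -> : expR 1 = expR (1 / 2) * expR (1 / 2) :> R by rewrite -expRD; congr expR; field.
nra.
Qed.

Lemma exp2_le (N : nat) : 2 ^+ N <= expR N%:R :> R.
Proof.
rewrite -[N%:R]mulr1 expRM_natl lerXn2r ?nnegrE ?expR_ge0 //.
by have := expR_ge1Dx (1 : R); lra.
Qed.

(* The factor [|k|^n] coming from the rescaling turns [growth s n] into a
   product of factors at most 1 + 2 kap p / (i + 1), bounded by 2^(n + 2 kap p + 1);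
   the resulting exponential in [p] is absorbed because [kap] is small. *)
Lemma layer_approx s c A K kap sg C1 m k p : 0 < s -> 0 < K -> approximable (2 * K) sg C1 -> 0 <= C1 ->
  0 <= A -> jet 0 1 c ->
  (forall n x, 0 < x < 1 -> `|c n x| <= A * K ^+ n * growth s n) ->
  0 < kap <= sg / 4 -> 0 < `|k| <= 1 -> `|k| <= 2 * kap * p%:R * s ->
  (forall t, 0 < t < 1 -> 0 < m + k * t < 1) ->
  exists2 q : {poly R}, (size q <= p.+1)%N & forall t, 0 < t < 1 ->
    let d := C1 * (6 * A) * expR (- (sg / 2) * p%:R) in
    [/\ `|affine_jet c m k 0 t - q.[t]| <= d, `|affine_jet c m k 1 t - q^`().[t]| <= d &
      `|2 * affine_jet c m k 2 t - q^`()^`().[t]| <= d].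
Proof.
move=> s0 K0 hap C10 A0 cj cb /andP[ka0 ka1] /andP[k0 k1] ks hm.
pose a : R := 2 * kap * p%:R.
have a0 : 0 <= a by rewrite /a !mulr_ge0 // ltW.
have [N aN Na] := ceil_exists a0.
have bA : jbound 0 1 (A * 2 ^+ N) (2 * K) (affine_jet c m k).
  move=> n t t01; rewrite /affine_jet normrM normrX.
  apply: (le_trans (ler_wpM2l (exprn_ge0 n (ltW k0)) (cb n _ (hm t t01)))).
  have gr : `|k| ^+ n * growth s n <= 2 ^+ (n + N).
    apply: (le_trans _ (@prod_growth_le _ a N n _)); last by rewrite a0.
    rewrite -[X in _ ^+ X]card_ord -prodr_const -big_split /=.
    apply: ler_prod => i _; apply/andP; split.
      by apply: mulr_ge0; [exact: ltW | rewrite addr_ge0 // invr_ge0 mulr_ge0 // ltW].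
    rewrite mulrDr mulr1; apply: lerD => //.
    rewrite invfM mulrCA mulrC ler_wpM2r ?invr_ge0 //.
    by rewrite ler_pdivrMr.
  have -> : `|k| ^+ n * (A * K ^+ n * growth s n) = A * K ^+ n * (`|k| ^+ n * growth s n) by ring.
  apply: (le_trans (ler_wpM2l _ gr)); first by rewrite mulr_ge0 // exprn_ge0 // ltW.
  by rewrite exprMn exprD le_eqVlt; apply/orP; left; apply/eqP; ring.
have [q sq hq] := hap _ _ p (jet_affine hm cj) bA.
exists q => // t t01 d.
have hd : C1 * (A * 2 ^+ N) * expR (- sg * p%:R) <= d.
  rewrite /d -!mulrA; apply: ler_wpM2l => //.
  rewrite [6 * _]mulrCA; apply: ler_wpM2l => //.
  have e1 : 2 ^+ N <= expR (a + 1) by apply: (le_trans (exp2_le N)); rewrite ler_expR.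
  have e3 : expR 1 <= 6 :> R by have := expR1_le4; lra.
  apply: (le_trans (ler_wpM2r (expR_ge0 _) e1)).
  rewrite -expRD.
  have e2 : a + 1 + - sg * p%:R <= 1 + - (sg / 2) * p%:R.
    have : kap * p%:R <= sg / 4 * p%:R by rewrite ler_wpM2r.
    by rewrite /a; lra.
  apply: (@le_trans _ _ (expR (1 + - (sg / 2) * p%:R))); first by rewrite ler_expR.
  by rewrite expRD ler_wpM2r ?expR_ge0.
have [h0 h1 h2] := hq t t01; split; exact: le_trans hd.
Qed.

End Construction.

(** * Interpolants on the single, layer and inner elements *)

Section Elements.
Context {R : realType}.
Implicit Types (s e C A D k m x t sg K g : R) (bj rj fj c : nat -> R -> R) (p : nat) (q S : {poly R}).

(** A layer element has three conditions to meet: the boundary value, and the value and slope at the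
    inner end. *)
Lemma quadratic_correction (al be la : R) : let B := 2 * (`|al| + `|be| + `|la|) in
  exists l : {poly R}, [/\ (size l <= 3)%N, l.[0] = al, l.[1] = be, l^`().[1] = la &
    forall t, 0 < t < 1 -> [/\ `|l.[t]| <= B, `|l^`().[t]| <= B & `|l^`()^`().[t]| <= B]].
Proof.
move=> B; pose l : {poly R} := al%:P + (2 * be - 2 * al - la) *: 'X + (al - be + la) *: 'X^2.
have l1 : l^`() = (2 * be - 2 * al - la)%:P + (2 * (al - be + la)) *: 'X.
  rewrite /l !derivD derivC !derivZ derivX derivXn add0r alg_polyC expr1.
  by rewrite -scalerMnr scalerMnl -[X in X *: 'X]mulr_natl.
have l2 : l^`()^`() = (2 * (al - be + la))%:P.
  by rewrite l1 derivD derivC derivZ derivX add0r alg_polyC.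
exists l; split.
- rewrite /l; apply: (leq_trans (size_polyD _ _)); rewrite geq_max.
  rewrite (leq_trans (size_scale_leq _ _)) ?size_polyXn // andbT.
  apply: (leq_trans (size_polyD _ _)); rewrite geq_max.
  rewrite (leq_trans (size_polyC_leq1 _)) //=.
  by rewrite (leq_trans (size_scale_leq _ _)) // size_polyX.
- by rewrite /l !hornerE /=; ring.
- by rewrite /l !hornerE /=; ring.
- by rewrite l1 !hornerE /=; ring.
have tri (w1 w2 w3 : R) : `|w1| <= 2 -> `|w2| <= 2 -> `|w3| <= 2 ->
    `|al * w1 + be * w2 + la * w3| <= B.
  move=> h1 h2 h3; have -> : B = `|al| * 2 + `|be| * 2 + `|la| * 2 by rewrite /B; ring.
  apply: (le_trans (ler_normD _ _)); apply: lerD; last by rewrite normrM ler_wpM2l.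
  by apply: (le_trans (ler_normD _ _)); apply: lerD; rewrite normrM ler_wpM2l.
move=> t /andP[t0 t1]; rewrite l2 l1 /l; split.
- rewrite (_ : _.[t] = al * (1 - t) ^+ 2 + be * (1 - (1 - t) ^+ 2) + la * (t * (t - 1))).
    by apply: tri; rewrite ler_norml; apply/andP; split; nra.
  by rewrite !hornerE /=; ring.
- rewrite (_ : _.[t] = al * (2 * t - 2) + be * (2 - 2 * t) + la * (2 * t - 1)).
    by apply: tri; rewrite ler_norml; apply/andP; split; lra.
  by rewrite !hornerE /=; ring.
- rewrite (_ : _.[t] = al * 2 + be * (- 2) + la * 2).
    by apply: tri; rewrite ler_norml; apply/andP; split; lra.
  by rewrite !hornerE /=; ring.
Qed.

Section Layers.
Context (s e C A K kap sg C1 : R) (bj rj c : nat -> R -> R) (p : nat).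
Context (s0 : 0 < s) (es : 0 <= e <= s) (K0 : 0 < K) (hap : approximable (2 * K) sg C1).
Context (C10 : 0 <= C1) (A0 : 0 <= A) (cj : jet 0 1 c).
Context (cb : forall n x, 0 < x < 1 -> `|c n x| <= A * K ^+ n * growth s n).
Context (hkap : 0 < kap <= sg / 4).
Context (hb : forall x, 0 < x < 1 -> `|bj 0%N x| <= C).
Context (hr : forall x, 0 < x < 1 -> `|rj 0%N x| <= C).
Let d := C1 * (6 * A) * expR (- (sg / 2) * p%:R).

Let d0 : 0 <= d.
Proof. by rewrite /d !mulr_ge0 // expR_ge0. Qed.

Let C0 : 0 <= C.
Proof.
have h : 0 < (1 / 2 : R) < 1 by lra.
exact: le_trans (hb h).
Qed.

(** Nothing has to be matched, and an affine correction restores the two boundary values. The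
    hypothesis [1 <= 2 * kap * p%:R * s] says that (0, 1) itself is within the layer scale. *)
Lemma single_element : s <= 1 -> (0 < p)%N -> 1 <= 2 * kap * p%:R * s ->
  c 0%N t @[t --> 0^'+] --> 0 -> c 0%N t @[t --> 1^'-] --> 0 ->
  exists S : {poly R}, [/\ (size S <= p.+1)%N, S.[0] = 0, S.[1] = 0 &
    forall x, 0 < x < 1 -> `|strong_form (bj 0%N) (rj 0%N) (s ^+ 2) e S x - ode s e bj rj c x|
      <= (1 + 2 * C) * (3 * d)].
Proof.
move=> s1 p0 kps c00 c01.
have hm t : 0 < t < 1 -> 0 < 0 + 1 * t < 1 by rewrite add0r mul1r.
have k1 : `|1 : R| = 1 := normr1 _.
have [||q sq hq] := @layer_approx R s c A K kap sg C1 0 1 p s0 K0 hap C10 A0 cj cb hkap _ _ hm.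
- by rewrite k1; lra.
- by rewrite k1.
have aj n t : affine_jet c 0 1 n t = c n t by rewrite /affine_jet expr1n mul1r add0r mul1r.
have q0 : `|q.[0]| <= d.
  rewrite -normrN -[- _]add0r; apply: (dist_le_right _ c00) => t /hq [+ _ _].
  by rewrite aj.
have q1 : `|q.[1]| <= d.
  rewrite -normrN -[- _]add0r; apply: (dist_le_left _ c01) => t /hq [+ _ _].
  by rewrite aj.
pose l : {poly R} := q.[0]%:P + (q.[1] - q.[0]) *: 'X.
have l1 : l^`() = (q.[1] - q.[0])%:P by rewrite /l derivD derivC derivZ derivX add0r alg_polyC.
have l2 : l^`()^`() = 0 by rewrite l1 derivC.
exists (rescale (q - l) 0 1); split.
- apply: (leq_trans (size_rescale _ _ _)).
  apply: (leq_trans (size_polyD _ _)); rewrite size_polyN geq_max sq /=.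
  apply: (leq_trans (size_polyD _ _)); rewrite geq_max (leq_trans (size_polyC_leq1 _)) //=.
  by rewrite (leq_trans (size_scale_leq _ _)) // size_polyX.
- by rewrite horner_rescale subr0 mul0r /l !hornerE /=; ring.
- by rewrite horner_rescale subr0 divr1 /l !hornerE /=; ring.
move=> x x01; have [h0 h1 h2] := hq x x01; rewrite !aj -/d in h0 h1 h2.
have -> : 1 + 2 * C = 1 ^+ 2 + C * 1 + C by ring.
have := @rescaled_approx R s e bj rj c _ (q - l) C (3 * d) 0 1 x s0 es (oner_neq0 _).
rewrite add0r mul1r => /(_ (rescale (q - l) 0 1)) H.
apply: H => //; [exact: hb|exact: hr|by rewrite k1 divr1|rewrite !aj; split].
- have -> : c 0%N x - (q - l).[x] = (c 0%N x - q.[x]) + (q.[0] * (1 - x) + q.[1] * x).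
    by rewrite /l !hornerE /=; ring.
  have b0 : `|q.[0] * (1 - x)| <= d.
    by rewrite normrM [`|1 - x|]ger0_norm; [rewrite (le_trans _ q0) // ler_piMr // | ]; lra.
  have b1 : `|q.[1] * x| <= d.
    by rewrite normrM [`|x|]ger0_norm; [rewrite (le_trans _ q1) // ler_piMr // | ]; lra.
  apply: (le_trans (ler_normD _ _)); have := ler_normD (q.[0] * (1 - x)) (q.[1] * x); lra.
- rewrite derivB l1 hornerD hornerN hornerC.
  have -> : c 1%N x - (q^`().[x] - (q.[1] - q.[0])) = (c 1%N x - q^`().[x]) + (q.[1] - q.[0]) by ring.
  apply: (le_trans (ler_normD _ _)); have := ler_normB q.[1] q.[0]; lra.
- by rewrite !derivB l2 subr0; apply: (le_trans h2); rewrite ler_peMl //; lra.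
Qed.

(** [bv] and [bl] bound the mismatch between [c] and the data prescribed at the inner end [m + k],
    the slope being scaled by the length of the element. The quadratic correction is controlled by
    these mismatches and the approximation error [d]. *)
Lemma layer_element m k D (v sl bv bl : R) : (1 < p)%N -> 0 < `|k| <= 1 ->
  `|k| <= 2 * kap * p%:R * s -> s / `|k| <= D ->
  (forall t, 0 < t < 1 -> 0 < m + k * t < 1) -> 0 < m + k < 1 ->
  c 0%N (m + k * t) @[t --> 0^'+] --> 0 ->
  `|c 0%N (m + k) - v| <= bv -> `|k| * `|c 1%N (m + k) - sl| <= bl ->
  exists S : {poly R}, [/\ (size S <= p.+1)%N, S.[m] = 0, S.[m + k] = v, S^`().[m + k] = sl &
    forall t, 0 < t < 1 ->
      `|strong_form (bj 0%N) (rj 0%N) (s ^+ 2) e S (m + k * t) - ode s e bj rj c (m + k * t)|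
      <= (D ^+ 2 + C * D + C) * (7 * d + 2 * bv + 2 * bl)].
Proof.
move=> p1 k01 kps sk hm mk c00 hv hsl.
have k0 : k != 0 by rewrite -normr_gt0; lra.
have [q sq hq] := @layer_approx R s c A K kap sg C1 m k p s0 K0 hap C10 A0 cj cb hkap k01 kps hm.
have h1t n : c n (m + k * t) @[t --> 1^'-] --> c n (m + k).
  have h : {for m + k * 1, continuous (c n)} by rewrite mulr1; exact: jet_cont mk.
  have := cvg_comp _ _ (cvg_at_left_filter (@affine_cvg _ m k 1)) h.
  by rewrite mulr1.
have q0 : `|q.[0]| <= d.
  rewrite -normrN -[- _]add0r; apply: (dist_le_right _ c00) => t /hq [+ _ _].
  by rewrite /affine_jet expr0 mul1r.
have q1 : `|c 0%N (m + k) - q.[1]| <= d.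
  apply: (dist_le_left _ (h1t 0%N)) => t /hq [+ _ _].
  by rewrite /affine_jet expr0 mul1r.
have q1' : `|k * c 1%N (m + k) - q^`().[1]| <= d.
  have {}h1t : k * c 1%N (m + k * t) @[t --> 1^'-] --> k * c 1%N (m + k).
    by apply: cvgMr; exact: h1t.
  apply: (dist_le_left _ h1t) => t /hq [_ + _].
  by rewrite /affine_jet expr1.
have [l [sl3 l0 l1 l1' lB]] := quadratic_correction (- q.[0]) (v - q.[1]) (k * sl - q^`().[1]).
set B := 2 * _ in lB.
(* One [d] for each of the three corrected quantities, doubled; the approximation itself adds the
   seventh. *)
have hB : B <= 6 * d + 2 * bv + 2 * bl.
  have n1 : `|v - q.[1]| <= bv + d.
    have -> : v - q.[1] = - (c 0%N (m + k) - v) + (c 0%N (m + k) - q.[1]) by ring.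
    by apply: (le_trans (ler_normD _ _)); rewrite normrN lerD.
  have n2 : `|k * sl - q^`().[1]| <= bl + d.
    have -> : k * sl - q^`().[1] = - (k * (c 1%N (m + k) - sl)) + (k * c 1%N (m + k) - q^`().[1]) by ring.
    by apply: (le_trans (ler_normD _ _)); rewrite normrN normrM lerD.
  by rewrite /B normrN; lra.
exists (rescale (q + l) m k); split.
- apply: (leq_trans (size_rescale _ _ _)).
  apply: (leq_trans (size_polyD _ _)); rewrite geq_max sq /=; exact: leq_trans sl3 _.
- by rewrite horner_rescale subrr mul0r hornerD l0 subrr.
- by rewrite horner_rescale addrAC subrr add0r divff // hornerD l1 addrC subrK.
- rewrite deriv_rescale hornerZ horner_rescale addrAC subrr add0r divff // derivD hornerD l1'.
  by rewrite [q^`().[1] + _]addrC subrK mulKf.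
move=> t t01; have [h0 h1 h2] := hq t t01; have [g0 g1 g2] := lB t t01.
rewrite -/d in h0 h1 h2.
apply: (@rescaled_approx R s e bj rj c _ (q + l) C _ m k t) => //; first exact/hb/hm.
  exact/hr/hm.
have tri (x y z : R) : `|x - y| <= d -> `|z| <= B -> `|x - (y + z)| <= 7 * d + 2 * bv + 2 * bl.
  move=> hx hz; rewrite opprD addrA; apply: (le_trans (ler_normB _ _)); lra.
by rewrite !derivD !hornerD; split; apply: tri.
Qed.

End Layers.

Lemma interior_decay s e C (r0 be Z kap pz : R) bj rj z p :
  0 < s -> 0 <= e <= s -> e * C <= s / 2 -> 0 < r0 -> 0 <= C -> 0 <= pz -> 0 <= Z ->
  jet 0 1 z -> (forall x, 0 < x < 1 -> `|bj 0%N x| <= C) ->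
  (forall x, 0 < x < 1 -> `|rj 0%N x| <= C) -> (forall x, 0 < x < 1 -> r0 <= rj 0%N x) ->
  (forall x, 0 < x < 1 -> `|z 0%N x| <= Z) ->
  (forall x, 0 < x < 1 -> `|ode s e bj rj z x| <= pz) ->
  0 < be -> be ^+ 2 + be * C <= r0 -> (0 < p)%N -> 0 < kap <= 1 ->
  let dz := pz / r0 + 4 * Z * expR (- (be * kap / 2) * p%:R) in
  forall x, kap * p%:R * s <= x <= 1 - kap * p%:R * s -> 0 < x < 1 /\
    (`|z 0%N x| <= dz /\ s * `|z 1%N x| <= 2 * (4 * dz / kap + C * dz + pz)).
Proof.
move=> s0 hes eC r00 C0 pz0 Z0 jz hb0 hr0 hr zZ Ez be0 beC p0 /andP[ka0 ka1] dz.
have decay x : 0 < x < 1 -> `|z 0%N x| <= pz / r0 + 2 * Z *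
    (expR (- (be / s) * x) + expR (- (be / s) * (1 - x))).
  apply: (@layer_decay R s e (bj 0%N) (rj 0%N) (z 0%N) (z 1%N) (fun x => 2 * z 2%N x) C) => //.
  - by move=> y; exact: jet_der0.
  - by move=> y; exact: jet_der1.
  - by move=> y y01; apply: cvgMr; exact: jet_cont jz y01.
pose h := kap * p%:R * s.
have p1 : 1 <= p%:R :> R by rewrite ler1n.
have ks : kap * s <= h by rewrite /h mulrAC ler_peMr // mulr_ge0 // ltW.
have ks0 : 0 < kap * s by rewrite mulr_gt0.
(* The bound is needed from distance [h / 2] on, since the slope estimate at a layer point uses the
   interval of length [kap / 2 * s] to its left; this halves the decay rate. *)
have hdz x : h / 2 <= x <= 1 - h / 2 -> 0 < x < 1 /\ `|z 0%N x| <= dz.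
  move=> xh; have x01 : 0 < x < 1 by lra.
  split=> //; apply: (le_trans (decay x x01)); rewrite /dz lerD2l.
  have ee y : h / 2 <= y -> expR (- (be / s) * y) <= expR (- (be * kap / 2) * p%:R).
    move=> hy; rewrite ler_expR.
    have -> : - (be * kap / 2) * p%:R = - (be / s) * (h / 2) by rewrite /h; field; lra.
    by rewrite !mulNr lerN2 ler_wpM2l // divr_ge0 // ltW.
  have e1 : expR (- (be / s) * x) <= expR (- (be * kap / 2) * p%:R) by apply: ee; lra.
  have e2 : expR (- (be / s) * (1 - x)) <= expR (- (be * kap / 2) * p%:R) by apply: ee; lra.
  have -> : 4 * Z = 2 * Z * 2 by ring.
  rewrite -[leRHS]mulrA; apply: ler_wpM2l; first exact: mulr_ge0.
  lra.
move=> x hx.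
have [x01 zx] : 0 < x < 1 /\ `|z 0%N x| <= dz by apply: hdz; rewrite -/h in hx; lra.
split=> //; split=> //.
have sub y : x - kap / 2 * s <= y <= x -> 0 < y < 1 /\ `|z 0%N y| <= dz.
  by move=> hy; apply: hdz; rewrite -/h in hx; lra.
have -> : 4 * dz / kap = 2 * dz / (kap / 2) by field; lra.
have k20 : 0 < kap / 2 by rewrite divr_gt0.
have i1 : kap / 2 * s <= x - (x - kap / 2 * s) <= s.
  rewrite opprB addrCA subrr addr0 lexx /= ler_piMl // ?(ltW s0) //.
  by rewrite ler_pdivrMr // mul1r (le_trans ka1) // ler1n.
have i2 : x - kap / 2 * s <= x <= x by rewrite lexx andbT gerBl mulr_ge0 // ltW.
apply: (@landau_bound _ (x - kap / 2 * s) x s (kap / 2) e (bj 0%N) (rj 0%N) (z 0%N) (z 1%N)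
  (fun y => 2 * z 2%N y)) i2 => //.
- by case/andP: hes.
- by move=> y /sub [y01 _]; exact: jet_der0.
- by move=> y /sub [y01 _]; exact: jet_der1.
- by move=> y /sub [y01 _]; exact: hb0.
- by move=> y /sub [y01 _]; exact: hr0.
- by move=> y /sub [].
- by move=> y /sub [y01 _]; have := Ez y y01; rewrite /ode.
Qed.

Lemma smooth_inner s e bj rj fj c C (G g r0 be Z kap sg2 C2 : R) (M : nat) p :
  0 < s -> 0 <= e <= s -> e * C <= s / 2 -> s <= 1 -> 0 < r0 -> 0 <= G -> 1 <= 2 * g ->
  2 * G <= g -> 4 * C * G <= r0 * g ->
  jet 0 1 bj -> jet 0 1 rj -> jet 0 1 fj ->
  jbound 0 1 C G bj -> jbound 0 1 C G rj -> jbound 0 1 C G fj ->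
  (forall x, 0 < x < 1 -> r0 <= rj 0%N x) ->
  2 / r0 * ((8 * g * (M%:R * s)) ^+ 2 + 2 * C * (8 * g * (M%:R * s))) <= expR (-1) ->
  approximable (2 * g) sg2 C2 -> 0 <= C2 ->
  jet 0 1 c -> (forall x, 0 < x < 1 -> ode s e bj rj c x = fj 0%N x) ->
  (forall x, 0 < x < 1 -> `|c 0%N x| <= Z) ->
  0 < be -> be ^+ 2 + be * C <= r0 -> (0 < p)%N -> 0 < kap <= 1 ->
  let pz := 2 * C ^+ 2 / r0 * expR (- M%:R) in
  let d2 := C2 * (4 * C / r0) * expR (- sg2 * p%:R) in
  let dz := pz / r0 + 4 * (Z + 4 * C / r0) * expR (- (be * kap / 2) * p%:R) in
  exists Q : {poly R}, [/\ (size Q <= p.+1)%N,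
    forall x, 0 < x < 1 -> `|strong_form (bj 0%N) (rj 0%N) (s ^+ 2) e Q x - fj 0%N x|
      <= (1 + 2 * C) * d2 + pz &
    forall x, kap * p%:R * s <= x <= 1 - kap * p%:R * s ->
      `|c 0%N x - Q.[x]| <= d2 + dz /\
      s * `|c 1%N x - Q^`().[x]| <= d2 + 2 * (4 * dz / kap + C * dz + pz)].
Proof.
move=> s0 hes eC s1 r00 G0 g1 Gg CG jb jr jf bb br bf hr hX hap C20 cj Ec cZ be0 beC p0 hka pz d2 dz.
have g0 : 0 < g by lra.
have C0 := jbound_ge0 bb.
have [w [jw bw Ew]] := smooth_part s0 hes r00 G0 g0 Gg CG jb jr jf bb br bf hr hX.
have [q sq hq] := hap _ _ p jw bw.
have hb0 x := jbound0 bb (x := x); have hr0 x := jbound0 br (x := x).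
have d20 : 0 <= d2.
  apply: mulr_ge0; last exact: expR_ge0.
  by apply: mulr_ge0 => //; apply: divr_ge0; [exact: mulr_ge0 | exact: ltW].
have sd2 : s * d2 <= d2 by rewrite ler_piMl.
have h12 : 0 < (1 / 2 : R) < 1 by lra.
have Z0 : 0 <= Z by apply: le_trans (cZ _ h12).
have Cr : 0 <= 4 * C / r0 by apply: divr_ge0; [exact: mulr_ge0 | exact: ltW].
have pz0 : 0 <= pz.
  apply: mulr_ge0; last exact: expR_ge0.
  by apply: divr_ge0; [apply: mulr_ge0 => //; exact: sqr_ge0 | exact: ltW].
exists q; split => //.
  move=> x x01; have [h0 h1 h2] := hq x x01.
  have -> : strong_form (bj 0%N) (rj 0%N) (s ^+ 2) e q x - fj 0%N x =
    (strong_form (bj 0%N) (rj 0%N) (s ^+ 2) e q x - ode s e bj rj w x) + (ode s e bj rj w x - fj 0%N x).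
    by ring.
  apply: (le_trans (ler_normD _ _)); apply: lerD; last exact: Ew.
  have -> : (1 + 2 * C) * d2 = d2 + C * d2 + C * d2 by ring.
  apply: residual_bound => //; [exact: hb0 | exact: hr0 | |].
    by apply: le_trans sd2; rewrite ler_wpM2l // ltW.
  apply: le_trans sd2; rewrite expr2 -mulrA; apply: ler_wpM2l; first exact: ltW.
  by apply: le_trans h2; rewrite ler_piMl // ?normr_ge0.
(* The difference satisfies the homogeneous equation up to [pz], so its size at the layer points is
   governed by decay. *)
pose zj n x := 1 * c n x + (-1) * w n x.
have jz : jet 0 1 zj by exact: jet_lin.
have Ez x : 0 < x < 1 -> `|ode s e bj rj zj x| <= pz.
  move=> x01; rewrite /zj ode_lin Ec // mul1r mulN1r -normrN opprB; exact: Ew.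
have zZ x : 0 < x < 1 -> `|zj 0%N x| <= Z + 4 * C / r0.
  move=> x01; rewrite /zj mul1r mulN1r; apply: (le_trans (ler_normB _ _)).
  by apply: lerD; [exact: cZ | exact: jbound0 bw x01].
move=> x hx; have [x01 [z0 z1]] := interior_decay s0 hes eC r00 C0 pz0 (addr_ge0 Z0 Cr) jz
  hb0 hr0 hr zZ Ez be0 beC p0 hka hx.
have [q0 q1 _] := hq x x01; rewrite -/d2 in q0 q1.
split.
  have -> : c 0%N x - q.[x] = (w 0%N x - q.[x]) + zj 0%N x by rewrite /zj; ring.
  by apply: (le_trans (ler_normD _ _)); exact: lerD.
have -> : c 1%N x - q^`().[x] = (w 1%N x - q^`().[x]) + zj 1%N x by rewrite /zj; ring.
apply: (le_trans (ler_wpM2l (ltW s0) (ler_normD _ _))); rewrite mulrDr; apply: lerD => //.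
by apply: le_trans sd2; apply: ler_wpM2l => //; exact: ltW.
Qed.

End Elements.

(** * Error bounds on the two meshes *)

Section ThreeMeshes.
Context {R : realType}.
Context (b b1 r f u u1 u2 : R -> R) (cb : {within `[0, 1], continuous b}).
Context (db : forall x : R, 0 < x < 1 -> is_derive x 1 b (b1 x)).
Context (bb1 : bdcont 0 1 b1) (br : bdcont 0 1 r) (bf : bdcont 0 1 f).
Context (bpos : forall x : R, 0 <= x <= 1 -> 0 < b x).
Context (p : nat) (e1 e2 gam rho : R) (p0 : (0 < p)%N).
Context (e10 : 0 < e1) (e20 : 0 < e2) (gam0 : 0 < gam) (rho0 : 0 <= rho).
Context (hr : forall x : R, 0 < x < 1 -> gam <= r x - e2 / 2 * b1 x).
Context (cu : {within `[0, 1], continuous u}) (u0 : u 0 = 0) (u_1 : u 1 = 0).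
Context (du : forall x : R, 0 < x < 1 -> is_derive x 1 u (u1 x)).
Context (du1 : forall x : R, 0 < x < 1 -> is_derive x 1 u1 (u2 x)).
Context (bu1 : bdcont 0 1 u1) (bu2 : bdcont 0 1 u2).
Context (Lu : forall x : R, 0 < x < 1 -> - e1 * u2 x + e2 * b x * u1 x + r x * u x = f x).
Notation residual S x := (strong_form b r e1 e2 S x - f x).

(** Comparison with 0, whose residual is [- f]. This settles [p = 1], where degree 1 has no room for
    the quadratic correction. *)
Lemma galerkin_error_zero (w : mesh R) (u_p : wgfun w) : is_mesh w ->
  (forall x : R, 0 < x < 1 -> `|f x| <= rho) -> wg_solution e1 e2 b r p f u_p ->
  wgnorm e1 e2 b p (of_H1 w u - u_p) <= (2 + 2 / gam) * rho.
Proof.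
move=> hw hf hup.
apply: (galerkin_error hw cb db bb1 br bf bpos p0 e10 e20 gam0 hr
  (S := fun _ => 0) (vb := 0) (ds := 0) _ _ _ _ _ _ _ _ hup cu u0 u_1 du du1 bu1 bu2 Lu rho0).
- by move=> j; rewrite size_poly0.
- by move=> j; rewrite horner0 mxE.
- by move=> j; rewrite horner0 mxE.
- by move=> j; rewrite deriv0 horner0 mxE.
- by move=> j; rewrite deriv0 horner0 mxE.
- by rewrite mxE.
- by rewrite mxE.
move=> j x xj; rewrite /strong_form !deriv0 !horner0 !mulr0 !addr0 sub0r normrN.
by apply: hf; exact: elt_in01 xj.
Qed.

Lemma galerkin_error_one (u_p : wgfun (@Mesh R 1 [tuple 0; 1])) (S : {poly R}) :
  is_mesh (@Mesh R 1 [tuple 0; 1]) ->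
  (size S <= p.+1)%N -> S.[0] = 0 -> S.[1] = 0 ->
  (forall x : R, 0 < x < 1 -> `|residual S x| <= rho) ->
  wg_solution e1 e2 b r p f u_p ->
  wgnorm e1 e2 b p (of_H1 (@Mesh R 1 [tuple 0; 1]) u - u_p) <= (2 + 2 / gam) * rho.
Proof.
move=> hw sS S0 S1 hS hup.
apply: (galerkin_error hw cb db bb1 br bf bpos p0 e10 e20 gam0 hr
  (S := fun _ => S) (vb := 0) (ds := \row_i (S^`()).[tnth [tuple 0; 1] i])
  _ _ _ _ _ _ _ _ hup cu u0 u_1 du du1 bu1 bu2 Lu rho0) => //.
- by move=> j; rewrite mxE /xl (tnth_nth 0) ord1 /= S0.
- by move=> j; rewrite mxE /xr (tnth_nth 0) ord1 /= S1.
- by move=> j; rewrite mxE.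
- by move=> j; rewrite mxE.
- by rewrite mxE.
- by rewrite mxE.
by move=> j x xj; apply: hS; exact: elt_in01 xj.
Qed.

Lemma galerkin_error_three (h : R) (w := @Mesh R 3 [tuple 0; h; 1 - h; 1]) (u_p : wgfun w)
  (S0 Q S2 : {poly R}) : is_mesh w -> 0 < h < 1 / 2 ->
  (size S0 <= p.+1)%N -> (size Q <= p.+1)%N -> (size S2 <= p.+1)%N ->
  S0.[0] = 0 -> S0.[h] = Q.[h] -> S0^`().[h] = Q^`().[h] ->
  S2.[1] = 0 -> S2.[1 - h] = Q.[1 - h] -> S2^`().[1 - h] = Q^`().[1 - h] ->
  (forall x : R, 0 < x < h -> `|residual S0 x| <= rho) ->
  (forall x : R, 0 < x < 1 -> `|residual Q x| <= rho) ->
  (forall x : R, 1 - h < x < 1 -> `|residual S2 x| <= rho) ->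
  wg_solution e1 e2 b r p f u_p ->
  wgnorm e1 e2 b p (of_H1 w u - u_p) <= (2 + 2 / gam) * rho.
Proof.
move=> hw h01 s0 sQ s2 S00 S0h S0h' S21 S2h S2h' h0 hQ h2 hup.
pose S (j : 'I_3) := nth 0 [:: S0; Q; S2] j.
pose vb := \row_(i < 4) nth 0 [:: 0; Q.[h]; Q.[1 - h]; 0] i.
pose ds := \row_(i < 4) nth 0 [:: S0^`().[0]; Q^`().[h]; Q^`().[1 - h]; S2^`().[1]] i.
apply: (galerkin_error hw cb db bb1 br bf bpos p0 e10 e20 gam0 hr
  (S := S) (vb := vb) (ds := ds) _ _ _ _ _ _ _ _ hup cu u0 u_1 du du1 bu1 bu2 Lu rho0).
- by case=> [[|[|[|]]]].
- by case=> [[|[|[|//]]] ?]; rewrite mxE /= /xl (tnth_nth 0).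
- by case=> [[|[|[|//]]] ?]; rewrite mxE /= /xr (tnth_nth 0).
- by case=> [[|[|[|//]]] ?]; rewrite mxE /= /xl (tnth_nth 0).
- by case=> [[|[|[|//]]] ?]; rewrite mxE /= /xr (tnth_nth 0).
- by rewrite mxE.
- by rewrite mxE.
case=> [[|[|[|//]]] ?] x; rewrite /xl /xr !(tnth_nth 0) /= => xj.
- exact: h0.
- by apply: hQ; lra.
- exact: h2.
Qed.

End ThreeMeshes.

(** * Interpolation of the solution *)

Section Regular.
Context {R : realType}.
Context (s e C G r0 : R) (b r f u : R -> R).
Context (s01 : 0 < s <= 1) (es : 0 <= e <= s) (eC : e * C <= s / 2) (r00 : 0 < r0) (G0 : 0 <= G).
Context (jb : jet 0 1 (tjet b)) (jr : jet 0 1 (tjet r)) (jf : jet 0 1 (tjet f)).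
Context (bb : jbound 0 1 C G (tjet b)) (br : jbound 0 1 C G (tjet r)) (bf : jbound 0 1 C G (tjet f)).
Context (hr : forall x, 0 < x < 1 -> r0 <= r x).
Context (hu : bvp_solution (s ^+ 2) e b r f u).

Lemma tjet0 (g : R -> R) : tjet g 0 = g.
Proof. by apply/funext => x; rewrite /tjet divr1. Qed.

Lemma tjet1 (g : R -> R) : tjet g 1 = derive1 g.
Proof. by apply/funext => x; rewrite /tjet divr1. Qed.

Lemma solution_jet : [/\ jet 0 1 (tjet u),
  forall x, 0 < x < 1 -> ode s e (tjet b) (tjet r) (tjet u) x = tjet f 0 x &
  forall n x, 0 < x < 1 ->
    s ^+ 2 * (n.+1%:R * n.+2%:R) * tjet u n.+2 x = ode_rhs e (tjet b) (tjet r) (tjet f) (tjet u) n x].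
Proof.
have [_ _ _ Lu] := hu.
have s0 : 0 < s by case/andP: s01.
have [||ju rec] := @ode_jet R (s ^+ 2) e (tjet b) (tjet r) (tjet f) u _ jb jr jf.
  by rewrite gt_eqF // exprn_gt0.
  by move=> x x01; have [] := Lu x; rewrite ?in_itv // !tjet0.
split => // x x01; have [|_ _ E] := Lu x; first by rewrite in_itv.
rewrite tjet0 -E /ode !tjet0 tjet1; congr (_ * _ + _ + _); rewrite /tjet mulrC divfK //.
Qed.

Let U := C / r0.

(** The sum of the bounds for [f], for [u] and for [s] times its slope, all of which [ode_jet_bound]
    requires below its constant. *)
Definition solution_const := C + U + 2 * (8 * U + C * U + C).

Lemma solution_bounds : [/\ forall x, 0 < x < 1 -> `|tjet u 0 x| <= U,
  0 <= solution_const &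
  forall K, 2 * G <= K -> 4 * C + 2 <= K ->
    forall n x, 0 < x < 1 -> `|tjet u n x| <= solution_const * K ^+ n * growth s n].
Proof.
have [cu u0 u1 _] := hu; have [ju E rec] := solution_jet; have [s0 s1] := andP s01.
have C0 := jbound_ge0 bb.
have hU x : 0 < x < 1 -> `|tjet u 0 x| <= U.
  move=> /andP[/ltW x0 /ltW x1].
  apply: (@solution_sup R s e (tjet b) (tjet r) (tjet f)) => //; rewrite ?tjet0 ?x0 //.
  by move=> y y01; rewrite -[f]tjet0; exact: jbound0 bf y01.
have U0 : 0 <= U by rewrite divr_ge0 // ltW.
have V0 : 0 <= 2 * (8 * U + C * U + C).
  by do ![done | apply: addr_ge0 | apply: mulr_ge0].
have A0 : 0 <= solution_const by rewrite !addr_ge0.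
split => // K GK CK n x x01.
apply: (@ode_jet_bound R s e (tjet b) (tjet r) (tjet f) (tjet u) C G) => //.
- by move=> k; exact: bb.
- by move=> k; exact: br.
- by move=> k; exact: bf.
- by rewrite /solution_const -addrA lerDl addr_ge0.
- apply: (le_trans (hU x x01)); rewrite /solution_const addrAC lerDr addr_ge0 //.
- apply: (@le_trans _ _ (2 * (8 * U + C * U + C))); last by rewrite lerDr addr_ge0.
  apply: (@solution_slope R s e (tjet b) (tjet r) (tjet f)) => //.
  + by case/andP: es.
  + by move=> y; exact: jbound0 bb.
  + by move=> y; exact: jbound0 br.
  + by move=> y; exact: jbound0 bf.
- by move=> k; exact: rec.
Qed.

Lemma tjet_bdcont n : bdcont 0 1 (tjet u n).
Proof.
have [ju _ _] := solution_jet; have [_ _ H] := solution_bounds.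
split=> [x x01|]; first exact: jet_cont ju x01.
exists (solution_const * (2 * G + (4 * C + 2)) ^+ n * growth s n) => x.
have C0 := jbound_ge0 bb.
by apply: H; rewrite ?lerDl ?lerDr ?addr_ge0 ?mulr_ge0.
Qed.

Context (K g kap be sg1 C1 sg2 C2 : R) (p M : nat).
Context (hap1 : approximable (2 * K) sg1 C1) (C10 : 0 <= C1).
Context (hap2 : approximable (2 * g) sg2 C2) (C20 : 0 <= C2).
Context (K0 : 0 < K) (GK : 2 * G <= K) (CK : 4 * C + 2 <= K).
Context (g1 : 1 <= 2 * g) (Gg : 2 * G <= g) (CGg : 4 * C * G <= r0 * g).
Context (kap1 : 0 < kap <= 1) (kap2 : kap <= sg1 / 4).
Context (be0 : 0 < be) (beC : be ^+ 2 + be * C <= r0).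
Let hkap : 0 < kap <= sg1 / 4.
Proof. by case/andP: kap1 => ->. Qed.
(** The error budget: approximation on the layers [dl], truncation of the expansion [pz],
    approximation of its sum [d2], distance [dz] from the solution to that sum at the layer points,
    slope mismatch [bl]. In [bl] the layer width [kap * p * s] multiplies a slope bounded only after
    multiplication by [s], which leaves [kap * p]. *)
Let dl := C1 * (6 * solution_const) * expR (- (sg1 / 2) * p%:R).
Let pz := 2 * C ^+ 2 / r0 * expR (- M%:R).
Let d2 := C2 * (4 * C / r0) * expR (- sg2 * p%:R).
Let dz := pz / r0 + 4 * (U + 4 * C / r0) * expR (- (be * kap / 2) * p%:R).
Let bl := kap * p%:R * (d2 + 2 * (4 * dz / kap + C * dz + pz)).
Notation residual S x := (strong_form b r (s ^+ 2) e S x - f x).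

Lemma interpolant_one : (0 < p)%N -> 1 / 2 <= kap * p%:R * s ->
  exists S : {poly R}, [/\ (size S <= p.+1)%N, S.[0] = 0, S.[1] = 0 &
    forall x, 0 < x < 1 -> `|residual S x| <= (1 + 2 * C) * (3 * dl)].
Proof.
move=> p0 kps; have [s0 s1] := andP s01.
have [ju E _] := solution_jet; have [_ A0 cb] := solution_bounds.
have [cu u0 u1 _] := hu.
have [|||S [sS S0 S1 hS]] := single_element s0 es K0 hap1 C10 A0 ju (cb K GK CK) hkap
  (fun x => jbound0 bb (x := x)) (fun x => jbound0 br (x := x)) s1 p0.
- by move: kps; lra.
- by rewrite tjet0 -[X in _ --> X]u0; apply: within_cvg_right => //; rewrite lexx ltr01.
- by rewrite tjet0 -[X in _ --> X]u1; apply: within_cvg_left => //; rewrite lexx ltr01.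
- by exists S; split => // x x01; have := hS x x01; rewrite E // !tjet0.
Qed.

Lemma interpolant_three (h := kap * p%:R * s) : (1 < p)%N -> h < 1 / 2 ->
  2 / r0 * ((8 * g * (M%:R * s)) ^+ 2 + 2 * C * (8 * g * (M%:R * s))) <= expR (-1) ->
  exists S0 Q S2 : {poly R}, [/\ [/\ (size S0 <= p.+1)%N, (size Q <= p.+1)%N & (size S2 <= p.+1)%N],
    [/\ S0.[0] = 0, S0.[h] = Q.[h] & S0^`().[h] = Q^`().[h]],
    [/\ S2.[1] = 0, S2.[1 - h] = Q.[1 - h] & S2^`().[1 - h] = Q^`().[1 - h]],
    forall x, 0 < x < 1 -> `|residual Q x| <= (1 + 2 * C) * d2 + pz &
    let rl := (kap^-1 ^+ 2 + C * kap^-1 + C) * (7 * dl + 2 * (d2 + dz) + 2 * bl) in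
    (forall x, 0 < x < h -> `|residual S0 x| <= rl) /\
    (forall x, 1 - h < x < 1 -> `|residual S2 x| <= rl)].
Proof.
move=> p1 h12 hX; have [s0 s1] := andP s01; have [ka0 ka1] := andP kap1.
have [ju E _] := solution_jet; have [hU A0 cb] := solution_bounds.
have [cu u0 u1 _] := hu.
have p0 : (0 < p)%N by exact: ltnW.
have pr : 1 <= p%:R :> R by rewrite ler1n.
have h0 : 0 < h by rewrite /h !mulr_gt0 // ltr0n.
have hr' x : 0 < x < 1 -> r0 <= tjet r 0 x by rewrite tjet0; exact: hr.
have [Q [sQ hQ hend]] := smooth_inner s0 es eC s1 r00 G0 g1 Gg CGg jb jr jf bb br bf
  hr' hX hap2 C20 ju E hU be0 beC p0 kap1.
rewrite -/pz -/d2 -/dz in hQ hend.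
(* One argument for both layers: [m = 0] with [k = h], and [m = 1] with [k = - h]. *)
have layer m k : `|k| = h -> (forall t, 0 < t < 1 -> 0 < m + k * t < 1) -> 0 < m + k < 1 ->
    tjet u 0 (m + k * t) @[t --> 0^'+] --> 0 ->
    kap * p%:R * s <= m + k <= 1 - kap * p%:R * s ->
    exists S : {poly R}, [/\ (size S <= p.+1)%N, S.[m] = 0, S.[m + k] = Q.[m + k],
      S^`().[m + k] = Q^`().[m + k] & forall t, 0 < t < 1 ->
      `|residual S (m + k * t)| <=
       (kap^-1 ^+ 2 + C * kap^-1 + C) * (7 * dl + 2 * (d2 + dz) + 2 * bl)].
  move=> kh hm mk c00 /hend [b0 b1].
  have k01 : 0 < `|k| <= 1 by rewrite kh h0 /=; lra.
  have kps : `|k| <= 2 * kap * p%:R * s by rewrite kh; have := h0; rewrite /h; lra.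
  have sk : s / `|k| <= kap^-1.
    by rewrite kh ler_pdivrMr // /h !mulrA mulVf ?gt_eqF // mul1r ler_peMl // (ltW s0).
  have b1' : `|k| * `|tjet u 1 (m + k) - Q^`().[m + k]| <= bl.
    rewrite kh /h -[X in X <= _]mulrA /bl; apply: ler_wpM2l => //.
    by apply: mulr_ge0 => //; exact: ltW.
  have [S [sS S0 S1 S1' hS]] := layer_element s0 es K0 hap1 C10 A0 ju (cb K GK CK) hkap
    (fun x => jbound0 bb (x := x)) (fun x => jbound0 br (x := x)) p1 k01 kps sk hm mk c00 b0 b1'.
  by exists S; split => // t t01; have := hS t t01; rewrite E ?hm // !tjet0.
have hh1 t : 0 < t < 1 -> 0 < h * t < h.
  by move=> /andP[t0 t1]; rewrite mulr_gt0 //= gtr_pMr.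
have [t t01||||S0 [s0' S00 S0h S0h' hS0]] := layer 0 h (gtr0_norm h0).
- by rewrite add0r; have := hh1 t t01; lra.
- by lra.
- rewrite tjet0 -[X in _ --> X]u0.
  apply: (cvg_comp _ _ (@affine_cvg_right _ 0 h h0)).
  by apply: within_cvg_right => //; rewrite lexx ltr01.
- by rewrite -/h; lra.
have nh : `|- h| = h by rewrite normrN gtr0_norm.
have [t t01||||S2 [s2' S21 S2h S2h' hS2]] := layer 1 (- h) nh.
- by have := hh1 t t01; lra.
- by lra.
- rewrite tjet0 -[X in _ --> X]u1.
  apply: (cvg_comp _ _ (@affine_cvg_left _ 1 (- h) _)); first by rewrite oppr_lt0.
  by apply: within_cvg_left => //; rewrite lexx ltr01.
- by rewrite -/h; lra.
rewrite add0r in S0h S0h'.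
exists S0, Q, S2; split => //.
- by move=> x x01; have := hQ x x01; rewrite !tjet0.
split=> x /andP[x0 x1].
  have -> : x = 0 + h * (x / h) by rewrite add0r mulrC divfK // gt_eqF.
  by apply: hS0; rewrite divr_gt0 //= ltr_pdivrMr // mul1r.
have -> : x = 1 + (- h) * ((1 - x) / h) by field; rewrite gt_eqF.
apply: hS2; rewrite divr_gt0 ?subr_gt0 //= ltr_pdivrMr // mul1r; lra.
Qed.

End Regular.

(** * Choice of the constants and exponential convergence *)

Section Constants.
Context {R : realType}.
Implicit Types (C g kap s sg : R) (p M : nat).

(** Half of the rate is spent on the factor [p] of the slope mismatch, by
    [sg * p <= expR (sg * p)]. *)
Lemma expR_absorb sg p : 0 < sg ->
  p%:R * expR (- (2 * sg) * p%:R) <= expR (- sg * p%:R) / sg.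
Proof.
move=> s0; rewrite ler_pdivlMr //.
have -> : - (2 * sg) * p%:R = - sg * p%:R + - sg * p%:R by ring.
rewrite expRD mulrAC mulrA mulrC ger_pMr ?expR_gt0 //.
have h := expR_ge1Dx (sg * p%:R); have h' := expRxMexpNx_1 (sg * p%:R).
have h1 : sg * p%:R <= expR (sg * p%:R) by lra.
rewrite mulNr -[leRHS]h'; apply: ler_wpM2r; first exact: expR_ge0.
by rewrite mulrC.
Qed.

(** As [kap * p * s < 1 / 2] on three elements, [M <= tau * p] bounds [M * s] independently of [s]
    and [p]. With [X0] as chosen, the left-hand side is then at most [1 / 4 <= expR (-1)]. *)
Lemma truncation_small C g kap s (r0 tau : R) M p : 0 <= C -> 0 < g -> 0 < r0 -> 0 < kap -> 0 < s ->
  let X0 := r0 / (8 * (1 + 2 * C) + r0) in tau = X0 * kap / (4 * g) ->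
  M%:R <= tau * p%:R -> kap * p%:R * s < 1 / 2 ->
  2 / r0 * ((8 * g * (M%:R * s)) ^+ 2 + 2 * C * (8 * g * (M%:R * s))) <= expR (-1).
Proof.
move=> C0 g0 r00 k0 s0 X0 tE hM hs.
have dn0 : 0 < 8 * (1 + 2 * C) + r0 by lra.
have X00 : 0 <= X0 by rewrite divr_ge0 // ltW.
have X01 : X0 <= 1 by rewrite ler_pdivrMr // mul1r lerDr !(mulr_ge0, addr_ge0).
set X := 8 * g * (M%:R * s).
have Xp : 0 <= X by rewrite /X !mulr_ge0 // ltW.
have XX : X <= X0.
  have h1 : M%:R * s <= tau * p%:R * s by rewrite ler_wpM2r // ltW.
  have h2 : X <= 8 * g * (tau * p%:R * s) by rewrite /X ler_wpM2l // mulr_ge0 // ltW.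
  apply: (le_trans h2).
  have -> : 8 * g * (tau * p%:R * s) = X0 * (2 * (kap * p%:R * s)).
    by rewrite tE; field; rewrite gt_eqF.
  by rewrite ler_piMr //; lra.
have h1 : X ^+ 2 + 2 * C * X <= X0 * (1 + 2 * C).
  have : X ^+ 2 <= X0 * 1 by rewrite expr2 ler_pM // (le_trans XX).
  have : C * X <= C * X0 by rewrite ler_wpM2l.
  lra.
apply: (le_trans (ler_wpM2l _ h1)); first by rewrite divr_ge0 // ltW.
have h2 : 2 / r0 * (X0 * (1 + 2 * C)) <= 1 / 4.
  have -> : 2 / r0 * (X0 * (1 + 2 * C)) = 2 * (1 + 2 * C) / (8 * (1 + 2 * C) + r0).
    by rewrite /X0; field; rewrite !gt_eqF.
  rewrite ler_pdivrMr //; lra.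
apply: (le_trans h2).
have := expRxMexpNx_1 (1 : R); have := @expR1_le4 R; have := expR_gt0 (-1 : R); nra.
Qed.

(** The quantities multiplied by [p] through [bl] decay like [F], at twice the rate of [E], so that
    [E] remains after [expR_absorb]; [dl] is not among them and needs only [E]. *)
Lemma total_residual C kap sg (r0 U k1 k2 kp dl d2 pz ez : R) p :
  let E := expR (- sg * p%:R) in let F := expR (- (2 * sg) * p%:R) in
  0 <= C -> 0 < r0 -> 0 < kap -> 0 <= U -> 0 < sg -> 0 <= k1 -> 0 <= k2 -> 0 <= kp ->
  dl <= k1 * E -> d2 <= k2 * F -> pz <= kp * F -> ez <= F ->
  let dz := pz / r0 + 4 * (U + 4 * C / r0) * ez in
  let bl := kap * p%:R * (d2 + 2 * (4 * dz / kap + C * dz + pz)) in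
  let kd := kp / r0 + 4 * (U + 4 * C / r0) in
  let kl := kap * (k2 + 2 * (4 * kd / kap + C * kd + kp)) / sg in
  (kap^-1 ^+ 2 + C * kap^-1 + C) * (7 * dl + 2 * (d2 + dz) + 2 * bl) <=
    (kap^-1 ^+ 2 + C * kap^-1 + C) * (7 * k1 + 2 * (k2 + kd) + 2 * kl) * E /\
  (1 + 2 * C) * d2 + pz <= ((1 + 2 * C) * k2 + kp) * E.
Proof.
move=> E F C0 r00 ka0 U0 sg0 k10 k20 kp0 hdl hd2 hpz hez dz bl kd kl.
have F0 : 0 <= F by exact: expR_ge0.
have FE : F <= E.
  rewrite ler_expR ler_wpM2r // lerN2; lra.
have Cr : 0 <= 4 * (U + 4 * C / r0).
  by apply: mulr_ge0 => //; apply: addr_ge0 => //; apply: divr_ge0; [exact: mulr_ge0 | exact: ltW].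
have kd0 : 0 <= kd by apply: addr_ge0 => //; apply: divr_ge0 => //; exact: ltW.
have hdz : dz <= kd * F.
  rewrite /dz /kd [leRHS]mulrDl; apply: lerD; last exact: ler_wpM2l.
  by rewrite mulrAC ler_wpM2r // invr_ge0 ltW.
have hd2E : d2 <= k2 * E by apply: (le_trans hd2); exact: ler_wpM2l.
have hdzE : dz <= kd * E by apply: (le_trans hdz); exact: ler_wpM2l.
have hpzE : pz <= kp * E by apply: (le_trans hpz); exact: ler_wpM2l.
have hbl : bl <= kl * E.
  pose kQ := k2 + 2 * (4 * kd / kap + C * kd + kp).
  have kk : 0 <= 4 / kap by apply: divr_ge0 => //; exact: ltW.
  have kQ0 : 0 <= kQ.
    apply: addr_ge0 => //; apply: mulr_ge0 => //; apply: addr_ge0 => //.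
    by apply: addr_ge0; [rewrite mulrAC; exact: mulr_ge0 | exact: mulr_ge0].
  have hq : d2 + 2 * (4 * dz / kap + C * dz + pz) <= kQ * F.
    have e1 := ler_wpM2l kk hdz; have e2 := ler_wpM2l C0 hdz.
    rewrite /kQ [4 * dz / kap]mulrAC [4 * kd / kap]mulrAC; lra.
  have kp' : 0 <= kap * p%:R by apply: mulr_ge0 => //; exact: ltW.
  apply: (le_trans (ler_wpM2l kp' hq)).
  have -> : kap * p%:R * (kQ * F) = kap * kQ * (p%:R * F) by ring.
  have -> : kl * E = kap * kQ * (E / sg) by rewrite /kl /kQ; field; rewrite !gt_eqF.
  apply: ler_wpM2l; last exact: expR_absorb.
  by apply: mulr_ge0 => //; exact: ltW.
split.
  rewrite -[leRHS]mulrA; apply: ler_wpM2l; last by lra.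
  have ki : 0 <= kap^-1 by rewrite invr_ge0 ltW.
  by apply: addr_ge0 => //; apply: addr_ge0; [exact: exprn_ge0 | exact: mulr_ge0].
have : C * d2 <= C * (k2 * E) by exact: ler_wpM2l.
lra.
Qed.

Lemma jet_bdcont A (g : R) c n : jet 0 1 c -> jbound 0 1 A g c -> bdcont 0 1 (c n).
Proof.
move=> cj cb; split=> [x x01|]; first exact: jet_cont cj x01.
by exists (A * g ^+ n) => x; exact: cb.
Qed.

Lemma sum4_ge (x y z t : R) : 0 <= x -> 0 <= y -> 0 <= z -> 0 <= t ->
  [/\ x <= x + y + z + t, y <= x + y + z + t, z <= x + y + z + t & t <= x + y + z + t].
Proof. by split; lra. Qed.

(** Coercivity bounds only [r - e / 2 * b'] from below; the smallness of [e] leaves half of [gam]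
    for [r] itself. *)
Lemma reaction_lower (gam rx b1 e B : R) : gam <= rx - e / 2 * b1 -> 0 <= e -> `|b1| <= B ->
  e * B <= gam -> gam / 2 <= rx.
Proof.
move=> h1 e0; rewrite ler_norml => /andP[h2 _] h3.
have := ler_wpM2l e0 h2; lra.
Qed.

End Constants.

Ltac nonneg := repeat first [assumption | apply: ltW; assumption | exact: ler0n |
  exact: expR_ge0 | apply: addr_ge0 | apply: mulr_ge0 | apply: divr_ge0 |
  apply: exprn_ge0 | rewrite invr_ge0 | done].

Theorem proposition2 (R : realType) (b r f : R -> R)
    (C0 gam_b gam_r gam_f gam : R)
    (hC0 : 0 < C0) (hgam_b : 0 < gam_b) (hgam_r : 0 < gam_r)
    (hgam_f : 0 < gam_f) (hgam : 0 < gam)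
    (b_analytic : analytic01 C0 gam_b b)
    (r_analytic : analytic01 C0 gam_r r)
    (f_analytic : analytic01 C0 gam_f f)
    (b_pos : forall x : R, x \in `[0, 1] -> 0 < b x)
    (r_nonneg : forall x : R, x \in `[0, 1] -> 0 <= r x) :
  exists c0 kappa sigma C : R,
    [/\ 0 < c0 < 1, 0 < kappa, 0 < sigma, 0 < C &
     forall (p : nat) (eps1 eps2 : R),
       (1 <= p)%N -> 0 < eps1 < 1 -> 0 < eps2 <= 1 ->
       (forall x : R, x \in `]0, 1[ -> gam <= r x - eps2 / 2 * derive1 b x) ->
       eps2 ^+ 2 <= c0 * eps1 ->
       let w := BL_mesh kappa p eps1 in
       forall (u : R -> R) (u_p : wgfun w),
         bvp_solution eps1 eps2 b r f u ->
         wg_solution eps1 eps2 b r p f u_p ->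
         wgnorm eps1 eps2 b p (of_H1 w u - u_p) <= C * expR (- sigma * p%:R)].
Proof.
pose G := gam_b + gam_r + gam_f; have G0 : 0 < G by rewrite !addr_gt0.
have C00 : 0 <= C0 by exact: ltW.
have jW (h : R -> R) gh : analytic01 C0 gh h -> 0 < gh -> gh <= G ->
    jet 0 1 (tjet h) /\ jbound 0 1 C0 G (tjet h).
  move=> /analytic_jet [jh bh] gh0 ghG; split => //.
  by apply: jboundW bh => //; exact: ltW.
have [jb bb] := jW _ _ b_analytic hgam_b ltac:(by rewrite /G -addrA lerDl addr_ge0 // ltW).
have [jr br] := jW _ _ r_analytic hgam_r ltac:(by rewrite /G addrAC lerDr addr_ge0 // ltW).
have [jf bf] := jW _ _ f_analytic hgam_f ltac:(by rewrite /G lerDr addr_ge0 // ltW).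
pose r0 := gam / 2; have r00 : 0 < r0 by rewrite divr_gt0.
(* The summands yield, for [th = dn^-1], the bounds [th <= 1 / 2], [th * C0 <= 1 / 2] for the slope
   estimate, and [th * (C0 * G) <= gam] for the lower bound of [r]. *)
pose dn := 2 + 2 * C0 + C0 * G / gam.
have CG0 : 0 <= C0 * G / gam by rewrite divr_ge0 ?mulr_ge0 ?ltW.
have dn0 : 0 < dn by rewrite /dn; lra.
pose th := dn^-1; have th0 : 0 < th by rewrite invr_gt0.
have th1 : th * 2 <= 1 by rewrite mulrC ler_pdivrMr // mul1r /dn; lra.
have th11 : th <= 1 by lra.
have th21 : th ^+ 2 < 1 by rewrite expr2; nra.
have thC : th * C0 <= 1 / 2 by rewrite mulrC ler_pdivrMr // /dn; lra.
have thG : th * (C0 * G) <= gam.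
  rewrite mulrC ler_pdivrMr //.
  have -> : gam * dn = gam * (2 + 2 * C0) + C0 * G by rewrite /dn; field; rewrite gt_eqF.
  by rewrite lerDr mulr_ge0 ?ltW // addr_gt0 // mulr_gt0.
pose g := 1 + 2 * G + 4 * C0 * G / r0.
have cg0 : 0 <= 4 * C0 * G / r0 by rewrite divr_ge0 ?mulr_ge0 ?ltW.
have g1 : 1 <= g by rewrite /g; lra.
have g0 : 0 < g by lra.
have g2 : 1 <= 2 * g by lra.
have Gg : 2 * G <= g by rewrite /g; lra.
have CGg : 4 * C0 * G <= r0 * g.
  have -> : r0 * g = r0 * (1 + 2 * G) + 4 * C0 * G by rewrite /g; field; rewrite gt_eqF.
  by rewrite lerDr mulr_ge0 ?ltW // addr_gt0 // mulr_gt0.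
pose K := 1 + 2 * G + (4 * C0 + 2).
have K0 : 1 <= K by rewrite /K; lra.
have GK : 2 * G <= K by rewrite /K; lra.
have CK : 4 * C0 + 2 <= K by rewrite /K; lra.
have [|sg1 [C1 [sg10 C10 hap1]]] := @approx_analytic2 R (2 * K); first lra.
have [|sg2 [C2 [sg20 C20 hap2]]] := @approx_analytic2 R (2 * g); first lra.
(* [sg1] comes from [K], hence from the data alone, so the choice is not circular; half of the
   approximation rate is left on the layers. *)
pose kap := Num.min 1 (sg1 / 4).
have ka0 : 0 < kap by rewrite lt_min ltr01 divr_gt0.
have ka1 : 0 < kap <= 1 by rewrite ka0 ge_min lexx.
have ka2 : kap <= sg1 / 4 by rewrite ge_min lexx orbT.
(* Then [be <= 1] and [be * (1 + C0) <= r0]. *)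
pose be := r0 / (1 + C0 + r0).
have be0 : 0 < be by rewrite divr_gt0 // !addr_gt0.
have beC : be ^+ 2 + be * C0 <= r0.
  have b1 : be <= 1 by rewrite ler_pdivrMr ?mul1r ?lerDr ?addr_ge0 // !addr_gt0.
  have b2 : be * (1 + C0 + r0) = r0 by rewrite divfK // gt_eqF // !addr_gt0.
  have b3 : be ^+ 2 <= be by rewrite expr2 ler_piMr // ltW.
  have b4 : 0 <= be * r0 by rewrite mulr_ge0 // ltW.
  lra.
pose X0 := r0 / (8 * (1 + 2 * C0) + r0).
pose tau := X0 * kap / (4 * g).
have X00 : 0 < X0 by rewrite divr_gt0 // !(addr_gt0, mulr_gt0).
have tau0 : 0 < tau by do ![done | apply: divr_gt0 | apply: mulr_gt0].
(* The layer approximation is used at the rate [sg]; the other three errors meet the factor [p] and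
   are needed at the rate [2 * sg]. *)
pose sg := Num.min (Num.min (sg1 / 2) (sg2 / 2)) (Num.min (tau / 2) (be * kap / 4)).
have sg0 : 0 < sg by rewrite !lt_min -andbA; apply/and4P; split; do ![done | apply: divr_gt0 | apply: mulr_gt0].
have sgE1 : sg <= sg1 / 2 by rewrite !ge_min lexx.
have sgE2 : sg <= sg2 / 2 by rewrite !ge_min lexx orbT.
have sgE3 : sg <= tau / 2 by rewrite !ge_min lexx !orbT.
have sgE4 : sg <= be * kap / 4 by rewrite !ge_min lexx !orbT.
have sg22 : 2 * sg <= sg2 by lra.
have sgt2 : 2 * sg <= tau by lra.
have sgb2 : 2 * sg <= be * kap / 2 by lra.
pose U := C0 / r0.
have U0 : 0 <= U by rewrite divr_ge0 // ltW.
pose A := solution_const C0 r0.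
have A0 : 0 <= A by rewrite /A /solution_const -/U; nonneg.
(* The last factor 4 of [kp] bounds [expR 1], lost when [tau * p] is rounded down to [M]. *)
pose k1 := C1 * (6 * A); pose k2 := C2 * (4 * C0 / r0); pose kp := 2 * C0 ^+ 2 / r0 * 4.
have k10 : 0 <= k1 by rewrite /k1; nonneg.
have k20 : 0 <= k2 by rewrite /k2; nonneg.
have kp0 : 0 <= kp by rewrite /kp; nonneg.
pose kd := kp / r0 + 4 * (U + 4 * C0 / r0).
pose kl := kap * (k2 + 2 * (4 * kd / kap + C0 * kd + kp)) / sg.
have kd0 : 0 <= kd by rewrite /kd; nonneg.
have kl0 : 0 <= kl by rewrite /kl; nonneg.
(* One constant for each residual: [p = 1], the single element, the layer elements, the inner
   element. The factor [expR sg] cancels the exponential at [p = 1]. *)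
pose c1 := C0 * expR sg; pose c2 := (1 + 2 * C0) * (3 * k1).
pose c3 := (kap^-1 ^+ 2 + C0 * kap^-1 + C0) * (7 * k1 + 2 * (k2 + kd) + 2 * kl).
pose c4 := (1 + 2 * C0) * k2 + kp.
have c10 : 0 < c1 by rewrite mulr_gt0 // expR_gt0.
have c20 : 0 <= c2 by rewrite /c2; nonneg.
have c30 : 0 <= c3 by rewrite /c3; nonneg.
have c40 : 0 <= c4 by rewrite /c4; nonneg.
pose rc := c1 + c2 + c3 + c4.
have [rc1 rc2 rc3 rc4] : [/\ c1 <= rc, c2 <= rc, c3 <= rc & c4 <= rc].
  by apply: sum4_ge => //; exact: ltW.
have rc0 : 0 < rc by exact: lt_le_trans rc1.
have gg0 : 0 < 2 + 2 / gam by rewrite addr_gt0 // divr_gt0.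
exists (th ^+ 2), kap, sg, ((2 + 2 / gam) * rc); split => //.
- by rewrite exprn_gt0.
- exact: mulr_gt0.
move=> p eps1 eps2 p1 /andP[e10 e11] /andP[e20 e21] hgm he w u u_p hu hup.
have [s [s0 sE e1E]] : exists s, [/\ 0 < s, Num.sqrt eps1 = s & eps1 = s ^+ 2].
  by exists (Num.sqrt eps1); rewrite sqrtr_gt0 sqr_sqrtr // ltW.
have s1 : s <= 1 by rewrite -sE -(sqrtr1 R) ler_wsqrtr // ltW.
have s01 : 0 < s <= 1 by rewrite s0.
have e2th : eps2 <= th * s.
  have ths : 0 <= th * s by nonneg.
  by rewrite -(@ler_pXn2r _ 2%N) ?nnegrE ?(ltW e20) // exprMn -e1E.
have es : 0 <= eps2 <= s.
  rewrite ltW //=; apply: (le_trans e2th); by rewrite ler_piMl // ltW.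
have eC : eps2 * C0 <= s / 2.
  apply: (le_trans (ler_wpM2r C00 e2th)); rewrite mulrAC.
  by apply: (le_trans (ler_wpM2r (ltW s0) thC)); rewrite mulrC div1r.
have hb1 (x : R) : 0 < x < 1 -> `|tjet b 1 x| <= C0 * G by move=> x01; have := bb 1%N x x01; rewrite expr1.
have hg1 (x : R) : 0 < x < 1 -> gam <= r x - eps2 / 2 * tjet b 1 x.
  by move=> x01; rewrite tjet1; apply: hgm; rewrite in_itv.
have hr (x : R) : 0 < x < 1 -> r0 <= r x.
  move=> x01; apply: reaction_lower (hg1 x x01) (ltW e20) (hb1 x x01) _.
  apply: (le_trans _ thG); rewrite ler_wpM2r ?mulr_ge0 ?(ltW G0) //.
  by apply: (le_trans e2th); rewrite ler_piMr // ltW.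
have hu2 : bvp_solution (s ^+ 2) eps2 b r f u by rewrite -e1E.
have [ju odeu _] := solution_jet s01 jb jr jf hu2.
have bu n := tjet_bdcont s01 es eC r00 (ltW G0) jb jr jf bb br bf hr hu2 n.
have [cu u0 u1 _] := hu.
have [cb _ _] := b_analytic.
have db (x : R) : 0 < x < 1 -> is_derive x 1 b (tjet b 1 x).
  by move=> x01; have := jet_der0 jb x01; rewrite tjet0.
have du (x : R) : 0 < x < 1 -> is_derive x 1 u (tjet u 1 x).
  by move=> x01; have := jet_der0 ju x01; rewrite tjet0.
have du1 (x : R) : 0 < x < 1 -> is_derive x 1 (tjet u 1) (2 * tjet u 2 x).
  by move=> x01; exact: jet_der1 ju x01.
have bu2 : bdcont 0 1 (fun x => 2 * tjet u 2 x) by apply: bdcontM; [exact: bdcont_cst | exact: bu].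
have bb1 : bdcont 0 1 (tjet b 1) by exact: jet_bdcont jb bb.
have brr : bdcont 0 1 r by rewrite -[r]tjet0; exact: jet_bdcont jr br.
have bff : bdcont 0 1 f by rewrite -[f]tjet0; exact: jet_bdcont jf bf.
have bpos (x : R) : 0 <= x <= 1 -> 0 < b x by move=> x01; apply: b_pos; rewrite in_itv.
have Lu (x : R) : 0 < x < 1 -> - eps1 * (2 * tjet u 2 x) + eps2 * b x * tjet u 1 x + r x * u x = f x.
  by move=> x01; have := odeu x x01; rewrite /ode !tjet0 e1E.
pose E := expR (- sg * p%:R).
have E0 : 0 < E by exact: expR_gt0.
have hm : is_mesh w by apply: BL_meshP.
have rcE c : c <= rc -> c * E <= rc * E by move=> h; rewrite ler_wpM2r // ltW.
have rE0 : 0 <= rc * E by rewrite mulr_ge0 // ltW.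
rewrite -[leRHS]mulrA -/E.
have [p2|p2] := leqP p 1.
  apply: (galerkin_error_zero cb db bb1 brr bff bpos _ e10 e20 hgam rE0 hg1 cu u0 u1 du du1 (bu 1%N) bu2 Lu hm _ hup) => // x x01.
  have pE : p = 1%N by apply/eqP; rewrite eqn_leq p2 p1.
  have EE : E = expR (- sg) by rewrite /E pE mulr1.
  have hf : `|f x| <= C0 by rewrite -[f]tjet0; exact: jbound0 bf x01.
  apply: (le_trans hf); apply: (@le_trans _ _ (c1 * E)).
    by rewrite EE /c1 -mulrA expRxMexpNx_1 mulr1.
  exact: rcE.
have hdl : C1 * (6 * A) * expR (- (sg1 / 2) * p%:R) <= k1 * E.
  by rewrite /k1 ler_wpM2l // ler_expR ler_wpM2r // lerN2.
move: hm u_p hup; rewrite /w /BL_mesh sE; case: (leP (1 / 2) (kap * p%:R * s)) => hs hm u_p hup.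
  have [S [sS S0 S1 hS]] := interpolant_one s01 es eC r00 (ltW G0) jb jr jf bb br bf hr hu2
    hap1 (ltW C10) (lt_le_trans ltr01 K0) GK CK ka1 ka2 p1 hs.
  apply: (galerkin_error_one cb db bb1 brr bff bpos _ e10 e20 hgam rE0 hg1 cu u0 u1 du du1 (bu 1%N) bu2 Lu hm sS S0 S1 _ hup) => // x x01.
  rewrite e1E; apply: (le_trans (hS x x01)).
  apply: (@le_trans _ _ (c2 * E)); last exact: rcE.
  have -> : c2 * E = (1 + 2 * C0) * (3 * (k1 * E)) by rewrite /c2; ring.
  apply: ler_wpM2l; first by nonneg.
  exact: ler_wpM2l.
(* The longest expansion that [truncation_small] allows. *)
pose M := Num.truncn (tau * p%:R).
have tp0 : 0 <= tau * p%:R by rewrite mulr_ge0 // ltW.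
have hM1 : M%:R <= tau * p%:R by rewrite truncn_le.
have hM2 : tau * p%:R <= M%:R + 1 by rewrite natr1 ltW // truncnS_gt.
pose F := expR (- (2 * sg) * p%:R).
have hX := truncation_small C00 g0 r00 ka0 s0 (erefl tau) hM1 hs.
have [S0 [Q [S2 [[sS0 sQ sS2] [S00 S0h S0h'] [S21 S2h S2h'] hQ /= [hS0 hS2]]]]] :=
  interpolant_three s01 es eC r00 (ltW G0) jb jr jf bb br bf hr hu2 hap1 (ltW C10) hap2 (ltW C20)
   (lt_le_trans ltr01 K0) GK CK g2 Gg CGg ka1 ka2 be0 beC p2 hs hX.
have hd2 : C2 * (4 * C0 / r0) * expR (- sg2 * p%:R) <= k2 * F.
  by rewrite /k2 ler_wpM2l // ler_expR ler_wpM2r // lerN2.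
have hpz : 2 * C0 ^+ 2 / r0 * expR (- M%:R) <= kp * F.
  rewrite /kp -[leRHS]mulrA; apply: ler_wpM2l.
    by apply: divr_ge0; [apply: mulr_ge0 => //; exact: exprn_ge0 | exact: ltW].
  apply: (@le_trans _ _ (expR (1 + - (2 * sg) * p%:R))).
    rewrite ler_expR mulNr addrC -lerNl opprD opprK lerBlDr.
    by apply: le_trans hM2; rewrite ler_wpM2r.
  by rewrite expRD ler_wpM2r ?expR_ge0 // expR1_le4.
have hez : expR (- (be * kap / 2) * p%:R) <= F.
  by rewrite ler_expR ler_wpM2r // lerN2.
have [hl hi] := @total_residual R _ _ _ _ _ _ _ _ _ _ _ _ p C00 r00 ka0 U0 sg0 k10 k20 kp0 hdl hd2 hpz hez.
have rl c : c <= c3 * E -> c <= rc * E by move=> h; apply: (le_trans h); exact: rcE.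
have ri c : c <= c4 * E -> c <= rc * E by move=> h; apply: (le_trans h); exact: rcE.
apply: (galerkin_error_three cb db bb1 brr bff bpos _ e10 e20 hgam rE0 hg1 cu u0 u1 du du1 (bu 1%N) bu2 Lu hm _
  sS0 sQ sS2 S00 S0h S0h' S21 S2h S2h' _ _ _ hup) => //.
- by rewrite hs andbT !mulr_gt0 // ltr0n.
- by move=> x x01; rewrite e1E; apply/rl/(le_trans _ hl)/hS0.
- by move=> x x01; rewrite e1E; apply/ri/(le_trans _ hi)/hQ.
- by move=> x x01; rewrite e1E; apply/rl/(le_trans _ hl)/hS2.
Qed.
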